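(* Let $r>1$ be an integer and let $\chi_1,\chi_2$ be any Dirichlet characters modulo $r$. For $\mathrm{Re}(z)>0$, $x>0$, and $\delta$ such that $0<\delta<\min\left(\frac{2\pi}{r},\frac{2\pi}{rx}\right)$, $$J_{r,\chi_1,\chi_2}(z,x)+x^{1-z}J_{r,\chi_2,\chi_1}\!\left(z,\frac1x\right)=-\sum_{c=1}^{r-1}\sum_{d=1}^{r-1}\chi_1(c)\chi_2(d)\,\mathbb{W}_{c,d}(z,x),$$ where $$\begin{aligned}\mathbb{W}_{c,d}(z,x)&=\frac{1}{\Gamma(z-1)}\sum_{n=1}^{\infty}\sum_{m=1}^{\infty}\frac{e^{2\pi i mc/r}\,e^{2\pi i nd/r}}{mn(n+mx)^{z-1}}\,\Gamma(z-1,(n+mx)\delta)\\&\quad+\frac{1}{\Gamma(z-1)}\sum_{u=0}^{\infty}\sum_{v=0}^{\infty}(-1)^{u+v}\frac{\mathscr{L}\left(1-u,\frac cr\right)\mathscr{L}\left(1-v,\frac dr\right)x^u\delta^{u+v+z-1}}{u!\,v!\,(u+v+z-1)}.\end{aligned}$$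
   Context: Let $\zeta_r=e^{2\pi i/r}$ and $G(\ell,\chi):=\sum_{j=1}^{r}\chi(j)e^{2\pi i j\ell/r}$. For $\mathrm{Re}(z)>0$ and $x>0$, $$J_{r,\chi_1,\chi_2}(z,x):=\frac{1}{\Gamma(z)}\int_0^1\frac{\left(\log\frac1t\right)^{z-1}}{t(1-t^r)}\left(\sum_{\ell=1}^{r}G(\ell,\chi_2)t^{\ell}\right)\left(\sum_{j=1}^{r}\chi_1(j)\log\left(1-\zeta_r^{j}t^{x}\right)\right)dt,$$ with the principal branch of the logarithm; since $\chi_1(r)=0$, the term $j=r$ is absent. $\Gamma(s,y)=\int_y^\infty t^{s-1}e^{-t}\,dt$ ($y>0$) is the (upper) incomplete Gamma function. $\mathscr{L}(s,\alpha)$ is the analytic continuation to $s\in\mathbb{C}$ of the periodic zeta function $\sum_{n=1}^{\infty}e^{2\pi i n\alpha}n^{-s}$, for real non-integer $\alpha$. At $z=1$ the expression for $\mathbb{W}_{c,d}(z,x)$ is understood as its limiting value. *)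

(* Defs.v *)
From Stdlib Require Import Reals ZArith.
From Coquelicot Require Import Coquelicot.

Open Scope C_scope.

Definition Cexp (z : C) : C :=
  RtoC (exp (fst z)) * (cos (snd z), sin (snd z)).

(* Principal argument, with values in (-PI, PI]. *)
Definition Carg (z : C) : R :=
  if Rle_dec 0 (snd z) then acos (fst z / Cmod z)
  else Ropp (acos (fst z / Cmod z)).

Definition Clog (z : C) : C := (ln (Cmod z), Carg z).

(* a ^ s for a positive real base a and a complex exponent s. *)
Definition cpow (a : R) (s : C) : C := Cexp (s * RtoC (ln a)).

(* e^{2 pi i a} *)
Definition e2pi (a : R) : C := Cexp (0%R, (2 * PI * a)%R).

(* Improper integral on (0, +oo), meant for Re s > 0. *)
Definition Gamma_int (s : C) : C :=
  RInt_gen (V := C_R_CompleteNormedModule)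
    (fun t : R => cpow t (s - 1) * RtoC (exp (- t)))
    (at_right 0) (Rbar_locally p_infty).

(* s (s+1) ... (s+n-1) *)
Fixpoint rising (s : C) (n : nat) : C :=
  match n with
  | O => 1
  | S k => rising s k * (s + RtoC (INR k))
  end.

(* The meromorphic continuation of the Gamma integral, by the functional
   equation Gamma(s+n) = s (s+1) ... (s+n-1) Gamma(s); the shift n is the least
   natural number with Re s + n > 0.  The value at the poles is junk. *)
Definition CGamma (s : C) : C :=
  let n := Z.to_nat (up (- fst s)) in
  Gamma_int (s + RtoC (INR n)) / rising s n.

(* Upper incomplete Gamma function, for y > 0. *)
Definition inc_Gamma (s : C) (y : R) : C :=
  RInt_gen (V := C_R_CompleteNormedModule)
    (fun t : R => cpow t (s - 1) * RtoC (exp (- t)))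
    (at_point y) (Rbar_locally p_infty).

Definition analytic_at (F : C -> C) (a : C) : Prop :=
  exists (p : nat -> C) (rho : R),
    (0 < rho)%R /\
    forall s : C, (Cmod (s - a) < rho)%R ->
      is_pseries (K := C_AbsRing) (V := C_NormedModule) p (s - a) (F s).

Definition continues_periodic_zeta (alpha : R) (F : C -> C) : Prop :=
  (forall a : C, analytic_at F a) /\
  (forall s : C, (1 < fst s)%R ->
     is_series (K := C_AbsRing) (V := C_NormedModule)
       (fun n : nat => e2pi (INR (S n) * alpha) / cpow (INR (S n)) s)
       (F s)).

(* The value at s of the analytic continuation, for alpha not an integer: that
   continuation exists and is unique, so that iota selects its value. *)
Definition periodic_zeta (s : C) (alpha : R) : C :=
  iota (T := C_CompleteNormedModule)
    (fun l : C =>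
       exists F : C -> C, continues_periodic_zeta alpha F /\ F s = l).

Record dirichlet_character (r : nat) (chi : Z -> C) : Prop := {
  dirichlet_periodic : forall n : Z, chi (n + Z.of_nat r)%Z = chi n;
  dirichlet_mult : forall m n : Z, chi (m * n)%Z = chi m * chi n;
  dirichlet_support :
    forall n : Z, chi n <> 0 <-> Z.gcd n (Z.of_nat r) = 1%Z
}.

Definition gauss_sum (r l : nat) (chi : Z -> C) : C :=
  sum_n_m (G := C_AbelianMonoid)
    (fun j : nat => chi (Z.of_nat j) * e2pi (INR (j * l) / INR r)) 1 r.

Definition J_integrand (r : nat) (chi1 chi2 : Z -> C) (z : C) (x t : R) : C :=
  cpow (ln (1 / t)) (z - 1) / RtoC (t * (1 - t ^ r))
  * sum_n_m (G := C_AbelianMonoid)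
      (fun l : nat => gauss_sum r l chi2 * RtoC (t ^ l)) 1 r
  * sum_n_m (G := C_AbelianMonoid)
      (fun j : nat =>
         chi1 (Z.of_nat j)
         * Clog (1 - e2pi (INR j / INR r) * RtoC (Rpower t x))) 1 r.

Definition J_converges (r : nat) (chi1 chi2 : Z -> C) (z : C) (x : R) : Prop :=
  ex_RInt_gen (V := C_R_NormedModule)
    (J_integrand r chi1 chi2 z x) (at_right 0) (at_left 1).

Definition J (r : nat) (chi1 chi2 : Z -> C) (z : C) (x : R) : C :=
  / CGamma z
  * RInt_gen (V := C_R_CompleteNormedModule)
      (J_integrand r chi1 chi2 z x) (at_right 0) (at_left 1).

(* The iterated series sum_n (sum_m a n m) converges to l. *)
Definition is_double_series (a : nat -> nat -> C) (l : C) : Prop :=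
  exists inner : nat -> C,
    (forall n : nat,
       is_series (K := C_AbsRing) (V := C_NormedModule) (a n) (inner n)) /\
    is_series (K := C_AbsRing) (V := C_NormedModule) inner l.

Definition W_term1 (r c d : nat) (z : C) (x delta : R) (n m : nat) : C :=
  let y := (INR n + INR m * x)%R in
  e2pi (INR (m * c) / INR r) * e2pi (INR (n * d) / INR r)
  / (RtoC (INR m * INR n) * cpow y (z - 1))
  * inc_Gamma (z - 1) (y * delta).

Definition W_term2 (r c d : nat) (z : C) (x delta : R) (u v : nat) : C :=
  RtoC ((-1) ^ (u + v))
  * (periodic_zeta (1 - RtoC (INR u)) (INR c / INR r)
     * periodic_zeta (1 - RtoC (INR v)) (INR d / INR r)
     * RtoC (x ^ u) * cpow delta (RtoC (INR (u + v)) + z - 1))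
  / (RtoC (INR (fact u) * INR (fact v)) * (RtoC (INR (u + v)) + z - 1)).

(* For z <> 1: both double series in the formula for W_{c,d}(z,x) converge, and
   w is the value of the formula. *)
Definition is_W_formula (r c d : nat) (z : C) (x delta : R) (w : C) : Prop :=
  exists w1 w2 : C,
    is_double_series
      (fun n m : nat => W_term1 r c d z x delta (S n) (S m)) w1 /\
    is_double_series (W_term2 r c d z x delta) w2 /\
    w = / CGamma (z - 1) * w1 + / CGamma (z - 1) * w2.

(* w is W_{c,d}(z,x), the case z = 1 being the limit of the formula. *)
Definition is_W (r c d : nat) (z : C) (x delta : R) (w : C) : Prop :=
  (z <> RtoC 1 -> is_W_formula r c d z x delta w) /\
  (z = RtoC 1 ->
     exists f : C -> C,
       locally' (T := C_UniformSpace) (RtoC 1)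
         (fun z' : C => is_W_formula r c d z' x delta (f z')) /\
       filterlim f (locally' (T := C_UniformSpace) (RtoC 1))
         (locally (T := C_UniformSpace) w)).

(* Main.v *)
Require Import Defs.
From Stdlib Require Import Reals ZArith Lra Lia Psatz.
From Coquelicot Require Import Coquelicot.

(* Substituting t = e^(-u) in the first integral and t = e^(-xu) in the second,
   and writing A_c(u) = log (1 - zeta^c e^(-u)) with zeta = e^(2 pi i / r), the
   left-hand side becomes 1 / Gamma(z) times the sum over c, d of chi1(c) chi2(d)
   times the Mellin integral of u^(z-1) (A_d(u) A_c(xu))'. Split it at delta.
   Beyond delta, integrate by parts and expand both logarithms in powers of
   e^(-u): this gives the incomplete Gamma functions. Below delta, use the Taylor
   series A_c(u) = - sum_v (-u)^v / v! L(1-v, c/r), whose radius of convergence is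
   at least 2 pi / r by Cauchy's formula, since log (1 - zeta^c e^(-u)) has no
   singularity closer to 0. The boundary terms at delta cancel. At z = 1 the
   Mellin integrals are continuous and Gamma(1) = 1.

   The continuation of the periodic zeta function comes from repeated summation
   by parts, which for |q| = 1, q <> 1 expresses sum q^n n^(-s) by k boundary terms
   and an absolutely convergent series of k-th differences of n^(-s). At s = -m the
   k-th differences vanish for k > m, and the same finite sum is the m-th Taylor
   coefficient of q e^(-u) / (1 - q e^(-u)), up to the factor (-1)^m m!. *)

Open Scope C_scope.

(** Below delta the derivative stays inside the integral because, for Re z <= 1, the integral of
    t^(z-2) A_d(t) A_c(xt) may diverge at 0; only [delta, oo) is integrated by parts. Termwise
    integration then produces k/(k+z-1) for terms of total degree k, and 1/(k+z-1) = (1 -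
    k/(k+z-1))/(z-1) supplies both the boundary term and the factor that turns 1/Gamma(z-1) into
    1/Gamma(z). The double series are iterated, so the two logarithms are expanded one at a time;
    each expansion needs only a remainder bounded by a null sequence times one integrable function.
    Holomorphy enters solely as the estimate |f(w2) - f(w1) - f'(w1)(w2-w1)| <= K |w2-w1|^2 on a
    closed disc, which makes Cauchy's formula a statement about real integrals over the angle. Zeta
    values are matched with Taylor coefficients on positive reals t tending to 0: two power series
    whose sums differ by O(t^k) share their first k coefficients. *)

Notation Cseries a l :=
  (is_series (K := C_AbsRing) (V := C_NormedModule) a l).
Notation Csum := (sum_n (G := C_AbelianMonoid) : (nat -> C) -> nat -> C).
Notation Cder f t l :=
  (is_derive (K := R_AbsRing) (V := C_R_NormedModule) f t l).
Notation Ccont f t :=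
  (continuous (T := R_UniformSpace) (U := C_UniformSpace) f t).
Notation is_CRInt f a b l := (is_RInt (V := C_R_NormedModule) f a b l).
Notation is_CRInt_gen f Fa Fb l :=
  (is_RInt_gen (V := C_R_NormedModule) f Fa Fb l).
Notation CRInt f a b := (RInt (V := C_R_CompleteNormedModule) f a b).
Notation CRInt_gen f Fa Fb := (RInt_gen (V := C_R_CompleteNormedModule) f Fa Fb).

(* ring and field do not recognize equations whose type is a structure with carrier C. *)
Ltac in_C := match goal with |- ?a = ?b => change (a = b :> C) end.

(** * Complex numbers *)

Lemma Cmod_minus_sym (a b : C) : Cmod (a - b) = Cmod (b - a).
Proof. rewrite <- Cmod_opp. f_equal; ring. Qed.

Lemma Cmod_triangle_minus (a b c : C) :
  (Cmod (a - c) <= Cmod (a - b) + Cmod (b - c))%R.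
Proof. replace (a - c) with ((a - b) + (b - c)) by ring. apply Cmod_triangle. Qed.

Lemma Cmod_triangle_le (a b : C) (M : R) :
  (Cmod a + Cmod b <= M)%R -> (Cmod (a + b) <= M)%R.
Proof. apply Rle_trans, Cmod_triangle. Qed.

Lemma Cmod_le_abs (z : C) : (Cmod z <= Rabs (fst z) + Rabs (snd z))%R.
Proof.
  replace z with (RtoC (fst z) + Ci * RtoC (snd z)) at 1.
  - apply Cmod_triangle_le.
    rewrite Cmod_mult, !Cmod_R, Cmod_Ci. lra.
  - destruct z; unfold RtoC, Ci, Cplus, Cmult; simpl; f_equal; ring.
Qed.

Lemma abs_fst_le (z : C) : (Rabs (fst z) <= Cmod z)%R.
Proof. eapply Rle_trans; [apply Rmax_l|apply Rmax_Cmod]. Qed.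

Lemma abs_snd_le (z : C) : (Rabs (snd z) <= Cmod z)%R.
Proof. eapply Rle_trans; [apply Rmax_r|apply Rmax_Cmod]. Qed.

Lemma Cinv_zero : / (0 : C) = 0.
Proof.
  unfold Cinv, RtoC; simpl. f_equal; unfold Rdiv; rewrite ?Ropp_0; ring.
Qed.

(** Inversion is total with / 0 = 0. Values of 1/Gamma can therefore be split and carried along as
    opaque factors, without a proof that Gamma does not vanish. *)
Lemma Cinv_mul (a b : C) : / (a * b) = / a * / b.
Proof.
  destruct (Ceq_dec a 0) as [->|Ha].
  { rewrite Cmult_0_l, Cinv_zero. ring. }
  destruct (Ceq_dec b 0) as [->|Hb].
  { rewrite Cmult_0_r, Cinv_zero. ring. }
  field. now split.
Qed.

Lemma RtoC_neq (x : R) : x <> 0%R -> RtoC x <> 0.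
Proof. intros H E. apply H. now apply RtoC_inj. Qed.

Lemma Cmod_one_minus (z : C) : (1 - Cmod z <= Cmod (1 - z))%R.
Proof.
  generalize (Cmod_triangle (1 - z) z). replace (1 - z + z) with (RtoC 1) by ring.
  rewrite Cmod_1. lra.
Qed.

Lemma Cexp_add (a b : C) : Cexp (a + b) = Cexp a * Cexp b.
Proof.
  destruct a as [a1 a2], b as [b1 b2]. unfold Cexp, Cplus, Cmult, RtoC; simpl.
  rewrite exp_plus, cos_plus, sin_plus. f_equal; ring.
Qed.

Lemma Cexp_0 : Cexp 0 = 1.
Proof. unfold Cexp, RtoC, Cmult; simpl. rewrite exp_0, cos_0, sin_0. f_equal; ring. Qed.

Lemma Cexp_neq_0 (a : C) : Cexp a <> 0.
Proof.
  intros H. assert (H1 : Cexp a * Cexp (- a) = 1).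
  { rewrite <- Cexp_add. replace (a + - a) with (RtoC 0) by ring. apply Cexp_0. }
  rewrite H, Cmult_0_l in H1. apply RtoC_inj in H1. lra.
Qed.

Lemma Cexp_opp (a : C) : Cexp (- a) = / Cexp a.
Proof.
  assert (H1 : Cexp a * Cexp (- a) = 1).
  { rewrite <- Cexp_add. replace (a + - a) with (RtoC 0) by ring. apply Cexp_0. }
  replace (Cexp (- a)) with (/ Cexp a * (Cexp a * Cexp (-a))).
  - rewrite H1. ring.
  - field. apply Cexp_neq_0.
Qed.

Lemma Cexp_R (x : R) : Cexp (RtoC x) = RtoC (exp x).
Proof. unfold Cexp, RtoC, Cmult; simpl. rewrite cos_0, sin_0. f_equal; ring. Qed.

Lemma Cmod_Cexp (a : C) : Cmod (Cexp a) = exp (fst a).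
Proof.
  unfold Cexp. rewrite Cmod_mult, Cmod_R, Rabs_pos_eq by (left; apply exp_pos).
  unfold Cmod; simpl. rewrite !Rmult_1_r.
  generalize (sin2_cos2 (snd a)); unfold Rsqr; intros H.
  replace (_ + _)%R with 1%R by lra. rewrite sqrt_1. ring.
Qed.

Lemma Cmod_Cexp_le (a : C) (M : R) : (Cmod a <= M -> Cmod (Cexp a) <= exp M)%R.
Proof.
  intros H. rewrite Cmod_Cexp. generalize (abs_fst_le a) (Rle_abs (fst a)); intros.
  destruct (Req_dec (fst a) M) as [->|]; [lra|]. left; apply exp_increasing. lra.
Qed.

Lemma Cpow_Cexp (a : C) (n : nat) : Cexp a ^ n = Cexp (RtoC (INR n) * a).
Proof.
  induction n as [|n IH].
  - simpl. rewrite Cmult_0_l, Cexp_0. reflexivity.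
  - rewrite S_INR, RtoC_plus, Cpow_S, IH, <- Cexp_add. f_equal; ring.
Qed.

Lemma cpow_add (a : R) (s t : C) : cpow a (s + t) = cpow a s * cpow a t.
Proof. unfold cpow. rewrite <- Cexp_add. f_equal; ring. Qed.

Lemma cpow_0 (a : R) : cpow a 0 = 1.
Proof. unfold cpow. rewrite Cmult_0_l. apply Cexp_0. Qed.

Lemma cpow_neq_0 (a : R) (s : C) : cpow a s <> 0.
Proof. apply Cexp_neq_0. Qed.

Lemma cpow_opp (a : R) (s : C) : cpow a (- s) = / cpow a s.
Proof. unfold cpow. rewrite <- Cexp_opp. f_equal; ring. Qed.

Lemma cpow_1 (a : R) : (0 < a)%R -> cpow a 1 = RtoC a.
Proof. intros Ha. unfold cpow. rewrite Cmult_1_l, Cexp_R, exp_ln; auto. Qed.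

Lemma cpow_INR (a : R) (n : nat) : (0 < a)%R -> cpow a (RtoC (INR n)) = RtoC (a ^ n).
Proof.
  intros Ha. induction n as [|n IH].
  - apply cpow_0.
  - rewrite S_INR, RtoC_plus, cpow_add, IH, cpow_1 by auto.
    rewrite <- RtoC_mult. f_equal. simpl; ring.
Qed.

Lemma cpow_mul (a b : R) (s : C) :
  (0 < a)%R -> (0 < b)%R -> cpow (a * b) s = cpow a s * cpow b s.
Proof.
  intros Ha Hb. unfold cpow. rewrite ln_mult, RtoC_plus, <- Cexp_add by auto.
  f_equal; ring.
Qed.

Lemma Cmod_cpow (a : R) (s : C) : Cmod (cpow a s) = Rpower a (fst s).
Proof.
  unfold cpow, Rpower. rewrite Cmod_Cexp. f_equal.
  destruct s; unfold RtoC; simpl; ring.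
Qed.

(** * Complex-valued functions of a real variable *)

(** A value z is the combination of the fixed vectors 1 and [Ci] with real coefficients [fst z] and
    [snd z], so the two real derivatives recombine by linearity. *)
Lemma Cder_pair (f : R -> C) (t : R) (l : C) :
  is_derive (fun x => fst (f x)) t (fst l) ->
  is_derive (fun x => snd (f x)) t (snd l) -> Cder f t l.
Proof.
  intros H1 H2.
  assert (H1' := is_derive_scal_l (K := R_AbsRing) (V := C_R_NormedModule)
                   _ _ _ (RtoC 1) H1).
  assert (H2' := is_derive_scal_l (K := R_AbsRing) (V := C_R_NormedModule)
                   _ _ _ Ci H2).
  assert (H := is_derive_plus _ _ _ _ _ H1' H2').
  assert (E : forall z : C, plus (G := C_R_NormedModule)
     (scal (K := R_AbsRing) (V := C_R_NormedModule) (fst z) (RtoC 1))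
     (scal (K := R_AbsRing) (V := C_R_NormedModule) (snd z) Ci) = z).
  { intros [a b]. unfold RtoC, Ci.
    change (((a * 1 + b * 0)%R, (a * 0 + b * 1)%R) = (a, b)). f_equal; ring. }
  rewrite E in H. revert H. apply is_derive_ext. intros s. apply E.
Qed.

Lemma Cder_fst (f : R -> C) (t : R) (l : C) :
  Cder f t l -> is_derive (fun x => fst (f x)) t (fst l).
Proof.
  intros H. unfold is_derive in *.
  apply (filterdiff_ext_lin _ (fun y => fst (scal (V := C_R_NormedModule) y l))).
  - apply (filterdiff_comp (U := R_NormedModule) (V := C_R_NormedModule)
             (W := R_NormedModule) f fst _ fst H).
    apply filterdiff_linear. apply is_linear_fst.
  - intros y. reflexivity.
Qed.

Lemma Cder_snd (f : R -> C) (t : R) (l : C) :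
  Cder f t l -> is_derive (fun x => snd (f x)) t (snd l).
Proof.
  intros H. unfold is_derive in *.
  apply (filterdiff_ext_lin _ (fun y => snd (scal (V := C_R_NormedModule) y l))).
  - apply (filterdiff_comp (U := R_NormedModule) (V := C_R_NormedModule)
             (W := R_NormedModule) f snd _ snd H).
    apply filterdiff_linear. apply is_linear_snd.
  - intros y. reflexivity.
Qed.

Lemma Cder_val (f : R -> C) (t : R) (l l' : C) : Cder f t l -> l = l' -> Cder f t l'.
Proof. now intros H <-. Qed.

Lemma Rder_val (f : R -> R) (t l l' : R) : is_derive f t l -> l = l' -> is_derive f t l'.
Proof. now intros H <-. Qed.

Lemma Cder_ext (f g : R -> C) (t : R) (l : C) :
  (forall x, f x = g x) -> Cder f t l -> Cder g t l.
Proof. apply (is_derive_ext (V := C_R_NormedModule)). Qed.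

Lemma Cder_plus (f g : R -> C) (t : R) (df dg : C) :
  Cder f t df -> Cder g t dg -> Cder (fun x => f x + g x) t (df + dg).
Proof. intros; now apply (is_derive_plus (V := C_R_NormedModule)). Qed.

Lemma Cder_opp (f : R -> C) (t : R) (df : C) :
  Cder f t df -> Cder (fun x => - f x) t (- df).
Proof. intros; now apply (is_derive_opp (V := C_R_NormedModule)). Qed.

Lemma Cder_minus (f g : R -> C) (t : R) (df dg : C) :
  Cder f t df -> Cder g t dg -> Cder (fun x => f x - g x) t (df - dg).
Proof. intros; apply Cder_plus; auto. now apply Cder_opp. Qed.

Lemma Cder_const (c : C) (t : R) : Cder (fun _ => c) t (RtoC 0).
Proof. apply (is_derive_const (V := C_R_NormedModule)). Qed.

Lemma is_derive_Rmul (f g : R -> R) (t df dg : R) :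
  is_derive f t df -> is_derive g t dg ->
  is_derive (fun x => f x * g x)%R t (df * g t + f t * dg)%R.
Proof. intros. apply (is_derive_mult f g); auto. exact Rmult_comm. Qed.

Lemma Cder_mult (f g : R -> C) (t : R) (df dg : C) :
  Cder f t df -> Cder g t dg ->
  Cder (fun x => f x * g x) t (df * g t + f t * dg).
Proof.
  intros Hf Hg.
  assert (f1 := Cder_fst _ _ _ Hf). assert (f2 := Cder_snd _ _ _ Hf).
  assert (g1 := Cder_fst _ _ _ Hg). assert (g2 := Cder_snd _ _ _ Hg).
  apply Cder_pair; simpl.
  - eapply Rder_val.
    + apply (is_derive_minus (V := R_NormedModule)).
      * apply (is_derive_Rmul _ _ _ _ _ f1 g1).
      * apply (is_derive_Rmul _ _ _ _ _ f2 g2).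
    + unfold minus, plus, opp; simpl. ring.
  - eapply Rder_val.
    + apply (is_derive_plus (V := R_NormedModule)).
      * apply (is_derive_Rmul _ _ _ _ _ f1 g2).
      * apply (is_derive_Rmul _ _ _ _ _ f2 g1).
    + unfold plus; simpl. ring.
Qed.

Lemma Cder_scal (c : C) (f : R -> C) (t : R) (df : C) :
  Cder f t df -> Cder (fun x => c * f x) t (c * df).
Proof.
  intros H. eapply Cder_val.
  - apply (Cder_mult (fun _ => c) f); [apply Cder_const|exact H].
  - cbv beta. ring.
Qed.

Lemma Cder_RtoC (f : R -> R) (t df : R) :
  is_derive f t df -> Cder (fun x => RtoC (f x)) t (RtoC df).
Proof.
  intros H. apply Cder_pair; simpl; auto.
  apply (is_derive_const (V := R_NormedModule)).
Qed.

Lemma Cder_comp (f : R -> C) (g : R -> R) (t : R) (df : C) (dg : R) :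
  Cder f (g t) df -> is_derive g t dg ->
  Cder (fun x => f (g x)) t (RtoC dg * df).
Proof.
  intros Hf Hg. eapply Cder_val.
  - apply (is_derive_comp (V := C_R_NormedModule) f g); eauto.
  - destruct df as [a b]. unfold RtoC, Cmult; simpl.
    change (((dg * a)%R, (dg * b)%R) = ((dg * a - 0 * b)%R, (dg * b + 0 * a)%R)).
    f_equal; ring.
Qed.

Lemma Cder_Cexp (p : R -> C) (t : R) (dp : C) :
  Cder p t dp -> Cder (fun x => Cexp (p x)) t (Cexp (p t) * dp).
Proof.
  intros H. assert (p1 := Cder_fst _ _ _ H). assert (p2 := Cder_snd _ _ _ H).
  apply Cder_pair; simpl.
  - eapply is_derive_ext.
    { intros s. symmetry. rewrite Rmult_0_l. apply Rminus_0_r. }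
    eapply Rder_val.
    + apply is_derive_Rmul.
      * apply (is_derive_comp exp (fun x => fst (p x))); [apply is_derive_exp|exact p1].
      * apply (is_derive_comp cos (fun x => snd (p x))); [apply is_derive_cos|exact p2].
    + unfold scal; simpl; unfold mult; simpl. ring.
  - eapply is_derive_ext.
    { intros s. symmetry. rewrite Rmult_0_l. apply Rplus_0_r. }
    eapply Rder_val.
    + apply is_derive_Rmul.
      * apply (is_derive_comp exp (fun x => fst (p x))); [apply is_derive_exp|exact p1].
      * apply (is_derive_comp sin (fun x => snd (p x))); [apply is_derive_sin|exact p2].
    + unfold scal; simpl; unfold mult; simpl. ring.
Qed.

Lemma Cder_inv (p : R -> C) (t : R) (dp : C) :
  p t <> 0 -> Cder p t dp -> Cder (fun x => / p x) t (- dp / (p t * p t)).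
Proof.
  intros Hn H. assert (p1 := Cder_fst _ _ _ H). assert (p2 := Cder_snd _ _ _ H).
  assert (Hd : (fst (p t) ^ 2 + snd (p t) ^ 2 <> 0)%R).
  { intros E. apply Hn. destruct (p t) as [a b]; simpl in *.
    assert (a = 0%R) by nra. assert (b = 0%R) by nra. subst. reflexivity. }
  assert (Hq : is_derive (fun x => fst (p x) ^ 2 + snd (p x) ^ 2)%R t
                 (2 * fst (p t) * fst dp + 2 * snd (p t) * snd dp)%R).
  { eapply Rder_val.
    - apply (is_derive_plus (V := R_NormedModule)).
      + apply (is_derive_pow _ 2 _ _ p1).
      + apply (is_derive_pow _ 2 _ _ p2).
    - unfold plus; simpl. ring. }
  assert (Hd' : forall a b : R, (a ^ 2 + b ^ 2 <> 0 ->
            (a * a - b * b) ^ 2 + (a * b + b * a) ^ 2 <> 0)%R).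
  { intros a b Hab. replace (_ + _)%R with ((a ^ 2 + b ^ 2) ^ 2)%R by ring.
    now apply pow_nonzero. }
  specialize (Hd' _ _ Hd).
  apply Cder_pair; simpl.
  - eapply Rder_val.
    + apply (is_derive_div (fun x => fst (p x))
               (fun x => fst (p x) ^ 2 + snd (p x) ^ 2)%R _ _ _ p1 Hq Hd).
    + destruct (p t) as [a b], dp as [c d]. cbn [fst snd] in *.
      field; repeat split; first [exact Hd | intros Z; apply Hd'; rewrite <- Z; ring | intros Z;
        apply Hd; rewrite <- Z; ring].
  - eapply Rder_val.
    + apply (is_derive_div (fun x => - snd (p x))%R
               (fun x => fst (p x) ^ 2 + snd (p x) ^ 2)%R _ _ _
               (is_derive_opp (V := R_NormedModule) _ _ _ p2) Hq Hd).
    + unfold opp; cbn -[pow]. destruct (p t) as [a b], dp as [c d].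
      cbn [fst snd] in *.
      field; repeat split; first [exact Hd | intros Z; apply Hd'; rewrite <- Z; ring | intros Z;
        apply Hd; rewrite <- Z; ring].
Qed.

Lemma Cder_cont (f : R -> C) (t : R) (l : C) : Cder f t l -> Ccont f t.
Proof.
  intros H. apply (ex_derive_continuous (V := C_R_NormedModule)). now exists l.
Qed.

Lemma Ccont_pair (f : R -> C) (t : R) :
  continuous (fun x => fst (f x)) t -> continuous (fun x => snd (f x)) t -> Ccont f t.
Proof.
  intros H1 H2 P [e He].
  specialize (H1 (ball (fst (f t)) e)). specialize (H2 (ball (snd (f t)) e)).
  destruct H1 as [d1 H1]. { now exists e. }
  destruct H2 as [d2 H2]. { now exists e. }
  assert (Hd : (0 < Rmin d1 d2)%R) by (apply Rmin_pos; apply cond_pos).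
  exists (mkposreal _ Hd). intros y Hy. apply He. split.
  - apply H1. eapply ball_le; [|apply Hy]. apply Rmin_l.
  - apply H2. eapply ball_le; [|apply Hy]. apply Rmin_r.
Qed.

Lemma Ccont_fst (f : R -> C) (t : R) : Ccont f t -> continuous (fun x => fst (f x)) t.
Proof. intros H. apply (continuous_comp f fst); auto. apply continuous_fst. Qed.

Lemma Ccont_snd (f : R -> C) (t : R) : Ccont f t -> continuous (fun x => snd (f x)) t.
Proof. intros H. apply (continuous_comp f snd); auto. apply continuous_snd. Qed.

Lemma Ccont_ext (f g : R -> C) (t : R) : (forall x, f x = g x) -> Ccont f t -> Ccont g t.
Proof. apply continuous_ext. Qed.

Lemma Ccont_opp (f : R -> C) (t : R) : Ccont f t -> Ccont (fun x => - f x) t.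
Proof. apply (continuous_opp (V := C_R_NormedModule)). Qed.

Lemma Ccont_plus (f g : R -> C) (t : R) :
  Ccont f t -> Ccont g t -> Ccont (fun x => f x + g x) t.
Proof. intros; now apply (continuous_plus (V := C_R_NormedModule)). Qed.

Lemma Ccont_const (c : C) (t : R) : Ccont (fun _ => c) t.
Proof. apply continuous_const. Qed.

Lemma Ccont_mult (f g : R -> C) (t : R) :
  Ccont f t -> Ccont g t -> Ccont (fun x => f x * g x) t.
Proof.
  intros Hf Hg.
  assert (f1 := Ccont_fst _ _ Hf). assert (f2 := Ccont_snd _ _ Hf).
  assert (g1 := Ccont_fst _ _ Hg). assert (g2 := Ccont_snd _ _ Hg).
  apply Ccont_pair; simpl.
  - apply (continuous_minus (V := R_NormedModule)); now apply (continuous_mult (K := R_AbsRing)).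
  - apply (continuous_plus (V := R_NormedModule)); now apply (continuous_mult (K := R_AbsRing)).
Qed.

Lemma Ccont_comp (f : R -> C) (g : R -> R) (t : R) :
  Ccont f (g t) -> continuous g t -> Ccont (fun x => f (g x)) t.
Proof. intros; now apply (continuous_comp g f). Qed.

Lemma norm_C_R (z : C) : norm (K := R_AbsRing) (V := C_R_NormedModule) z = Cmod z.
Proof. symmetry. apply Cmod_norm. Qed.

(** * Mean value inequality *)

Lemma is_derive_Rcont (f : R -> R) (t l : R) : is_derive f t l -> continuity_pt f t.
Proof.
  intros H. apply continuity_pt_filterlim.
  apply (ex_derive_continuous f). now exists l.
Qed.

Lemma derive_le_incr (f df : R -> R) (a b : R) :
  (a <= b)%R -> (forall t, (a <= t <= b)%R -> is_derive f t (df t)) ->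
  (forall t, (a <= t <= b)%R -> (0 <= df t)%R) -> (f a <= f b)%R.
Proof.
  intros Hab Hd Hp. destruct (MVT_gen f a b df) as (c & Hc & E).
  - intros t Ht. apply Hd. rewrite Rmin_left, Rmax_right in Ht; lra.
  - intros t Ht. eapply is_derive_Rcont. apply Hd.
    rewrite Rmin_left, Rmax_right in Ht; lra.
  - rewrite Rmin_left, Rmax_right in Hc by lra.
    specialize (Hp c Hc). assert (0 <= df c * (b - a))%R by (apply Rmult_le_pos; lra). lra.
Qed.

(* The factor 2 comes from treating real and imaginary parts separately. *)
Lemma Cmean_value (E dE : R -> C) (G dG : R -> R) (a b : R) :
  (a <= b)%R ->
  (forall t, (a <= t <= b)%R -> Cder E t (dE t)) ->
  (forall t, (a <= t <= b)%R -> is_derive G t (dG t)) ->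
  (forall t, (a <= t <= b)%R -> (Cmod (dE t) <= dG t)%R) ->
  (Cmod (E b - E a) <= 2 * (G b - G a))%R.
Proof.
  intros Hab HE HG Hle.
  assert (K : forall (e de : R -> R), (forall t, (a <= t <= b)%R -> is_derive e t (de t)) ->
     (forall t, (a <= t <= b)%R -> (Rabs (de t) <= dG t)%R) -> (Rabs (e b - e a) <= G b - G a)%R).
  { intros e de He Hd. apply Rabs_le. split.
    - assert (H : (G a + e a <= G b + e b)%R).
      { apply (derive_le_incr (fun t => G t + e t)%R (fun t => dG t + de t)%R); auto.
        - intros t Ht. apply (is_derive_plus (V := R_NormedModule)); auto.
        - intros t Ht. specialize (Hd t Ht). apply Rabs_le_between in Hd. lra. }
      lra.
    - assert (H : (G a - e a <= G b - e b)%R).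
      { apply (derive_le_incr (fun t => G t - e t)%R (fun t => dG t - de t)%R); auto.
        - intros t Ht. apply (is_derive_minus (V := R_NormedModule)); auto.
        - intros t Ht. specialize (Hd t Ht). apply Rabs_le_between in Hd. lra. }
      lra. }
  eapply Rle_trans; [apply Cmod_le_abs|].
  assert (H1 := K (fun t => fst (E t)) (fun t => fst (dE t))).
  assert (H2 := K (fun t => snd (E t)) (fun t => snd (dE t))).
  simpl.
  assert (Rabs (fst (E b) - fst (E a)) <= G b - G a)%R.
  { apply H1; intros t Ht; [now apply Cder_fst, HE|].
    eapply Rle_trans; [apply abs_fst_le|auto]. }
  assert (Rabs (snd (E b) - snd (E a)) <= G b - G a)%R.
  { apply H2; intros t Ht; [now apply Cder_snd, HE|].
    eapply Rle_trans; [apply abs_snd_le|auto]. }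
  unfold Rminus in *. lra.
Qed.

(** The mean value inequality along the segment from 0 to w, where the derivative of the exponential
    is at most |w| e^|w| in modulus. *)
Lemma Cexp_lipschitz (w : C) :
  (Cmod (Cexp w - 1) <= 2 * Cmod w * exp (Cmod w))%R.
Proof.
  assert (H := Cmean_value (fun t => Cexp (RtoC t * w)) (fun t => Cexp (RtoC t * w) * w)
    (fun t => t * (Cmod w * exp (Cmod w)))%R (fun _ => Cmod w * exp (Cmod w))%R 0 1).
  cbv beta in H. rewrite Cmult_0_l, Cmult_1_l, Cexp_0 in H.
  eapply Rle_trans; [apply H|lra]; try lra; clear H.
  - intros t _. apply Cder_Cexp. eapply Cder_val.
    + apply (Cder_mult (fun t => RtoC t) (fun _ => w)).
      * apply (Cder_RtoC (fun t => t)). apply (is_derive_id (K := R_AbsRing)).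
      * apply Cder_const.
    + change (@one R_AbsRing) with 1%R. ring.
  - intros t _. auto_derive; auto. ring.
  - intros t Ht. rewrite Cmod_mult, Rmult_comm.
    apply Rmult_le_compat_l; [apply Cmod_ge_0|]. apply Cmod_Cexp_le.
    rewrite Cmod_mult, Cmod_R, Rabs_pos_eq by lra.
    generalize (Cmod_ge_0 w); nra.
Qed.

(** The same segment, with the linear part subtracted: the derivative is now controlled by
    [Cexp_lipschitz]. Each of the two uses of the mean value inequality contributes a factor 2. *)
Lemma Cexp_taylor2 (w : C) :
  (Cmod (Cexp w - 1 - w) <= 4 * Cmod w ^ 2 * exp (Cmod w))%R.
Proof.
  assert (H := Cmean_value (fun t => Cexp (RtoC t * w) - RtoC t * w)
    (fun t => (Cexp (RtoC t * w) - 1) * w)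
    (fun t => t * (2 * Cmod w ^ 2 * exp (Cmod w)))%R
    (fun _ => 2 * Cmod w ^ 2 * exp (Cmod w))%R 0 1).
  cbv beta in H. rewrite Cmult_0_l, Cmult_1_l, Cexp_0 in H.
  replace (Cexp w - 1 - w) with (Cexp w - w - (1 - 0)) by ring.
  eapply Rle_trans; [apply H|lra]; try lra; clear H.
  - intros t _.
    assert (Hi : Cder (fun t => RtoC t * w) t w).
    { eapply Cder_val.
      - apply (Cder_mult (fun t => RtoC t) (fun _ => w)).
        * apply (Cder_RtoC (fun t => t)). apply (is_derive_id (K := R_AbsRing)).
        * apply Cder_const.
      - change (@one R_AbsRing) with 1%R. ring. }
    eapply Cder_val.
    + apply Cder_minus; [apply Cder_Cexp|]; exact Hi.
    + cbv beta. ring.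
  - intros t _. auto_derive; auto. ring.
  - intros t Ht. rewrite Cmod_mult.
    assert (Hw := Cmod_ge_0 w).
    assert (Ht' : (Cmod (RtoC t * w) <= Cmod w)%R).
    { rewrite Cmod_mult, Cmod_R, Rabs_pos_eq by lra. nra. }
    replace (2 * Cmod w ^ 2 * exp (Cmod w))%R with ((2 * Cmod w * exp (Cmod w)) * Cmod w)%R by
      ring.
    apply Rmult_le_compat_r; auto.
    eapply Rle_trans; [apply Cexp_lipschitz|].
    apply Rmult_le_compat; try lra.
    + generalize (Cmod_ge_0 (RtoC t * w)); lra.
    + left; apply exp_pos.
    + destruct (Req_dec (Cmod (RtoC t * w)) (Cmod w)) as [->|]; [lra|].
      left; apply exp_increasing; lra.
Qed.

(** * Complex series *)

Lemma is_series_Rmult_l (c : R) (a : nat -> R) (l : R) :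
  is_series a l -> is_series (fun n => c * a n)%R (c * l)%R.
Proof. apply (is_series_scal (K := R_AbsRing) (V := R_NormedModule) c). Qed.

Lemma ex_series_Rmult_l (c : R) (a : nat -> R) :
  ex_series a -> ex_series (fun n => c * a n)%R.
Proof. intros [l H]. exists (c * l)%R. now apply is_series_Rmult_l. Qed.

Lemma Csum_O (a : nat -> C) : Csum a 0%nat = a 0%nat.
Proof. exact (sum_O (G := C_AbelianMonoid) a). Qed.

Lemma Csum_S (a : nat -> C) (n : nat) : Csum a (S n) = Csum a n + a (S n).
Proof. exact (sum_Sn (G := C_AbelianMonoid) a n). Qed.

Lemma Csum_ext (a b : nat -> C) (n : nat) :
  (forall k, (k <= n)%nat -> a k = b k) -> Csum a n = Csum b n.
Proof. intros H. exact (sum_n_ext_loc (G := C_AbelianMonoid) a b n H). Qed.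

Lemma Csum_mult_l (c : C) (a : nat -> C) (n : nat) :
  Csum (fun k => c * a k) n = c * Csum a n.
Proof. exact (sum_n_mult_l (K := C_Ring) c a n). Qed.

Lemma Csum_plus (a b : nat -> C) (n : nat) :
  Csum (fun k => a k + b k) n = Csum a n + Csum b n.
Proof. exact (sum_n_plus (G := C_AbelianMonoid) a b n). Qed.

Lemma Cmod_Csum_le (a : nat -> C) (b : nat -> R) (n : nat) :
  (forall k, (Cmod (a k) <= b k)%R) -> (Cmod (Csum a n) <= sum_n b n)%R.
Proof.
  intros H. induction n as [|n IH].
  - rewrite Csum_O, sum_O. apply H.
  - rewrite Csum_S, sum_Sn. apply Cmod_triangle_le.
    apply Rplus_le_compat; auto.
Qed.

(** Most series below are summed through this: an explicit bound on the remainder after n terms that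
    tends to 0. *)
Lemma Cseries_of_bound (a : nat -> C) (l : C) (e : nat -> R) :
  (forall n, (Cmod (Csum a n - l) <= e n)%R) -> is_lim_seq e 0 -> Cseries a l.
Proof.
  intros H He. unfold is_series.
  apply (filterlim_locally_ball_norm (K := C_AbsRing) (U := C_NormedModule)).
  intros eps.
  assert (H1 := proj1 (filterlim_locally _ _) He eps).
  revert H1. apply filter_imp. intros n Hn.
  unfold ball_norm. change (Cmod (Csum a n - l) < eps)%R.
  eapply Rle_lt_trans; [apply H|].
  unfold ball in Hn; simpl in Hn; unfold AbsRing_ball, abs, minus, plus, opp in Hn; simpl in Hn.
  apply Rabs_lt_between in Hn. lra.
Qed.

Lemma Cseries_eps (a : nat -> C) (l : C) (eps : R) :
  Cseries a l -> (0 < eps)%R ->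
  exists N, forall n, (N <= n)%nat -> (Cmod (Csum a n - l) < eps)%R.
Proof.
  intros H He. unfold is_series in H.
  assert (H1 := proj1 (filterlim_locally_ball_norm (K := C_AbsRing)
                  (U := C_NormedModule) _ _) H (mkposreal eps He)).
  exact H1.
Qed.

Lemma Cseries_unique (a : nat -> C) (l l' : C) : Cseries a l -> Cseries a l' -> l = l'.
Proof.
  intros H H'. exact (filterlim_locally_unique (K := C_AbsRing)
    (V := C_NormedModule) (F := eventually) _ _ _ H H').
Qed.

Lemma Cseries_ext (a b : nat -> C) (l : C) :
  (forall n, a n = b n) -> Cseries a l -> Cseries b l.
Proof. apply is_series_ext. Qed.

Lemma Cseries_val (a : nat -> C) (l l' : C) : Cseries a l -> l = l' -> Cseries a l'.
Proof. now intros H <-. Qed.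

Lemma Cseries_mult_l (c : C) (a : nat -> C) (l : C) :
  Cseries a l -> Cseries (fun n => c * a n) (c * l).
Proof. apply (is_series_scal (K := C_AbsRing) (V := C_NormedModule) c). Qed.

Lemma Cseries_plus (a b : nat -> C) (la lb : C) :
  Cseries a la -> Cseries b lb -> Cseries (fun n => a n + b n) (la + lb).
Proof. apply (is_series_plus (K := C_AbsRing) (V := C_NormedModule)). Qed.

Lemma Cseries_minus (a b : nat -> C) (la lb : C) :
  Cseries a la -> Cseries b lb -> Cseries (fun n => a n - b n) (la - lb).
Proof. apply (is_series_minus (K := C_AbsRing) (V := C_NormedModule)). Qed.

Lemma Cseries_shift (a : nat -> C) (l : C) :
  Cseries a l -> Cseries (fun n => a (S n)) (l - a 0%nat).
Proof.
  intros H. apply (is_series_incr_1 (K := C_AbsRing) (V := C_NormedModule)).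
  eapply Cseries_val; [exact H|].
  change (l = l - a 0%nat + a 0%nat). ring.
Qed.

Lemma Cseries_unshift (a : nat -> C) (l : C) :
  Cseries (fun n => a (S n)) l -> Cseries a (l + a 0%nat).
Proof.
  intros H. apply (is_series_decr_1 (K := C_AbsRing) (V := C_NormedModule)).
  eapply Cseries_val; [exact H|].
  change (l = l + a 0%nat + - a 0%nat). ring.
Qed.

Lemma Cseries_limit (a : nat -> C) (l : C) (B : R) :
  Cseries a l -> (forall n, (Cmod (Csum a n) <= B)%R) -> (Cmod l <= B)%R.
Proof.
  intros H HB. apply le_epsilon. intros eps He.
  destruct (Cseries_eps _ _ _ H He) as [N HN]. specialize (HN N (le_n N)).
  rewrite Cmod_minus_sym in HN.
  assert (H1 := Cmod_triangle (l - Csum a N) (Csum a N)).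
  replace (l - Csum a N + Csum a N) with l in H1 by ring.
  specialize (HB N). lra.
Qed.

Lemma sum_n_le_series (b : nat -> R) (B : R) (n : nat) :
  (forall k, (0 <= b k)%R) -> is_series b B -> (sum_n b n <= B)%R.
Proof.
  intros Hb H.
  apply (is_lim_seq_incr_compare (sum_n b) B); [exact H|].
  intros k. rewrite sum_Sn. change (sum_n b k <= sum_n b k + b (S k))%R.
  specialize (Hb (S k)). lra.
Qed.

Lemma Cseries_dom_bound (a : nat -> C) (b : nat -> R) (l : C) (B : R) :
  (forall n, (Cmod (a n) <= b n)%R) -> is_series b B -> Cseries a l -> (Cmod l <= B)%R.
Proof.
  intros H HB Ha. apply (Cseries_limit a); auto. intros n.
  eapply Rle_trans; [apply Cmod_Csum_le; exact H|].
  apply sum_n_le_series; auto. intros k. eapply Rle_trans; [apply Cmod_ge_0|apply H].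
Qed.

Lemma Cplus_minus_l (u v : C) : u + v - u = v.
Proof. ring. Qed.

Lemma Csum_sub_shift (a : nat -> C) (n k : nat) :
  Csum a (n + S k)%nat = Csum a n + Csum (fun j => a (n + S j)%nat) k.
Proof.
  induction k as [|k IH].
  - rewrite Csum_O. replace (n + 1)%nat with (S n) by lia. rewrite Csum_S.
    reflexivity.
  - rewrite Csum_S. replace (n + S (S k))%nat with (S (n + S k)) by lia.
    rewrite Csum_S, IH. ring_simplify. do 2 f_equal; try lia.
Qed.

(** The remainder is dominated by that of the majorant, written as [B - sum_n b n] so that its
    convergence to 0 is immediate. *)
Lemma Cseries_tail_bound (a : nat -> C) (b : nat -> R) (l : C) (B : R) (n : nat) :
  (forall n, (Cmod (a n) <= b n)%R) -> is_series b B -> Cseries a l ->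
  (Cmod (Csum a n - l) <= B - sum_n b n)%R.
Proof.
  intros H HB Ha. rewrite Cmod_minus_sym.
  apply le_epsilon. intros eps He.
  destruct (Cseries_eps _ _ _ Ha He) as [N HN]. specialize (HN (n + S N)%nat ltac:(lia)).
  rewrite Cmod_minus_sym in HN.
  assert (H1 := Cmod_triangle_minus l (Csum a (n + S N)%nat) (Csum a n)).
  assert (H2 : (Cmod (Csum a (n + S N)%nat - Csum a n) <= B - sum_n b n)%R).
  { rewrite Csum_sub_shift.
    rewrite Cplus_minus_l.
    eapply Rle_trans; [apply Cmod_Csum_le; intros k; apply (H (n + S k)%nat)|].
    assert (H3 : forall k, (sum_n b (n + S k) = sum_n b n + sum_n (fun j => b (n + S j)%nat)
      k)%R).
    { induction k as [|k IH].
      - rewrite sum_O. replace (n + 1)%nat with (S n) by lia. rewrite sum_Sn. reflexivity.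
      - rewrite sum_Sn. replace (n + S (S k))%nat with (S (n + S k)) by lia.
        rewrite sum_Sn, IH. unfold plus; simpl. ring. }
    assert (H4 := sum_n_le_series b B (n + S N)).
    rewrite H3 in H4. apply Rplus_le_reg_l with (sum_n b n).
    eapply Rle_trans; [apply H4; auto|lra].
    intros k; eapply Rle_trans; [apply Cmod_ge_0|apply H]. }
  lra.
Qed.

Lemma Cseries_ex_dom (a : nat -> C) (b : nat -> R) :
  (forall n, (Cmod (a n) <= b n)%R) -> ex_series b -> exists l, Cseries a l.
Proof.
  intros H HB.
  apply (ex_series_le (K := C_AbsRing) (V := C_CompleteNormedModule) a b); auto.
Qed.

(** A Weierstrass-type exchange of sums. With q = |w|/rho < 1 the terms are at most B n q^j; cutting
    the j-sum at N and then summing over n costs at most SB times the geometric tail. *)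
Lemma Cseries_swap_power (p : nat -> nat -> C) (B : nat -> R) (SB rho : R) (w : C) (f : nat -> C)
  (P : nat -> C) (l : C) :
  (0 < rho)%R -> (Cmod w < rho)%R ->
  is_series B SB ->
  (forall n j, (Cmod (p n j) <= B n / rho ^ j)%R) ->
  (forall n, Cseries (fun j => p n j * w ^ j) (f n)) ->
  (forall j, Cseries (fun n => p n j) (P j)) ->
  Cseries f l ->
  Cseries (fun j => P j * w ^ j) l.
Proof.
  intros Hr Hw HB Hp Hf HP Hl.
  set (q := (Cmod w / rho)%R).
  assert (Hq0 : (0 <= q)%R) by (unfold q; apply Rdiv_le_0_compat; [apply Cmod_ge_0|auto]).
  assert (Hq1 : (q < 1)%R) by (unfold q; apply Rlt_div_l; lra).
  assert (Hterm : forall n j, (Cmod (p n j * w ^ j) <= B n * q ^ j)%R).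
  { intros n j. rewrite Cmod_mult, Cmod_pow. unfold q. unfold Rdiv.
    rewrite Rpow_mult_distr, pow_inv.
    eapply Rle_trans; [apply Rmult_le_compat_r; [apply pow_le, Cmod_ge_0|apply Hp]|].
    unfold Rdiv. lra. }
  assert (Hgeo : is_series (fun j => q ^ j)%R (/ (1 - q))%R).
  { apply is_series_geom. rewrite Rabs_pos_eq; auto. }
  apply (Cseries_of_bound _ _ (fun N => SB * (/ (1 - q) - sum_n (fun j => q ^ j) N))%R).
  - intros N.
    assert (Hsum : Cseries (fun n => Csum (fun j => p n j * w ^ j) N) (Csum (fun j => P j * w ^
      j) N)).
    { induction N as [|N IH].
      - rewrite Csum_O. eapply Cseries_ext.
        { intros n. symmetry. rewrite Csum_O. apply Cmult_comm. }
        rewrite (Cmult_comm (P 0%nat)). apply Cseries_mult_l. apply HP.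
      - rewrite Csum_S. eapply Cseries_ext.
        { intros n. symmetry. rewrite Csum_S. reflexivity. }
        apply Cseries_plus; auto. eapply Cseries_ext.
        { intros n. apply Cmult_comm. }
        rewrite (Cmult_comm (P (S N))). apply Cseries_mult_l. apply HP. }
    assert (Hd := Cseries_minus _ _ _ _ Hsum Hl).
    refine (Cseries_dom_bound _ (fun n => B n * (/ (1 - q) - sum_n (fun j => q ^ j) N))%R _ _ _ _
      Hd).
    + intros n. eapply Rle_trans.
      * apply (Cseries_tail_bound _ (fun j => B n * q ^ j)%R _ (B n * / (1 - q))%R); auto.
        apply (is_series_Rmult_l (B n)). exact Hgeo.
      * apply Req_le. rewrite (sum_n_mult_l (K := R_Ring)).
        change (B n * / (1 - q) - B n * sum_n (fun j => q ^ j) N =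
          B n * (/ (1 - q) - sum_n (fun j => q ^ j) N))%R. ring.
    + apply is_series_scal_r. exact HB.
  - replace (Finite 0) with (Finite (SB * (/ (1 - q) - / (1 - q)))) by (f_equal; ring).
    apply (is_lim_seq_scal_l _ _ (Finite _)).
    apply (is_lim_seq_minus' (fun _ => / (1 - q))%R).
    + apply is_lim_seq_const.
    + exact Hgeo.
Qed.

Lemma Cpow_pow_n (w : C) (k : nat) : pow_n (K := C_Ring) w k = w ^ k.
Proof. induction k as [|k IH]; simpl; [reflexivity|]. now rewrite IH. Qed.

Lemma is_pseries_Cseries (p : nat -> C) (w l : C) :
  is_pseries (K := C_AbsRing) (V := C_NormedModule) p w l <-> Cseries (fun k => p k * w ^ k) l.
Proof.
  unfold is_pseries.
  split; apply Cseries_ext; intros k; rewrite <- (Cpow_pow_n w k); apply Cmult_comm.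
Qed.

(** * Integrals of complex-valued functions *)

Lemma CRInt_pair (f : R -> C) (a b : R) (l : C) :
  is_RInt (fun t => fst (f t)) a b (fst l) ->
  is_RInt (fun t => snd (f t)) a b (snd l) -> is_CRInt f a b l.
Proof.
  intros H1 H2. rewrite (surjective_pairing l).
  now apply (is_RInt_fct_extend_pair (U := R_NormedModule) (V := R_NormedModule)).
Qed.

(** Integrals are taken in C as a real vector space, whose linearity covers real scalars; for a
    complex c the two components are recombined by hand. *)
Lemma CRInt_scal (c : C) (f : R -> C) (a b : R) (l : C) :
  is_CRInt f a b l -> is_CRInt (fun t => c * f t) a b (c * l).
Proof.
  intros H.
  assert (H1 := is_RInt_fct_extend_fst (U := R_NormedModule) (V := R_NormedModule) _ _ _ _ H).
  assert (H2 := is_RInt_fct_extend_snd (U := R_NormedModule) (V := R_NormedModule) _ _ _ _ H).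
  apply CRInt_pair; simpl.
  - apply (is_RInt_minus (V := R_NormedModule)); apply (is_RInt_scal (V := R_NormedModule)); auto.
  - apply (is_RInt_plus (V := R_NormedModule)); apply (is_RInt_scal (V := R_NormedModule)); auto.
Qed.

Lemma CRInt_minus (f g : R -> C) (a b : R) (lf lg : C) :
  is_CRInt f a b lf -> is_CRInt g a b lg -> is_CRInt (fun t => f t - g t) a b (lf - lg).
Proof. apply (is_RInt_minus (V := C_R_NormedModule)). Qed.

Lemma CRInt_plus (f g : R -> C) (a b : R) (lf lg : C) :
  is_CRInt f a b lf -> is_CRInt g a b lg -> is_CRInt (fun t => f t + g t) a b (lf + lg).
Proof. apply (is_RInt_plus (V := C_R_NormedModule)). Qed.

Lemma CRInt_ext (f g : R -> C) (a b : R) (l : C) :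
  (forall t, (Rmin a b < t < Rmax a b)%R -> f t = g t) -> is_CRInt f a b l -> is_CRInt g a b l.
Proof. apply (is_RInt_ext (V := C_R_NormedModule)). Qed.

Lemma CRInt_norm_le (f : R -> C) (a b M : R) (l : C) :
  (a <= b)%R -> (forall t, (a <= t <= b)%R -> (Cmod (f t) <= M)%R) ->
  is_CRInt f a b l -> (Cmod l <= (b - a) * M)%R.
Proof.
  intros Hab HM H. rewrite <- norm_C_R.
  apply (norm_RInt_le_const (V := C_R_NormedModule) f a b l M); auto.
  intros t Ht. rewrite norm_C_R. auto.
Qed.

Lemma CRInt_continuous (f : R -> C) (a b : R) :
  (forall t, (Rmin a b <= t <= Rmax a b)%R -> Ccont f t) ->
  is_CRInt f a b (CRInt f a b).
Proof.
  intros H. apply (RInt_correct (V := C_R_CompleteNormedModule)).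
  now apply (ex_RInt_continuous (V := C_R_CompleteNormedModule)).
Qed.

Lemma CRInt_derive (f df : R -> C) (a b : R) :
  (forall t, (Rmin a b <= t <= Rmax a b)%R -> Cder f t (df t)) ->
  (forall t, (Rmin a b <= t <= Rmax a b)%R -> Ccont df t) ->
  is_CRInt df a b (f b - f a).
Proof. apply (is_RInt_derive (V := C_R_CompleteNormedModule)). Qed.

Lemma CRInt_val (f : R -> C) (a b : R) (l l' : C) : is_CRInt f a b l -> l = l' -> is_CRInt f a b
  l'.
Proof. now intros H <-. Qed.

Lemma CRInt_unique (f : R -> C) (a b : R) (l l' : C) :
  is_CRInt f a b l -> is_CRInt f a b l' -> l = l'.
Proof.
  intros H H'. rewrite <- (is_RInt_unique (V := C_R_CompleteNormedModule) _ _ _ _ H).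
  apply (is_RInt_unique (V := C_R_CompleteNormedModule) _ _ _ _ H').
Qed.

Lemma Ccont_lipschitz (g : R -> C) (t L : R) :
  (forall s, (Cmod (g s - g t) <= L * Rabs (s - t))%R) -> Ccont g t.
Proof.
  intros H.
  assert (K : forall h : R -> R, (forall s, (Rabs (h s - h t) <= L * Rabs (s - t))%R) ->
     continuous h t).
  { intros h Hh. apply continuity_pt_filterlim. intros eps He.
    assert (HL : (0 < Rabs L + 1)%R) by (generalize (Rabs_pos L); lra).
    exists (eps / (Rabs L + 1))%R. split; [now apply Rdiv_lt_0_compat|].
    intros s [_ Hs]. simpl in *. unfold R_dist in *.
    eapply Rle_lt_trans; [apply Hh|].
    apply Rle_lt_trans with ((Rabs L + 1) * Rabs (s - t))%R.
    - apply Rmult_le_compat_r; [apply Rabs_pos|]. generalize (Rle_abs L); lra.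
    - rewrite Rmult_comm. now apply Rlt_div_r in Hs. }
  apply Ccont_pair; apply K; intros s; eapply Rle_trans; try apply H.
  - apply (abs_fst_le (g s - g t)).
  - apply (abs_snd_le (g s - g t)).
Qed.

(** This is what converts the quadratic estimate that stands for holomorphy into a derivative along
    a real path, once the linear part has been removed. *)
Lemma Cder_zero_quadratic (g : R -> C) (t L : R) :
  (forall s, (Cmod (g s - g t) <= L * (s - t) ^ 2)%R) -> Cder g t (RtoC 0).
Proof.
  intros H.
  assert (K : forall h : R -> R, (forall s, (Rabs (h s - h t) <= L * (s - t) ^ 2)%R) ->
     is_derive h t 0%R).
  { intros h Hh. apply is_derive_Reals. intros eps He.
    assert (HL : (0 < Rabs L + 1)%R) by (generalize (Rabs_pos L); lra).
    assert (Hd : (0 < eps / (Rabs L + 1))%R) by now apply Rdiv_lt_0_compat.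
    exists (mkposreal _ Hd). intros s Hs0 Hs. simpl in Hs.
    rewrite Rminus_0_r. unfold Rdiv. rewrite Rabs_mult, Rabs_inv.
    apply Rlt_div_l; [now apply Rabs_pos_lt|].
    eapply Rle_lt_trans; [apply Hh|].
    replace (t + s - t)%R with s by ring.
    apply Rlt_div_r in Hs; auto.
    rewrite <- (pow2_abs s).
    assert (Hp := Rabs_pos_lt _ Hs0). assert (H1 := Rle_abs L).
    apply Rle_lt_trans with ((Rabs s * (Rabs L + 1)) * Rabs s)%R; [nra|].
    apply Rmult_lt_compat_r; auto. }
  apply Cder_pair; simpl; apply K; intros s; eapply Rle_trans; try apply H.
  - apply (abs_fst_le (g s - g t)).
  - apply (abs_snd_le (g s - g t)).
Qed.

(** * Cauchy's formula and Taylor expansions *)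

Definition circ (rho t : R) : C := RtoC rho * Cexp (RtoC t * Ci).

Lemma Cmod_circ (rho t : R) : (0 <= rho)%R -> Cmod (circ rho t) = rho.
Proof.
  intros H. unfold circ. rewrite Cmod_mult, Cmod_R, Cmod_Cexp, Rabs_pos_eq by auto.
  unfold RtoC, Ci; simpl. replace (t * 0 - 0 * 1)%R with 0%R by ring. rewrite exp_0. ring.
Qed.

Lemma Cder_id_scal (c : C) (t : R) : Cder (fun x => RtoC x * c) t c.
Proof.
  eapply Cder_val.
  - apply (Cder_mult (fun t => RtoC t) (fun _ => c)).
    + apply (Cder_RtoC (fun t => t)). apply (is_derive_id (K := R_AbsRing)).
    + apply Cder_const.
  - change (@one R_AbsRing) with 1%R. ring.
Qed.

Lemma Cder_circ (rho t : R) : Cder (circ rho) t (circ rho t * Ci).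
Proof.
  unfold circ. eapply Cder_val.
  - apply Cder_scal, Cder_Cexp. apply Cder_id_scal.
  - cbv beta; ring.
Qed.

Lemma circ_lipschitz (rho s t : R) :
  (0 <= rho)%R -> (Cmod (circ rho s - circ rho t) <= 2 * rho * Rabs (s - t))%R.
Proof.
  intros Hr.
  assert (K : forall a b, (a <= b)%R -> (Cmod (circ rho b - circ rho a) <= 2 * (rho * b - rho *
    a))%R).
  { intros a b Hab.
    apply (Cmean_value _ (fun t => circ rho t * Ci) (fun t => rho * t)%R (fun _ => rho)); auto.
    - intros u _. apply Cder_circ.
    - intros u _. auto_derive; auto; ring.
    - intros u _. rewrite Cmod_mult, Cmod_circ, Cmod_Ci by auto. lra. }
  destruct (Rle_dec t s) as [H|H].
  - rewrite Rabs_pos_eq by lra. eapply Rle_trans; [apply K; auto|lra].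
  - rewrite Cmod_minus_sym, Rabs_left1 by lra. eapply Rle_trans; [apply K; lra|lra].
Qed.

Lemma Ccont_circ (rho t : R) : Ccont (circ rho) t.
Proof. eapply Cder_cont, Cder_circ. Qed.

Lemma circ_neq_0 (rho t : R) : (0 < rho)%R -> circ rho t <> 0.
Proof. intros H. apply Cmult_neq_0; [apply RtoC_neq; lra|apply Cexp_neq_0]. Qed.

Lemma circ_sub_neq_0 (rho t : R) (w : C) : (Cmod w < rho)%R -> circ rho t - w <> 0.
Proof.
  intros H E. assert (Hw := Cmod_ge_0 w).
  assert (E' : circ rho t = w) by (rewrite <- (Cplus_0_r w), <- E; ring).
  assert (Hr : (0 <= rho)%R) by lra. rewrite <- E', Cmod_circ in H; lra.
Qed.

Lemma circ_period (rho : R) : circ rho (2 * PI) = circ rho 0.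
Proof.
  unfold circ, Cexp, RtoC, Ci, Cmult; simpl.
  replace (2 * PI * 0 - 0 * 1)%R with 0%R by ring.
  replace (2 * PI * 1 + 0 * 0)%R with (2 * PI)%R by ring.
  replace (0 * 0 - 0 * 1)%R with 0%R by ring.
  replace (0 * 1 + 0 * 0)%R with 0%R by ring.
  now rewrite sin_2PI, cos_2PI, sin_0, cos_0.
Qed.

Lemma Ccont_inv (p : R -> C) (t : R) (dp : C) :
  p t <> 0 -> Cder p t dp -> Ccont (fun x => / p x) t.
Proof. intros Hn H. eapply Cder_cont, Cder_inv; eauto. Qed.

(** On the circle v = rho e^(it), the form dv/(v - w) of Cauchy's formula is i times this function
    of t, times dt. *)
Lemma Ccont_kernel (rho t : R) (w : C) :
  (Cmod w < rho)%R -> Ccont (fun t => circ rho t * / (circ rho t - w)) t.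
Proof.
  intros H. apply Ccont_mult; [apply Ccont_circ|].
  apply (Ccont_inv (fun t => circ rho t - w) t (circ rho t * Ci - 0)).
  - now apply circ_sub_neq_0.
  - apply Cder_minus; [apply Cder_circ|apply Cder_const].
Qed.

Lemma Cmod_kernel (rho t : R) (w : C) :
  (Cmod w < rho)%R -> (Cmod (circ rho t * / (circ rho t - w)) <= rho / (rho - Cmod w))%R.
Proof.
  intros H. assert (Hw := Cmod_ge_0 w).
  rewrite Cmod_mult, Cmod_inv, Cmod_circ by (try lra; now apply circ_sub_neq_0).
  unfold Rdiv. apply Rmult_le_compat_l; [lra|]. apply Rinv_le_contravar; [lra|].
  assert (H1 := Cmod_triangle (circ rho t - w) w).
  replace (circ rho t - w + w) with (circ rho t) in H1 by ring.
  rewrite Cmod_circ in H1; lra.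
Qed.

Lemma Ccont_Cpow (p : R -> C) (t : R) (n : nat) :
  Ccont p t -> Ccont (fun x => p x ^ n) t.
Proof.
  intros H. induction n as [|n IH]; simpl; [apply Ccont_const|]. now apply Ccont_mult.
Qed.

Lemma Ccont_inv_circ (rho t : R) : (0 < rho)%R -> Ccont (fun x => / circ rho x) t.
Proof.
  intros H. eapply Ccont_inv; [now apply circ_neq_0|apply Cder_circ].
Qed.

(** The Cauchy coefficient integral without its factor 1/(2 pi): on v = rho e^(it), v^(-n-1) dv
    equals i v^(-n) dt. *)
Definition circ_coef (rho : R) (phi : R -> C) (n : nat) : C :=
  CRInt (fun t => phi t * (/ circ rho t) ^ n) 0 (2 * PI).

Lemma circ_coef_correct (rho : R) (phi : R -> C) (n : nat) :
  (0 < rho)%R -> (forall t, Ccont phi t) ->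
  is_CRInt (fun t => phi t * (/ circ rho t) ^ n) 0 (2 * PI) (circ_coef rho phi n).
Proof.
  intros Hr Hp. apply CRInt_continuous. intros t _.
  apply Ccont_mult; auto. apply Ccont_Cpow. now apply Ccont_inv_circ.
Qed.

Lemma circ_coef_bound (rho M : R) (phi : R -> C) (n : nat) :
  (0 < rho)%R -> (forall t, Ccont phi t) -> (forall t, (Cmod (phi t) <= M)%R) ->
  (Cmod (circ_coef rho phi n) <= 2 * PI * (M / rho ^ n))%R.
Proof.
  intros Hr Hp HM. assert (HPI := PI_RGT_0).
  eapply Rle_trans; [eapply (CRInt_norm_le _ 0 (2 * PI) (M / rho ^ n)%R);
    [lra| |now apply circ_coef_correct]|lra].
  intros t _. cbv beta.
  rewrite Cmod_mult, Cmod_pow, Cmod_inv, Cmod_circ by (try lra; now apply circ_neq_0).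
  rewrite pow_inv. unfold Rdiv. apply Rmult_le_compat_r; auto.
  left. now apply Rinv_0_lt_compat, pow_lt.
Qed.

(** The kernel is the sum of the geometric series in w / circ. Its remainder after degree n is
    exactly (w / circ)^(n+1) times the kernel, hence at most q^(n+1) rho / (rho - |w|) for every
    angle, with q = |w|/rho. *)
Lemma Cauchy_kernel_series (rho M : R) (phi : R -> C) (w l : C) :
  (Cmod w < rho)%R -> (forall t, Ccont phi t) -> (forall t, (Cmod (phi t) <= M)%R) ->
  is_CRInt (fun t => phi t * (circ rho t * / (circ rho t - w))) 0 (2 * PI) l ->
  Cseries (fun n => circ_coef rho phi n * w ^ n) l.
Proof.
  intros Hw Hp HM Hl. assert (Hw0 := Cmod_ge_0 w). assert (HPI := PI_RGT_0).
  assert (Hr : (0 < rho)%R) by lra.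
  assert (HM0 : (0 <= M)%R) by (eapply Rle_trans; [apply Cmod_ge_0|apply (HM 0%R)]).
  set (q := (Cmod w / rho)%R).
  apply (Cseries_of_bound _ _ (fun n => q ^ n * (q * (2 * PI * (M * (rho / (rho - Cmod w))))))%R).
  - intros n.
    assert (H : is_CRInt (fun t => phi t * Csum (fun k => (w * / circ rho t) ^ k) n) 0 (2 * PI)
                  (Csum (fun n => circ_coef rho phi n * w ^ n) n)).
    { induction n as [|n IH].
      - rewrite Csum_O. eapply CRInt_ext.
        2: { rewrite Cmult_comm. apply CRInt_scal. now apply circ_coef_correct. }
        intros t _. rewrite Csum_O. simpl. ring.
      - rewrite Csum_S. eapply CRInt_ext.
        2: { apply CRInt_plus; [exact IH|]. rewrite Cmult_comm. apply CRInt_scal.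
             now apply circ_coef_correct. }
        intros t _. rewrite Csum_S, (Cpow_mult_l w). ring. }
    assert (Hd := CRInt_minus _ _ _ _ _ _ H Hl).
    eapply Rle_trans.
    { eapply (CRInt_norm_le _ 0 (2 * PI) (M * (q ^ (S n) * (rho / (rho - Cmod w))))%R);
        [lra| |exact Hd].
      intros t _. cbv beta.
      assert (Hc := circ_neq_0 rho t Hr). assert (Hc' := circ_sub_neq_0 rho t w Hw).
      assert (E : phi t * Csum (fun k => (w * / circ rho t) ^ k) n
                  - phi t * (circ rho t * / (circ rho t - w))
                = - (phi t * ((w * / circ rho t) ^ (S n) * (circ rho t * / (circ rho t - w))))).
      { assert (E : Csum (fun k => (w * / circ rho t) ^ k) n =
                 (1 - (w * / circ rho t) ^ (S n)) * (circ rho t * / (circ rho t - w))).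
        { clear - Hc Hc'. induction n as [|n IH].
          - rewrite Csum_O. simpl. field; auto.
          - rewrite Csum_S, IH. simpl. field; auto. }
        rewrite E. ring. }
      rewrite E, Cmod_opp, !(Cmod_mult (phi t)).
      apply Rmult_le_compat; [apply Cmod_ge_0|apply Cmod_ge_0|apply HM|].
      rewrite Cmod_mult. apply Rmult_le_compat; [apply Cmod_ge_0|apply Cmod_ge_0| |].
      + rewrite Cmod_pow, Cmod_mult, Cmod_inv, Cmod_circ by (auto; lra).
        unfold q, Rdiv. lra.
      + now apply Cmod_kernel. }
    simpl. lra.
  - replace (Finite 0) with (Finite (0 * (q * (2 * PI * (M * (rho / (rho - Cmod w)))))))
      by (f_equal; ring).
    apply (is_lim_seq_scal_r _ _ (Finite 0)). apply is_lim_seq_geom.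
    assert (0 <= q)%R by (unfold q; apply Rdiv_le_0_compat; lra).
    rewrite Rabs_pos_eq; auto. unfold q. apply Rlt_div_l; lra.
Qed.

(** The integrand is a multiple of e^(-i(n+1)t), whose antiderivative is again periodic. *)
Lemma circ_coef_one (rho : R) (n : nat) :
  (0 < rho)%R -> circ_coef rho (fun _ => 1) (S n) = 0.
Proof.
  intros Hr. eapply CRInt_unique; [apply circ_coef_correct; auto; intros; apply Ccont_const|].
  assert (HN : RtoC (INR (S n)) <> 0) by (apply RtoC_neq, not_0_INR; lia).
  assert (HC : Ci <> 0).
  { intros E. assert (H := Cmod_Ci). rewrite E, Cmod_0 in H. lra. }
  assert (Hd : forall t, Cder (fun t => / (RtoC rho) ^ (S n) * (- / (RtoC (INR (S n)) * Ci)) *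
       Cexp (RtoC t * (- (RtoC (INR (S n)) * Ci)))) t ((/ circ rho t) ^ (S n))).
  { intros t. eapply Cder_val.
    - apply Cder_scal. apply Cder_Cexp. apply Cder_id_scal.
    - assert (HR : RtoC rho ^ S n <> 0) by (apply Cpow_nz, RtoC_neq; lra).
      assert (E : (/ circ rho t) ^ (S n) = / RtoC rho ^ (S n) * Cexp (RtoC t * - (RtoC (INR (S
        n)) * Ci))).
      { unfold circ. rewrite (Cinv_mul (RtoC rho)), Cpow_mult_l, <- Cexp_opp, Cpow_Cexp.
        rewrite Cpow_inv by (apply RtoC_neq; lra). do 2 f_equal. ring. }
      rewrite E. cbv beta. field. auto. }
  apply (CRInt_ext (fun t => (/ circ rho t) ^ (S n))).
  { intros; ring. }
  eapply CRInt_val; [apply (CRInt_derive _ _ 0 (2 * PI) (fun t _ => Hd t))|cbv beta].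
  - intros t _. apply Ccont_Cpow. now apply Ccont_inv_circ.
  - assert (E : Cexp (RtoC (2 * PI) * - (RtoC (INR (S n)) * Ci)) = Cexp (RtoC 0 * - (RtoC (INR (S
      n)) * Ci))).
    { replace (RtoC (2 * PI) * - (RtoC (INR (S n)) * Ci)) with (- (RtoC (INR (S n)) * (RtoC (2 *
        PI) * Ci))) by ring.
      rewrite Cexp_opp, <- Cpow_Cexp. assert (H := circ_period 1).
      unfold circ in H. rewrite !Cmult_1_l in H. rewrite H, !Cmult_0_l, Cexp_0, Cpow_1_l. field. }
    rewrite E. ring.
Qed.

(** Subtracting f'(p t) p(s) from f(p s) leaves a function whose increment from t is O((s-t)^2), so
    its derivative at t is 0; the subtracted part is linear in p. *)
Lemma Cder_comp_quadratic (f f' : C -> C) (rho K L : R) (p : R -> C) (t : R) (dp : C) :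
  (forall w1 w2, (Cmod w1 <= rho)%R -> (Cmod w2 <= rho)%R ->
     (Cmod (f w2 - f w1 - f' w1 * (w2 - w1)) <= K * Cmod (w2 - w1) ^ 2)%R) ->
  (0 <= K)%R ->
  (forall s, (Cmod (p s) <= rho)%R) ->
  (forall s, (Cmod (p s - p t) <= L * Rabs (s - t))%R) ->
  Cder p t dp -> Cder (fun s => f (p s)) t (f' (p t) * dp).
Proof.
  intros Hq HK Hp HL Hd.
  assert (H1 : Cder (fun s => f (p s) - f' (p t) * p s) t (RtoC 0)).
  { apply (Cder_zero_quadratic _ _ (K * L ^ 2)). intros s.
    replace (_ - _) with (f (p s) - f (p t) - f' (p t) * (p s - p t)) by ring.
    eapply Rle_trans; [apply Hq; apply Hp|].
    rewrite Rmult_assoc. apply Rmult_le_compat_l; auto.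
    rewrite <- (pow2_abs (s - t)), <- Rpow_mult_distr.
    apply pow_incr. split; [apply Cmod_ge_0|apply HL]. }
  assert (H2 : Cder (fun s => f' (p t) * p s) t (f' (p t) * dp)) by now apply Cder_scal.
  assert (H3 := Cder_plus _ _ _ _ _ H1 H2). rewrite Cplus_0_l in H3.
  revert H3. apply Cder_ext. intros s.
  in_C. ring.
Qed.

Definition taylor_coef (rho : R) (f : C -> C) (n : nat) : C :=
  / RtoC (2 * PI) * circ_coef rho (fun t => f (circ rho t)) n.

(* Let G l be the integral of f (w + l (circ - w)) against the Cauchy kernel.
   Its formal l-derivative is the integral over a period of a t-derivative, so
   G l2 - G l1 = O((l2 - l1)^2), which forces G 0 = G 1: Cauchy's formula. *)
Lemma Cauchy_Taylor (f f' : C -> C) (rho K M : R) :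
  (0 < rho)%R ->
  (forall w1 w2, (Cmod w1 <= rho)%R -> (Cmod w2 <= rho)%R ->
     (Cmod (f w2 - f w1 - f' w1 * (w2 - w1)) <= K * Cmod (w2 - w1) ^ 2)%R) ->
  (forall w, (Cmod w <= rho)%R -> (Cmod (f w) <= M)%R) ->
  (forall n, (Cmod (taylor_coef rho f n) <= M / rho ^ n)%R) /\
  forall w, (Cmod w < rho)%R -> Cseries (fun n => taylor_coef rho f n * w ^ n) (f w).
Proof.
  intros Hr Hq HM.
  assert (HPI := PI_RGT_0).
  assert (HK : (0 <= K)%R).
  { assert (H := Hq 0 (RtoC rho)). rewrite Cmod_0, Cmod_R, Rabs_pos_eq in H by lra.
    specialize (H ltac:(lra) ltac:(lra)).
    replace (RtoC rho - 0) with (RtoC rho) in H by ring.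
    rewrite Cmod_R, Rabs_pos_eq in H by lra.
    assert (H1 := Cmod_ge_0 (f rho - f 0 - f' 0 * rho)).
    assert (0 < rho ^ 2)%R by (apply pow_lt; lra). nra. }
  (* Adding the estimate for (w1, w2) to the one for (w2, w1) leaves (f' w2 - f' w1)(w2 - w1), so f'
     is Lipschitz. The continuity of f' comes from here alone. *)
  assert (Hlip : forall w1 w2, (Cmod w1 <= rho)%R -> (Cmod w2 <= rho)%R ->
     (Cmod (f' w2 - f' w1) <= 2 * K * Cmod (w2 - w1))%R).
  { intros w1 w2 H1 H2. destruct (Ceq_dec w2 w1) as [->|Hn].
    { replace (f' w1 - f' w1) with (RtoC 0) by ring. rewrite Cmod_0.
      generalize (Cmod_ge_0 (w1 - w1)); nra. }
    assert (Hpos : (0 < Cmod (w2 - w1))%R).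
    { apply Cmod_gt_0. intros E. apply Hn. rewrite <- (Cplus_0_l w1), <- E. ring. }
    assert (A := Hq w1 w2 H1 H2). assert (B := Hq w2 w1 H2 H1).
    rewrite (Cmod_minus_sym w1 w2) in B.
    assert (T := Cmod_triangle (f w2 - f w1 - f' w1 * (w2 - w1)) (f w1 - f w2 - f' w2 * (w1 -
      w2))).
    replace (_ + _) with ((f' w2 - f' w1) * (w2 - w1)) in T by ring.
    rewrite Cmod_mult in T.
    apply Rmult_le_reg_r with (Cmod (w2 - w1)); auto. nra. }
  set (phi := fun t => f (circ rho t)).
  assert (Hcr : forall t, (Cmod (circ rho t) <= rho)%R) by (intros t; rewrite Cmod_circ; lra).
  assert (Hphi : forall t, Ccont phi t).
  { intros t. eapply Cder_cont. apply (Cder_comp_quadratic f f' rho K (2 * rho)); auto.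
    - intros s. apply circ_lipschitz; lra.
    - apply Cder_circ. }
  assert (HphiM : forall t, (Cmod (phi t) <= M)%R) by (intros t; apply HM, Hcr).
  split.
  { intros n. unfold taylor_coef. fold phi.
    rewrite Cmod_mult, Cmod_inv, Cmod_R, Rabs_pos_eq by (try apply RtoC_neq; lra).
    assert (H := circ_coef_bound rho M phi n Hr Hphi HphiM).
    apply Rmult_le_reg_l with (2 * PI)%R; [lra|]. rewrite <- Rmult_assoc, Rinv_r by lra. lra. }
  intros w Hw. assert (Hw0 := Cmod_ge_0 w).
  set (k := fun t => circ rho t * / (circ rho t - w)).
  assert (Hk : forall t, Ccont k t) by (intros t; now apply Ccont_kernel).
  set (p := fun l t => w + RtoC l * (circ rho t - w)).
  assert (Hp : forall l t, (0 <= l <= 1)%R -> (Cmod (p l t) <= rho)%R).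
  { intros l t Hl. unfold p.
    replace (w + RtoC l * (circ rho t - w)) with (RtoC (1 - l) * w + RtoC l * circ rho t)
      by (rewrite RtoC_minus; ring).
    apply Cmod_triangle_le.
    rewrite !Cmod_mult, !Cmod_R, !Rabs_pos_eq, Cmod_circ by lra. nra. }
  assert (Hpd : forall l t, Cder (p l) t (RtoC l * (circ rho t * Ci))).
  { intros l t. eapply Cder_val.
    - apply Cder_plus; [apply Cder_const|]. apply Cder_scal.
      apply Cder_minus; [apply Cder_circ|apply Cder_const].
    - ring. }
  assert (Hplip : forall l s t, (0 <= l <= 1)%R -> (Cmod (p l s - p l t) <= 2 * rho * Rabs (s -
    t))%R).
  { intros l s t Hl. unfold p. replace (_ - _) with (RtoC l * (circ rho s - circ rho t)) by ring.
    rewrite Cmod_mult, Cmod_R, Rabs_pos_eq by lra.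
    assert (H := circ_lipschitz rho s t ltac:(lra)).
    generalize (Cmod_ge_0 (circ rho s - circ rho t)); nra. }
  assert (Hfp : forall l t, (0 <= l <= 1)%R -> Cder (fun t => f (p l t)) t (f' (p l t) * (RtoC l
    * (circ rho t * Ci)))).
  { intros l t Hl. apply (Cder_comp_quadratic f f' rho K (2 * rho)); auto. }
  assert (Hf'c : forall l t, (0 <= l <= 1)%R -> Ccont (fun t => f' (p l t)) t).
  { intros l t Hl. apply (Ccont_lipschitz _ _ (2 * K * (2 * rho))). intros s.
    eapply Rle_trans; [apply Hlip; auto|]. rewrite (Rmult_assoc (2 * K)).
    apply Rmult_le_compat_l; [lra|auto]. }
  set (G := fun l => (CRInt (fun t => f (p l t) * k t) 0 (2 * PI)) : C).
  assert (HG : forall l, (0 <= l <= 1)%R -> is_CRInt (fun t => f (p l t) * k t) 0 (2 * PI) (G l)).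
  { intros l Hl. apply CRInt_continuous. intros t _. apply Ccont_mult; auto.
    eapply Cder_cont, Hfp; auto. }
  set (Q := (2 * PI * (K * (2 * rho) ^ 2 * (rho / (rho - Cmod w))))%R).
  assert (Hstep : forall l1 l2, (0 < l1 <= 1)%R -> (0 <= l2 <= 1)%R ->
     (Cmod (G l2 - G l1) <= Q * (l2 - l1) ^ 2)%R).
  { intros l1 l2 Hl1 Hl2.
    assert (HC : Ci <> 0).
    { intros E. assert (H := Cmod_Ci). rewrite E, Cmod_0 in H. lra. }
    assert (Hl1' : RtoC l1 <> 0) by (apply RtoC_neq; lra).
    (* The derivative of f (p l1 t) in t is f' (p l1 t) l1 i circ, with integral 0 over a period.
       Recovering this integrand means dividing by l1 i, which is why [Hstep] asks for l1 > 0. *)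
    assert (Z : is_CRInt (fun t => f' (p l1 t) * circ rho t) 0 (2 * PI) (RtoC 0)).
    { eapply CRInt_ext.
      2: { eapply CRInt_val.
           - apply (CRInt_scal (/ (RtoC l1 * Ci))).
             apply (CRInt_derive (fun t => f (p l1 t)) _ 0 (2 * PI)).
             + intros t _. apply Hfp; lra.
             + intros t _. apply Ccont_mult; [apply Hf'c; lra|].
               apply Ccont_mult; [apply Ccont_const|].
               apply Ccont_mult; [apply Ccont_circ|apply Ccont_const].
           - unfold p. rewrite circ_period. ring. }
      intros t _. cbv beta. field. auto. }
    assert (D := CRInt_minus _ _ _ _ _ _
       (CRInt_minus _ _ _ _ _ _ (HG l2 Hl2) (HG l1 ltac:(lra))) (CRInt_scal (RtoC (l2 - l1)) _ _
         _ _ Z)).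
    rewrite Cmult_0_r in D.
    assert (E : G l2 - G l1 - 0 = G l2 - G l1) by ring. rewrite E in D. clear E.
    eapply Rle_trans.
    - eapply (CRInt_norm_le _ 0 (2 * PI) (K * (2 * rho) ^ 2 * (rho / (rho - Cmod w)) * (l2 - l1)
        ^ 2)%R);
        [lra| |exact D].
      intros t _. cbv beta.
      assert (E : f (p l2 t) * k t - f (p l1 t) * k t - RtoC (l2 - l1) * (f' (p l1 t) * circ rho
        t)
         = (f (p l2 t) - f (p l1 t) - f' (p l1 t) * (p l2 t - p l1 t)) * k t).
      { assert (E : (p l2 t - p l1 t) * k t = RtoC (l2 - l1) * circ rho t).
        { unfold p, k. rewrite RtoC_minus. field. now apply circ_sub_neq_0. }
        replace (RtoC (l2 - l1) * (f' (p l1 t) * circ rho t)) with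
          (f' (p l1 t) * ((p l2 t - p l1 t) * k t)) by (rewrite E; ring). ring. }
      rewrite E, Cmod_mult.
      replace (K * (2 * rho) ^ 2 * (rho / (rho - Cmod w)) * (l2 - l1) ^ 2)%R with
        ((K * ((2 * rho) * Rabs (l2 - l1)) ^ 2) * (rho / (rho - Cmod w)))%R.
      2: { rewrite Rpow_mult_distr, pow2_abs. ring. }
      apply Rmult_le_compat; [apply Cmod_ge_0|apply Cmod_ge_0| |exact (Cmod_kernel rho t w Hw)].
      eapply Rle_trans; [apply Hq; apply Hp; lra|].
      apply Rmult_le_compat_l; auto. apply pow_incr. split; [apply Cmod_ge_0|].
      unfold p. replace (_ - _) with (RtoC (l2 - l1) * (circ rho t - w)) by (rewrite RtoC_minus;
        ring).
      rewrite Cmod_mult, Cmod_R, Rmult_comm. apply Rmult_le_compat_r; [apply Rabs_pos|].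
      assert (T := Cmod_triangle (circ rho t) (- w)). rewrite Cmod_opp, Cmod_circ in T by lra.
      change (circ rho t - w) with (circ rho t + - w). lra.
    - unfold Q. lra. }
  assert (HQ : (0 <= Q)%R).
  { unfold Q. apply Rmult_le_pos; [lra|]. apply Rmult_le_pos.
    - apply Rmult_le_pos; [lra|apply pow2_ge_0].
    - apply Rdiv_le_0_compat; lra. }
  assert (HG01 : G 1%R = G 0%R).
  (* Cutting [0, 1] into N equal steps gives |G 1 - G 0| <= N Q / N^2 for every N. Each step is
     based at its right end, since [Hstep] excludes l1 = 0. *)
  { assert (HN : forall N : nat, (0 < N)%nat -> (Cmod (G 1 - G 0)%C * INR N <= Q)%R).
    { intros N HN0. assert (HN : (0 < INR N)%R) by now apply lt_0_INR.
      assert (Hj : forall j : nat, (j <= N)%nat -> (Cmod (G (INR j / INR N)%R - G 0%R) <= INR j *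
        (Q / INR N ^ 2))%R).
      { induction j as [|j IH]; intros Hj.
        - simpl INR. unfold Rdiv at 1. rewrite Rmult_0_l.
          replace (G 0%R - G 0%R) with (RtoC 0) by ring. rewrite Cmod_0. lra.
        - assert (Hj1 : (INR (S j) <= INR N)%R) by now apply le_INR.
          assert (Hj0 := pos_INR j). rewrite S_INR in Hj1.
          eapply Rle_trans; [apply (Cmod_triangle_minus _ (G (INR j / INR N)%R))|].
          rewrite S_INR, Rmult_plus_distr_r, Rplus_comm.
          apply Rplus_le_compat; [apply IH; lia|].
          rewrite Cmod_minus_sym. eapply Rle_trans; [apply Hstep|].
          + split; [apply Rdiv_lt_0_compat; lra|]. apply Rle_div_l; lra.
          + split; [apply Rdiv_le_0_compat; lra|]. apply Rle_div_l; lra.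
          + apply Req_le. field. lra. }
      specialize (Hj N (le_n N)). replace (INR N / INR N)%R with 1%R in Hj by (field; lra).
      replace (INR N * (Q / INR N ^ 2))%R with (Q / INR N)%R in Hj by (field; lra).
      apply Rle_div_r; auto. }
    assert (Z : Cmod (G 1%R - G 0%R) = 0%R).
    { apply Rle_antisym; [|apply Cmod_ge_0].
      apply Rnot_lt_le. intros Hpos.
      destruct (INR_unbounded (Q / Cmod (G 1%R - G 0%R))) as [N HNN].
      assert (HN0 : (0 < N)%nat).
      { apply INR_lt. simpl. eapply Rle_lt_trans; [|exact HNN]. apply Rdiv_le_0_compat; auto. }
      specialize (HN N HN0). apply Rlt_div_l in HNN; auto. lra. }
    apply Cmod_eq_0 in Z. rewrite <- (Cplus_0_r (G 0%R)), <- Z. ring. }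
  assert (S1 : Cseries (fun n => circ_coef rho phi n * w ^ n) (G 1%R)).
  { apply (Cauchy_kernel_series rho M); auto.
    eapply CRInt_ext; [|apply (HG 1%R); lra].
    intros t _. unfold phi, p, k. f_equal. f_equal. ring. }
  (* At l = 0 the integrand is f w times the kernel, and the kernel integrates to 2 pi: in its
     series all coefficients but the first vanish by [circ_coef_one]. *)
  assert (S0 : G 0%R = RtoC (2 * PI) * f w).
  { assert (A : is_CRInt (fun t => (fun _ => RtoC 1) t * k t) 0 (2 * PI) (CRInt (fun t => 1 * k
      t) 0 (2 * PI))).
    { apply CRInt_continuous. intros t _. apply Ccont_mult; auto. apply Ccont_const. }
    assert (B := Cauchy_kernel_series rho 1 (fun _ => RtoC 1) w _ Hw ltac:(intros; apply
      Ccont_const)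
       ltac:(intros; cbv beta; rewrite Cmod_1; lra) A).
    assert (B' : Cseries (fun n => circ_coef rho (fun _ => 1) n * w ^ n) (RtoC (2 * PI))).
    { apply (Cseries_of_bound _ _ (fun _ => 0%R)); [|apply is_lim_seq_const].
      intros n. replace (Csum _ n) with (RtoC (2 * PI)).
      { replace (RtoC (2 * PI) - RtoC (2 * PI)) with (RtoC 0) by ring. rewrite Cmod_0. lra. }
      induction n as [|n IH].
      - rewrite Csum_O. simpl. rewrite Cmult_1_r. symmetry.
        eapply CRInt_unique; [apply circ_coef_correct; auto; intros; apply Ccont_const|].
        eapply CRInt_ext; [|eapply CRInt_val; [apply (is_RInt_const (V := C_R_NormedModule) 0 (2
          * PI) (RtoC 1))|]].
        + intros t _. simpl. ring.
        + change ((((2 * PI - 0) * 1)%R, ((2 * PI - 0) * 0)%R) = RtoC (2 * PI)).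
          unfold RtoC. f_equal; ring.
      - rewrite Csum_S, <- IH, circ_coef_one by auto. ring. }
    assert (E := Cseries_unique _ _ _ B B').
    eapply CRInt_unique; [apply HG; lra|]. rewrite Cmult_comm, <- E.
    eapply CRInt_ext; [|apply CRInt_scal; exact A].
    intros t _. unfold p. cbv beta. replace (w + RtoC 0 * (circ rho t - w)) with w by ring.
    ring. }
  eapply Cseries_val.
  - eapply Cseries_ext; [|apply (Cseries_mult_l (/ RtoC (2 * PI))); exact S1].
    intros n. unfold taylor_coef. fold phi. ring.
  - rewrite HG01, S0. field. apply RtoC_neq. lra.
Qed.

(** * The periodic zeta function *)

Definition CSeries (a : nat -> C) : C :=
  iota (T := C_CompleteNormedModule) (fun l : C => Cseries a l).

Lemma CSeries_unique (a : nat -> C) (l : C) : Cseries a l -> CSeries a = l.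
Proof.
  intros H. apply (iota_unique (V := C_CompleteNormedModule)); auto.
  intros y Hy. exact (Cseries_unique _ _ _ Hy H).
Qed.

Lemma CSeries_correct (a : nat -> C) : (exists l, Cseries a l) -> Cseries a (CSeries a).
Proof. intros [l Hl]. now rewrite (CSeries_unique _ _ Hl). Qed.

(** * Finite differences of n^(-s) and summation by parts *)

Fixpoint fdiff (k : nat) (s : C) (x : R) : C :=
  match k with
  | O => cpow x (- s)
  | S k => fdiff k s (x + 1) - fdiff k s x
  end.

Lemma Cder_cpow (s : C) (x : R) :
  (0 < x)%R -> Cder (fun y => cpow y s) x (s * cpow x (s - 1)).
Proof.
  intros Hx. eapply Cder_val.
  - apply Cder_Cexp. apply Cder_scal. apply (Cder_RtoC ln). apply is_derive_ln; auto.
  - cbv beta. fold (cpow x s). replace s with (s - 1 + 1) at 1 by ring.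
    rewrite cpow_add, cpow_1, RtoC_inv by lra. field. apply RtoC_neq; lra.
Qed.

Lemma Cder_fdiff (k : nat) (s : C) (x : R) :
  (0 < x)%R -> Cder (fdiff k s) x (- s * fdiff k (s + 1) x).
Proof.
  revert x. induction k as [|k IH]; intros x Hx; simpl.
  - eapply Cder_val; [apply Cder_cpow; auto|].
    do 2 f_equal. ring.
  - eapply Cder_val.
    + apply Cder_minus; [|apply IH; auto].
      apply (Cder_comp (fdiff k s) (fun y => y + 1)%R); [apply IH; lra|].
      auto_derive; auto.
    + cbv beta. ring.
Qed.

(** The modulus of s (s+1) ... (s+k-1), the factor that k differentiations of x^(-s) bring out. At s
    = -m it contains a zero factor as soon as k > m. *)
Fixpoint rising_mod (k : nat) (s : C) : R :=
  match k with
  | O => 1%R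
  | S k => (Cmod s * rising_mod k (s + 1))%R
  end.

Lemma rising_mod_pos (k : nat) (s : C) : (0 <= rising_mod k s)%R.
Proof.
  revert s; induction k as [|k IH]; intros s; simpl; [lra|].
  apply Rmult_le_pos; [apply Cmod_ge_0|auto].
Qed.

Lemma rising_mod_le (k : nat) (s : C) : (rising_mod k s <= (Cmod s + INR k) ^ k)%R.
Proof.
  revert s; induction k as [|k IH]; intros s; [simpl; lra|].
  rewrite S_INR. simpl. assert (Hs := Cmod_ge_0 s). assert (Hk := pos_INR k).
  apply Rmult_le_compat; auto; [apply rising_mod_pos|lra|].
  eapply Rle_trans; [apply IH|].
  apply pow_incr. assert (H := Cmod_triangle s 1). rewrite Cmod_1 in H.
  generalize (Cmod_ge_0 (s + 1)). lra.
Qed.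

Lemma rising_mod_zero (m k : nat) : (m < k)%nat -> rising_mod k (- RtoC (INR m)) = 0%R.
Proof.
  revert k; induction m as [|m IH]; intros [|k] H; try lia;
    change (rising_mod (S k)) with (fun s => (Cmod s * rising_mod k (s + 1))%R); cbv beta.
  - simpl INR. rewrite Cmod_opp, Cmod_0. ring.
  - rewrite S_INR, RtoC_plus. replace (- (INR m + 1) + 1) with (- RtoC (INR m)) by ring.
    rewrite IH by lia. ring.
Qed.

Lemma is_derive_linear (c t : R) : is_derive (fun y => c * y)%R t c.
Proof. auto_derive; auto. ring. Qed.

Lemma Rpower_anti (x y p : R) : (0 < x)%R -> (x <= y)%R -> (0 <= p)%R -> (Rpower y (- p) <=
  Rpower x (- p))%R.
Proof.
  intros Hx Hxy Hp. rewrite !Rpower_Ropp.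
  apply Rinv_le_contravar; [apply exp_pos|]. apply Rle_Rpower_l; lra.
Qed.

(** A difference is bounded by the derivative on [x, x+1], and differentiating replaces s by s+1 at
    the price of a factor s; so each difference gains one power of x. The sign condition makes that
    power largest at the left end x. The 2^k comes from the mean value inequality. *)
Lemma fdiff_bound (k : nat) (s : C) (x : R) :
  (1 <= x)%R -> (0 <= fst s + INR k)%R ->
  (Cmod (fdiff k s x) <= 2 ^ k * rising_mod k s * Rpower x (- (fst s + INR k)))%R.
Proof.
  revert s x; induction k as [|k IH]; intros s x Hx Hs.
  - simpl. rewrite Cmod_cpow. apply Req_le. rewrite !Rmult_1_l. f_equal.
    destruct s; simpl; ring.
  - simpl fdiff. rewrite S_INR in *.
    set (D := (Cmod s * (2 ^ k * rising_mod k (s + 1) * Rpower x (- (fst s + (INR k + 1)))))%R).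
    assert (H := Cmean_value (fdiff k s) (fun y => - s * fdiff k (s + 1) y) (fun y => D * y)%R
      (fun _ => D) x (x + 1)).
    eapply Rle_trans; [apply H|]; clear H.
    + lra.
    + intros t Ht. apply Cder_fdiff. lra.
    + intros t _. auto_derive; auto. ring.
    + intros t Ht. unfold D. rewrite Cmod_mult, Cmod_opp.
      apply Rmult_le_compat_l; [apply Cmod_ge_0|].
      assert (E : fst (s + 1) = (fst s + 1)%R) by (destruct s; reflexivity).
      eapply Rle_trans; [apply IH; [lra|rewrite E; lra]|].
      apply Rmult_le_compat_l.
      { apply Rmult_le_pos; [apply pow_le; lra|apply rising_mod_pos]. }
      rewrite E. replace (fst s + 1 + INR k)%R with (fst s + (INR k + 1))%R by ring.
      apply Rpower_anti; lra.
    + unfold D. simpl. apply Req_le. ring.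
Qed.

(** Comparison with the integral: T is an antiderivative of x^(-p), each term is at most an
    increment of T, and the increments telescope to a bounded sum because T <= 0. *)
Lemma ex_series_Rpower (p : R) : (1 < p)%R -> ex_series (fun n => Rpower (INR (S n)) (- p)).
Proof.
  intros Hp.
  assert (Hd : forall x, (0 < x)%R -> is_derive (fun y => - Rpower y (1 - p) / (p - 1))%R x
    (Rpower x (- p))).
  { intros x Hx. unfold Rpower. auto_derive; auto.
    replace ((1 - p) * ln x)%R with (- p * ln x + ln x)%R by ring.
    rewrite exp_plus, exp_ln by auto. field. split; lra. }
  set (T := fun x => (- Rpower x (1 - p) / (p - 1))%R) in *.
  assert (Hb : forall n : nat, (Rpower (INR (S n) + 1) (- p) <= T (INR (S n) + 1) - T (INR (S
    n)))%R).
  { intros n. assert (Hn : (0 < INR (S n))%R) by (apply lt_0_INR; lia).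
    assert (H := derive_le_incr (fun y => T y - Rpower (INR (S n) + 1) (- p) * y)%R
      (fun y => Rpower y (- p) - Rpower (INR (S n) + 1) (- p))%R (INR (S n)) (INR (S n) + 1)).
    cbv beta in H.
    enough (T (INR (S n)) - Rpower (INR (S n) + 1) (- p) * INR (S n) <=
            T (INR (S n) + 1) - Rpower (INR (S n) + 1) (- p) * (INR (S n) + 1))%R by lra.
    apply H; [lra| |].
    - intros t Ht. apply (is_derive_minus (V := R_NormedModule)); [apply Hd; lra|].
      apply is_derive_linear.
    - intros t Ht. assert (H1 := Rpower_anti t (INR (S n) + 1) p). lra. }
  assert (HT : forall x, (0 < x)%R -> (T x <= 0)%R).
  { intros x Hx. unfold T. assert (0 < Rpower x (1 - p))%R by apply exp_pos.
    assert (0 <= Rpower x (1 - p) / (p - 1))%R by (apply Rdiv_le_0_compat; lra).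
    unfold Rdiv in *. lra. }
  apply ex_series_incr_1.
  apply (ex_series_le (K := R_AbsRing) (V := R_CompleteNormedModule) _
     (fun n => T (INR (S n) + 1) - T (INR (S n)))%R).
  { intros n. change (Rabs (Rpower (INR (S (S n))) (- p)) <= T (INR (S n) + 1) - T (INR (S n)))%R.
    rewrite Rabs_pos_eq by (left; apply exp_pos). rewrite (S_INR (S n)). apply Hb. }
  assert (Hs : forall N, (sum_n (fun n => T (INR (S n) + 1) - T (INR (S n)))%R N = T (INR (S N) +
    1) - T 1)%R).
  { induction N as [|N IH].
    - rewrite sum_O. reflexivity.
    - rewrite sum_Sn, IH. unfold plus; simpl plus. rewrite (S_INR (S N)).
      change (T (INR (S N) + 1) - T 1 + (T (INR (S N) + 1 + 1) - T (INR (S N) + 1)) = T (INR (S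
        N) + 1 + 1) - T 1)%R.
      ring. }
  assert (L : ex_finite_lim_seq (sum_n (fun n => T (INR (S n) + 1) - T (INR (S n)))%R)).
  { apply (ex_finite_lim_seq_incr _ (- T 1)%R).
    - intros N. rewrite sum_Sn. change (sum_n (fun n => T (INR (S n) + 1) - T (INR (S n)))%R N <=
        sum_n (fun n => T (INR (S n) + 1) - T (INR (S n)))%R N + (T (INR (S (S N)) + 1) - T (INR
          (S (S N)))))%R.
      generalize (Hb (S N)). assert (0 < Rpower (INR (S (S N)) + 1) (- p))%R by apply exp_pos.
      lra.
    - intros N. rewrite Hs. assert (H := HT (INR (S N) + 1)%R).
      assert (0 < INR (S N))%R by (apply lt_0_INR; lia). lra. }
  exact L.
Qed.

Definition zeta_term (q : C) (k : nat) (s : C) (n : nat) : C :=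
  q ^ (S n) * fdiff k s (INR (S n)).

Lemma zeta_term_bound (q : C) (k : nat) (s : C) (p : R) (n : nat) :
  Cmod q = 1%R -> (0 <= p <= fst s + INR k)%R ->
  (Cmod (zeta_term q k s n) <= (2 * (Cmod s + INR k)) ^ k * Rpower (INR (S n)) (- p))%R.
Proof.
  intros Hq Hp. unfold zeta_term. rewrite Cmod_mult, Cmod_pow, Hq, pow1, Rmult_1_l.
  assert (Hn : (1 <= INR (S n))%R) by (rewrite S_INR; generalize (pos_INR n); lra).
  eapply Rle_trans; [apply fdiff_bound; lra|].
  apply Rmult_le_compat.
  - apply Rmult_le_pos; [apply pow_le; lra|apply rising_mod_pos].
  - left; apply exp_pos.
  - rewrite Rpow_mult_distr. apply Rmult_le_compat_l; [apply pow_le; lra|apply rising_mod_le].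
  - apply Rle_Rpower; lra.
Qed.

Lemma zeta_series (q : C) (k : nat) (s : C) :
  Cmod q = 1%R -> (1 < fst s + INR k)%R ->
  Cseries (zeta_term q k s) (CSeries (zeta_term q k s)).
Proof.
  intros Hq Hs. apply CSeries_correct.
  apply (Cseries_ex_dom _ (fun n => (2 * (Cmod s + INR k)) ^ k * Rpower (INR (S n)) (- (fst s +
    INR k)))%R).
  - intros n. apply zeta_term_bound; auto. lra.
  - apply ex_series_Rmult_l. now apply ex_series_Rpower.
Qed.

(* Summation by parts k times gives this expression for the sum of
   q^n n^(-s), which makes sense for Re s > 1 - k. *)
Fixpoint zeta_head (q : C) (k : nat) (s : C) : C :=
  match k with
  | O => 0
  | S k => zeta_head q k s + (q / (1 - q)) ^ (S k) * fdiff k s 1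
  end.

Definition zeta_part (q : C) (k : nat) (s : C) : C :=
  zeta_head q k s + (q / (1 - q)) ^ k * CSeries (zeta_term q k s).

(** With a_n the k-th difference at n, the sum of q^n a_(n+1) is 1/q times the original series
    without its first term. Bare convergence is assumed, so the step also applies to the
    conditionally convergent series at s = 1. *)
Lemma zeta_summation_by_parts (q : C) (k : nat) (s S0 : C) :
  1 - q <> 0 -> q <> 0 -> Cseries (zeta_term q k s) S0 ->
  Cseries (zeta_term q (S k) s) ((1 - q) / q * S0 - fdiff k s 1).
Proof.
  intros Hq Hq0 H. assert (H1 := Cseries_shift _ _ H).
  assert (H2 := Cseries_minus _ _ _ _ (Cseries_mult_l (/ q) _ _ H1) H).
  eapply Cseries_val; [eapply Cseries_ext; [|exact H2]|].
  - intros n. unfold zeta_term. rewrite (S_INR (S n)). simpl fdiff. rewrite (Cpow_S q (S n)).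
    field. auto.
  - unfold zeta_term. simpl INR. simpl Cpow. field. auto.
Qed.

Lemma zeta_part_S (q : C) (k : nat) (s : C) :
  Cmod q = 1%R -> 1 - q <> 0 -> (1 < fst s + INR k)%R -> zeta_part q k s = zeta_part q (S k) s.
Proof.
  intros Hq1 Hq Hs.
  assert (Hq0 : q <> 0) by (intros E; rewrite E, Cmod_0 in Hq1; lra).
  unfold zeta_part.
  rewrite (CSeries_unique _ _ (zeta_summation_by_parts q k s _ Hq Hq0 (zeta_series q k s Hq1
    Hs))).
  simpl. field. auto.
Qed.

Lemma zeta_part_consistent (q : C) (k k' : nat) (s : C) :
  Cmod q = 1%R -> 1 - q <> 0 -> (1 < fst s + INR k)%R -> (1 < fst s + INR k')%R ->
  zeta_part q k s = zeta_part q k' s.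
Proof.
  intros Hq1 Hq.
  assert (K : forall d k, (1 < fst s + INR k)%R -> zeta_part q k s = zeta_part q (k + d) s).
  { induction d as [|d IH]; intros j Hj; [now rewrite Nat.add_0_r|].
    rewrite (zeta_part_S q j) by auto.
    replace (j + S d)%nat with (S j + d)%nat by lia. apply IH. rewrite S_INR; lra. }
  intros H H'. destruct (Nat.le_ge_cases k k') as [L|L].
  - replace k' with (k + (k' - k))%nat by lia. now apply K.
  - symmetry. replace k with (k' + (k - k'))%nat by lia. now apply K.
Qed.

(** The number k of summations by parts is taken so that Re s + k >= 2, safely inside the region of
    absolute convergence. Every other k with Re s + k > 1 gives the same value, by
    [zeta_part_consistent]. *)
Definition zeta_cont (q s : C) : C := zeta_part q (Z.to_nat (up (2 - fst s))) s.

Lemma INR_to_nat_up (t : R) : (t <= INR (Z.to_nat (up t)))%R.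
Proof.
  destruct (archimed t) as [H _].
  destruct (Z_le_dec 0 (up t)) as [L|L].
  - rewrite INR_IZR_INZ, Z2Nat.id by auto. lra.
  - assert (H1 : (up t <= 0)%Z) by lia. apply IZR_le in H1.
    generalize (pos_INR (Z.to_nat (up t))). lra.
Qed.

Lemma zeta_cont_part (q : C) (k : nat) (s : C) :
  Cmod q = 1%R -> 1 - q <> 0 -> (1 < fst s + INR k)%R -> zeta_cont q s = zeta_part q k s.
Proof.
  intros Hq1 Hq H. apply zeta_part_consistent; auto.
  generalize (INR_to_nat_up (2 - fst s)). lra.
Qed.

(** * Analyticity of the continuation: the quadratic estimate on the unit disc *)

Definition quadratic_approx (f : C -> C) : Prop :=
  exists (f' : C -> C) (K : R), forall w1 w2, (Cmod w1 <= 1)%R -> (Cmod w2 <= 1)%R ->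
     (Cmod (f w2 - f w1 - f' w1 * (w2 - w1)) <= K * Cmod (w2 - w1) ^ 2)%R.

Lemma quadratic_approx_plus (f g : C -> C) :
  quadratic_approx f -> quadratic_approx g -> quadratic_approx (fun w => f w + g w).
Proof.
  intros (f' & K & H) (g' & L & H'). exists (fun w => f' w + g' w), (K + L)%R.
  intros w1 w2 H1 H2. specialize (H w1 w2 H1 H2). specialize (H' w1 w2 H1 H2).
  replace (_ - _) with ((f w2 - f w1 - f' w1 * (w2 - w1)) + (g w2 - g w1 - g' w1 * (w2 - w1))) by
    ring.
  apply Cmod_triangle_le. lra.
Qed.

Lemma quadratic_approx_scal (c : C) (f : C -> C) :
  quadratic_approx f -> quadratic_approx (fun w => c * f w).
Proof.
  intros (f' & K & H). exists (fun w => c * f' w), (Cmod c * K)%R.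
  intros w1 w2 H1 H2. specialize (H w1 w2 H1 H2).
  replace (_ - _) with (c * (f w2 - f w1 - f' w1 * (w2 - w1))) by ring.
  rewrite Cmod_mult, Rmult_assoc. apply Rmult_le_compat_l; auto. apply Cmod_ge_0.
Qed.

Lemma quadratic_approx_const (c : C) : quadratic_approx (fun _ => c).
Proof.
  exists (fun _ => 0), 0%R. intros w1 w2 _ _.
  replace (_ - _) with (RtoC 0) by ring. rewrite Cmod_0. lra.
Qed.

Lemma quadratic_approx_Cexp (a b : C) : quadratic_approx (fun w => Cexp (a + w * b)).
Proof.
  exists (fun w => Cexp (a + w * b) * b), (exp (Cmod a + Cmod b) * (4 * Cmod b ^ 2 * exp (2 *
    Cmod b)))%R.
  intros w1 w2 H1 H2.
  assert (Hb := Cmod_ge_0 b).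
  replace (a + w2 * b) with ((a + w1 * b) + (w2 - w1) * b) by ring.
  rewrite Cexp_add.
  replace (_ - _) with (Cexp (a + w1 * b) * (Cexp ((w2 - w1) * b) - 1 - (w2 - w1) * b)) by ring.
  rewrite Cmod_mult, Rmult_assoc.
  apply Rmult_le_compat; [apply Cmod_ge_0|apply Cmod_ge_0| |].
  - apply Cmod_Cexp_le. apply Cmod_triangle_le. rewrite Cmod_mult. nra.
  - eapply Rle_trans; [apply Cexp_taylor2|]. rewrite Cmod_mult, Rpow_mult_distr.
    assert (H3 : (Cmod (w2 - w1) <= 2)%R).
    { assert (H := Cmod_triangle w2 (- w1)). rewrite Cmod_opp in H. unfold Cminus. lra. }
    replace (4 * (Cmod (w2 - w1) ^ 2 * Cmod b ^ 2) * exp (Cmod (w2 - w1) * Cmod b))%R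
      with ((4 * Cmod b ^ 2 * exp (Cmod (w2 - w1) * Cmod b)) * Cmod (w2 - w1) ^ 2)%R by ring.
    apply Rmult_le_compat_r; [apply pow2_ge_0|].
    apply Rmult_le_compat_l; [generalize (pow2_ge_0 (Cmod b)); lra|].
    destruct (Req_dec (Cmod (w2 - w1) * Cmod b) (2 * Cmod b)) as [->|]; [lra|].
    left. apply exp_increasing. assert (Cmod (w2 - w1) * Cmod b <= 2 * Cmod b)%R by nra. lra.
Qed.

Lemma quadratic_approx_ext (f g : C -> C) :
  (forall w, f w = g w) -> quadratic_approx f -> quadratic_approx g.
Proof.
  intros E (f' & K & H). exists f', K. intros w1 w2. rewrite <- !E. apply H.
Qed.

Lemma quadratic_approx_fdiff (k : nat) (a : C) (x : R) :
  quadratic_approx (fun w => fdiff k (a + w) x).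
Proof.
  revert x; induction k as [|k IH]; intros x; simpl.
  - eapply quadratic_approx_ext; [|apply (quadratic_approx_Cexp (- a * ln x) (- ln x))].
    intros w. unfold cpow. f_equal. ring.
  - eapply quadratic_approx_ext; [|apply (quadratic_approx_plus _ _ (IH (x + 1)%R)
      (quadratic_approx_scal (- (1)) _ (IH x)))].
    intros w. cbv beta. ring.
Qed.

Lemma quadratic_approx_bounded (f : C -> C) :
  quadratic_approx f -> exists M, forall w, (Cmod w <= 1)%R -> (Cmod (f w) <= M)%R.
Proof.
  intros (f' & K & H). exists (Rabs K + Cmod (f 0) + Cmod (f' 0))%R.
  intros w Hw. assert (H1 := H 0 w). rewrite Cmod_0 in H1. specialize (H1 ltac:(lra) Hw).
  replace (w - 0) with w in H1 by ring.
  replace (f w) with ((f w - f 0 - f' 0 * w) + (f 0 + f' 0 * w)) by ring.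
  apply Cmod_triangle_le.
  assert (H2 := Cmod_triangle (f 0) (f' 0 * w)). rewrite Cmod_mult in H2.
  assert (H3 := Cmod_ge_0 w). assert (H4 := Cmod_ge_0 (f' 0)). assert (H5 := Rle_abs K).
  assert (H6 := Rabs_pos K).
  assert (Cmod w ^ 2 <= 1)%R by nra. assert (0 <= Cmod w ^ 2)%R by apply pow2_ge_0.
  assert (K * Cmod w ^ 2 <= Rabs K)%R by nra. nra.
Qed.

(** Each term of the remaining series is holomorphic in s, so Cauchy's estimate bounds its Taylor
    coefficients at a by its supremum on the unit disc about a. These suprema are summable, and the
    two summations can be exchanged. *)
Lemma zeta_cont_analytic (q a : C) :
  Cmod q = 1%R -> 1 - q <> 0 -> analytic_at (zeta_cont q) a.
Proof.
  intros Hq1 Hq.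
  (* One k for the whole disc: Re s + k >= 2 holds at distance at most 1 from a, so the terms there
     are dominated by a multiple of (n+1)^(-2). *)
  set (k := Z.to_nat (up (3 - fst a))).
  assert (Hk : (3 <= fst a + INR k)%R) by (generalize (INR_to_nat_up (3 - fst a)); unfold k; lra).
  assert (Hball : forall w, (Cmod w <= 1)%R -> (2 <= fst (a + w)%C + INR k)%R).
  { intros w Hw. assert (H := abs_fst_le w). apply Rabs_le_between in H.
    destruct a, w; simpl in *. lra. }
  set (g := fun n w => zeta_term q k (a + w) n).
  set (B := fun n => ((2 * (Cmod a + 1 + INR k)) ^ k * Rpower (INR (S n)) (- (2)))%R).
  assert (HgB : forall n w, (Cmod w <= 1)%R -> (Cmod (g n w) <= B n)%R).
  { intros n w Hw. unfold g, B. eapply Rle_trans; [apply (zeta_term_bound q k _ 2 n); auto|].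
    - specialize (Hball w Hw). lra.
    - apply Rmult_le_compat_r; [left; apply exp_pos|].
      assert (H := Cmod_triangle a w). assert (H1 := pos_INR k). assert (H2 := Cmod_ge_0 (a + w)).
      apply pow_incr. lra. }
  assert (HB : ex_series B).
  { apply ex_series_Rmult_l. apply ex_series_Rpower. lra. }
  assert (Hgq : forall n, quadratic_approx (g n)).
  { intros n. apply quadratic_approx_scal. apply quadratic_approx_fdiff. }
  assert (HgT : forall n, (forall j, (Cmod (taylor_coef 1 (g n) j) <= B n / 1 ^ j)%R) /\
     forall w, (Cmod w < 1)%R -> Cseries (fun j => taylor_coef 1 (g n) j * w ^ j) (g n w)).
  { intros n. destruct (Hgq n) as (f' & K & HK).
    apply (Cauchy_Taylor (g n) f' 1 K (B n)); auto; lra. }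
  set (P := fun j => CSeries (fun n => taylor_coef 1 (g n) j)).
  assert (HP : forall j, Cseries (fun n => taylor_coef 1 (g n) j) (P j)).
  { intros j. apply CSeries_correct. apply (Cseries_ex_dom _ B); auto.
    intros n. destruct (HgT n) as [H _]. specialize (H j). rewrite pow1 in H. lra. }
  assert (Hh : exists e : nat -> C, forall w, (Cmod w < 1)%R ->
     Cseries (fun j => e j * w ^ j) (zeta_head q k (a + w))).
  { assert (Hqh : quadratic_approx (fun w => zeta_head q k (a + w))).
    { clear. induction k as [|k IH]; simpl; [apply quadratic_approx_const|].
      apply quadratic_approx_plus; auto. apply quadratic_approx_scal, quadratic_approx_fdiff. }
    destruct (quadratic_approx_bounded _ Hqh) as [M HM].
    destruct Hqh as (f' & K & HK).
    destruct (Cauchy_Taylor _ f' 1 K M ltac:(lra) HK HM) as [_ H]. eexists. exact H. }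
  destruct Hh as [e He].
  exists (fun j => e j + (q / (1 - q)) ^ k * P j), 1%R. split; [lra|].
  intros s Hs. apply is_pseries_Cseries.
  assert (Es : a + (s - a) = s) by ring.
  assert (H1 := Hball (s - a) ltac:(lra)). rewrite Es in H1.
  rewrite (zeta_cont_part q k) by (auto; lra). unfold zeta_part.
  eapply Cseries_ext.
  2: { apply Cseries_plus.
       - eapply Cseries_val; [apply (He (s - a) Hs)|]. now rewrite Es.
       - apply Cseries_mult_l.
         destruct HB as [SB HB].
         apply (Cseries_swap_power (fun n j => taylor_coef 1 (g n) j) B SB 1 (s - a)
            (fun n => g n (s - a)) P); auto; try lra.
         + intros n j. apply HgT.
         + intros n. now apply HgT.
         + eapply Cseries_ext; [|apply zeta_series; auto; lra].
           intros n. unfold g. now rewrite Es. }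
  intros j. cbv beta. ring.
Qed.

Lemma e2pi_INR_mul (n : nat) (alpha : R) : e2pi (INR n * alpha) = e2pi alpha ^ n.
Proof.
  unfold e2pi. rewrite Cpow_Cexp. f_equal. unfold Cmult, RtoC; simpl. f_equal; ring.
Qed.

Lemma Cmod_e2pi (alpha : R) : Cmod (e2pi alpha) = 1%R.
Proof. unfold e2pi. rewrite Cmod_Cexp. simpl. apply exp_0. Qed.

Lemma zeta_cont_continues (alpha : R) :
  1 - e2pi alpha <> 0 -> continues_periodic_zeta alpha (zeta_cont (e2pi alpha)).
Proof.
  intros Hq. assert (Hq1 := Cmod_e2pi alpha). split.
  - intros a. now apply zeta_cont_analytic.
  - intros s Hs. rewrite (zeta_cont_part _ 0) by (auto; simpl; lra).
    unfold zeta_part. cbn [zeta_head Cpow]. rewrite Cplus_0_l, Cmult_1_l.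
    eapply Cseries_ext; [|apply zeta_series; auto; simpl; lra].
    intros n. unfold zeta_term.
    change (fdiff 0 s (INR (S n))) with (cpow (INR (S n)) (- s)).
    now rewrite e2pi_INR_mul, cpow_opp.
Qed.

(** * Order of vanishing of power series and uniqueness of the continuation *)

Lemma Cseries_terms_bounded (a : nat -> C) (l : C) :
  Cseries a l -> exists D, (0 <= D)%R /\ forall n, (Cmod (a n) <= D)%R.
Proof.
  intros H. destruct (Cseries_eps _ _ _ H Rlt_0_1) as [N HN].
  assert (K : forall N, exists D, (0 <= D)%R /\ forall n, (n <= N)%nat -> (Cmod (a n) <= D)%R).
  { induction N0 as [|N0 (D & H0 & HD)].
    - exists (Cmod (a 0%nat)). split; [apply Cmod_ge_0|]. intros n Hn.
      replace n with 0%nat by lia. lra.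
    - exists (D + Cmod (a (S N0)))%R. assert (H1 := Cmod_ge_0 (a (S N0))). split; [lra|].
      intros n Hn. destruct (Nat.eq_dec n (S N0)) as [->|]; [lra|].
      specialize (HD n ltac:(lia)). lra. }
  destruct (K N) as (D & H0 & HD). exists (D + 2)%R. split; [lra|]. intros n.
  destruct (Nat.le_gt_cases n N) as [L|L]; [specialize (HD n L); lra|].
  destruct n as [|n]; [lia|].
  assert (H1 := HN n ltac:(lia)). assert (H2 := HN (S n) ltac:(lia)).
  rewrite Csum_S in H2. rewrite Cmod_minus_sym in H1.
  assert (H3 := Cmod_triangle (Csum a n + a (S n) - l) (l - Csum a n)).
  replace (Csum a n + a (S n) - l + (l - Csum a n)) with (a (S n)) in H3 by ring. lra.
Qed.

(** The first nonzero term is the sum minus the tail, and the tail is at most D x^(j+1) / (1-x),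
    where 1/(1-x) <= 2. *)
Lemma Cseries_leading (b : nat -> C) (D x : R) (j : nat) (l : C) :
  (0 <= x <= 1 / 2)%R -> (forall i, (i < j)%nat -> b i = 0) ->
  (forall i, (Cmod (b i) <= D * x ^ i)%R) -> Cseries b l ->
  (Cmod (b j) <= Cmod l + 2 * D * x ^ S j)%R.
Proof.
  intros Hx Hz HD Hl.
  assert (Hs : Csum b j = b j).
  { destruct j as [|j]; [apply Csum_O|]. rewrite Csum_S.
    assert (E : forall i, (i <= j)%nat -> Csum b i = 0).
    { induction i as [|i IH]; intros Hi; [rewrite Csum_O; apply Hz; lia|].
      rewrite Csum_S, IH, Hz by lia. ring. }
    rewrite E by lia. ring. }
  assert (Hg : is_series (fun i => D * x ^ i)%R (D * / (1 - x))%R).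
  { apply (is_series_Rmult_l D).
    apply is_series_geom. rewrite Rabs_pos_eq; lra. }
  assert (HT := Cseries_tail_bound b _ l _ j HD Hg).
  specialize (HT Hl). rewrite Hs in HT.
  assert (Hgs : forall n, (sum_n (fun i => D * x ^ i)%R n = D * ((1 - x ^ S n) / (1 - x)))%R).
  { induction n as [|n IH].
    - rewrite sum_O. simpl. field. lra.
    - rewrite sum_Sn, IH.
      change (D * ((1 - x ^ S n) / (1 - x)) + D * x ^ S n = D * ((1 - x ^ S (S n)) / (1 - x)))%R.
      simpl. field. lra. }
  rewrite Hgs in HT.
  replace (D * / (1 - x) - D * ((1 - x ^ S j) / (1 - x)))%R with (D * x ^ S j * / (1 - x))%R in HT
    by (field; lra).
  assert (HD0 : (0 <= D)%R).
  { specialize (HD 0%nat). simpl in HD. generalize (Cmod_ge_0 (b 0%nat)). lra. }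
  assert (Hi : (/ (1 - x) <= 2)%R).
  { replace 2%R with (/ (1 / 2))%R by field. apply Rinv_le_contravar; lra. }
  assert (Hp : (0 <= D * x ^ S j)%R) by (apply Rmult_le_pos; [auto|apply pow_le; lra]).
  assert (H3 := Cmod_triangle (b j - l) l). replace (b j - l + l) with (b j) in H3 by ring.
  nra.
Qed.

(** By strong induction on j the terms before t^j vanish. Then p j t^j is bounded by f t plus the
    tail, that is by a multiple of t^(j+1), and letting t tend to 0 gives p j = 0. Positive real
    arguments suffice, which is all that the applications provide. *)
Lemma power_series_order (p : nat -> C) (f : R -> C) (rho M : R) (N : nat) :
  (0 < rho)%R ->
  (forall t, (0 < t < rho)%R -> Cseries (fun j => p j * RtoC t ^ j) (f t)) ->
  (forall t, (0 < t < rho)%R -> (Cmod (f t) <= M * t ^ N)%R) ->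
  forall j, (j < N)%nat -> p j = 0.
Proof.
  intros Hr Hs HM.
  destruct (Cseries_terms_bounded _ _ (Hs (rho / 2)%R ltac:(lra))) as (D & HD0 & HD).
  assert (HDt : forall t i, (0 < t)%R -> (Cmod (p i * RtoC t ^ i) <= D * (t / (rho / 2)) ^ i)%R).
  { intros t i Ht. specialize (HD i).
    rewrite Cmod_mult, Cmod_pow, Cmod_R, Rabs_pos_eq in HD |- * by lra.
    unfold Rdiv at 1. rewrite Rpow_mult_distr, pow_inv.
    assert (Hti : (0 < t ^ i)%R) by (apply pow_lt; lra).
    assert (Hri : (0 < (rho / 2) ^ i)%R) by (apply pow_lt; lra).
    apply Rmult_le_reg_r with ((rho / 2) ^ i)%R; auto.
    replace (D * (t ^ i * / (rho / 2) ^ i) * (rho / 2) ^ i)%R with (D * t ^ i)%R by (field; lra).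
    replace (Cmod (p i) * t ^ i * (rho / 2) ^ i)%R with (Cmod (p i) * (rho / 2) ^ i * t ^ i)%R by
      ring.
    apply Rmult_le_compat_r; lra. }
  intros j. induction j as [j IH] using (well_founded_induction lt_wf). intros Hj.
  (* The two summands bound, up to the factor t^(j+1), the value M t^N (using t < rho) and the tail.
     The constant D bounds the terms of the series at rho / 2. *)
  set (Q := (Rabs M * (rho ^ (N - S j)) + 2 * D * (/ (rho / 2)) ^ S j)%R).
  assert (HQ : forall t, (0 < t <= rho / 4)%R -> (Cmod (p j) <= Q * t)%R).
  { intros t Ht.
    assert (Htj : (0 < t ^ j)%R) by (apply pow_lt; lra).
    assert (H := Cseries_leading (fun j => p j * RtoC t ^ j) D (t / (rho / 2)) j (f t)).
    cbv beta in H.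
    assert (Hq : (0 <= t / (rho / 2) <= 1 / 2)%R).
    { split; [apply Rdiv_le_0_compat; lra|]. apply Rle_div_l; lra. }
    specialize (H Hq).
    assert (H' : (Cmod (p j * RtoC t ^ j) <= Cmod (f t) + 2 * D * (t / (rho / 2)) ^ S j)%R).
    { apply H.
      - intros i Hi. rewrite (IH i Hi) by lia. ring.
      - intros i. apply HDt. lra.
      - apply Hs. lra. }
    clear H. rewrite Cmod_mult, Cmod_pow, Cmod_R, Rabs_pos_eq in H' by lra.
    assert (HMt := HM t ltac:(lra)).
    apply Rmult_le_reg_r with (t ^ j)%R; auto.
    eapply Rle_trans; [exact H'|]. unfold Q.
    assert (E1 : (M * t ^ N <= Rabs M * rho ^ (N - S j) * (t * t ^ j))%R).
    { replace N with ((N - S j) + S j)%nat at 1 by lia. rewrite pow_add. simpl.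
      assert (0 <= t ^ (N - S j))%R by (apply pow_le; lra).
      assert (t ^ (N - S j) <= rho ^ (N - S j))%R by (apply pow_incr; lra).
      assert (0 < t * t ^ j)%R by (apply Rmult_lt_0_compat; lra).
      rewrite <- Rmult_assoc. apply Rmult_le_compat_r; [lra|].
      assert (H5 := Rle_abs M). assert (H6 := Rabs_pos M). nra. }
    assert (E2 : ((t / (rho / 2)) ^ S j = (/ (rho / 2)) ^ S j * (t * t ^ j))%R).
    { unfold Rdiv at 1. rewrite Rpow_mult_distr. simpl. ring. }
    rewrite E2. lra. }
  apply Cmod_eq_0. apply Rle_antisym; [|apply Cmod_ge_0].
  apply Rnot_lt_le. intros Hpos.
  assert (HQ0 : (0 < Q)%R).
  { specialize (HQ (rho / 4)%R ltac:(lra)). apply Rnot_le_lt. intros L. nra. }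
  set (t := Rmin (rho / 4) (Cmod (p j) / (2 * Q))).
  assert (Ht : (0 < t)%R).
  { apply Rmin_pos; [lra|]. apply Rdiv_lt_0_compat; lra. }
  assert (Ht' : (t <= rho / 4)%R) by apply Rmin_l.
  assert (Ht2 : (t <= Cmod (p j) / (2 * Q))%R) by apply Rmin_r.
  specialize (HQ t ltac:(lra)). apply Rle_div_r in Ht2; [|lra]. lra.
Qed.

Lemma analytic_at_minus (F G : C -> C) (a : C) :
  analytic_at F a -> analytic_at G a -> analytic_at (fun s => F s - G s) a.
Proof.
  intros (p & rp & Hp & HF) (q & rq & Hq & HG).
  exists (fun j => p j - q j), (Rmin rp rq). split; [now apply Rmin_pos|].
  intros s Hs. apply is_pseries_Cseries.
  assert (H1 : Cseries (fun j => p j * (s - a) ^ j) (F s)).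
  { apply is_pseries_Cseries, HF. eapply Rlt_le_trans; [apply Hs|apply Rmin_l]. }
  assert (H2 : Cseries (fun j => q j * (s - a) ^ j) (G s)).
  { apply is_pseries_Cseries, HG. eapply Rlt_le_trans; [apply Hs|apply Rmin_r]. }
  eapply Cseries_ext; [|exact (Cseries_minus _ _ _ _ H1 H2)].
  intros n. cbv beta. ring.
Qed.

Lemma Cseries_zero (a : nat -> C) (l : C) : (forall n, a n = 0) -> Cseries a l -> l = 0.
Proof.
  intros H Hl. eapply Cseries_unique; [exact Hl|].
  apply (Cseries_of_bound _ _ (fun _ => 0%R)); [|apply is_lim_seq_const].
  intros n. replace (Csum a n) with (RtoC 0).
  - replace (RtoC 0 - 0) with (RtoC 0) by ring. rewrite Cmod_0. lra.
  - induction n as [|n IH]; [now rewrite Csum_O|]. rewrite Csum_S, <- IH, H. ring.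
Qed.

(** The identity theorem along a horizontal line. If F s were nonzero, there would be a leftmost
    point s - x such that F vanishes on the line to its right. Vanishing on one side of that point
    already annihilates its power series there, so F also vanishes slightly to the left of it. *)
Lemma analytic_zero (F : C -> C) :
  (forall a, analytic_at F a) -> (forall s, (1 < fst s)%R -> F s = 0) -> forall s, F s = 0.
Proof.
  intros HF H1 s. destruct (Ceq_dec (F s) 0) as [|Hn]; auto. exfalso.
  set (E := fun x : R => forall t, (- x <= t)%R -> F (s + RtoC t) = 0).
  assert (Hne : exists x, E x).
  { exists (- (2 - fst s))%R. intros t Ht. apply H1. destruct s; simpl in *. lra. }
  assert (Hb : bound E).
  { exists 0%R. intros x Hx. apply Rnot_lt_le. intros Hx0. apply Hn.
    replace s with (s + RtoC 0) by ring. apply Hx. lra. }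
  destruct (completeness E Hb Hne) as [x [Hub Hlub]].
  assert (Hgt : forall t, (- x < t)%R -> F (s + RtoC t) = 0).
  { intros t Ht. destruct (Ceq_dec (F (s + RtoC t)) 0) as [|Hnt]; auto. exfalso.
    assert (x <= - t)%R; [|lra]. apply Hlub. intros y Hy. apply Rnot_lt_le. intros L.
    apply Hnt, Hy. lra. }
  destruct (HF (s + RtoC (- x))) as (p & rho & Hr & Hp).
  assert (Hpz : forall j, p j = 0).
  { intros j.
    apply (power_series_order p (fun t => F (s + RtoC (- x + t))) rho 0 (S j)); auto.
    - intros t Ht. apply is_pseries_Cseries.
      assert (Ew : RtoC t = s + RtoC (- x + t) - (s + RtoC (- x))) by (rewrite RtoC_plus; ring).
      rewrite Ew. apply Hp. rewrite <- Ew, Cmod_R, Rabs_pos_eq; lra.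
    - intros t Ht. rewrite Hgt by lra. rewrite Cmod_0. lra. }
  assert (Hx : E (x + rho / 2)%R).
  { intros t Ht. destruct (Rlt_dec (- x) t) as [L|L]; [now apply Hgt|].
    assert (A := Hp (s + RtoC t)).
    replace (s + RtoC t - (s + RtoC (- x))) with (RtoC (t + x)) in A
      by (rewrite RtoC_plus, RtoC_opp; ring).
    rewrite Cmod_R, Rabs_left1 in A by lra. specialize (A ltac:(lra)).
    apply is_pseries_Cseries in A. revert A. apply Cseries_zero.
    intros n. rewrite Hpz. ring. }
  specialize (Hub _ Hx). lra.
Qed.

(** The uniqueness required by [iota] is the identity theorem for the difference of two
    continuations, which vanishes on Re s > 1. *)
Lemma periodic_zeta_eq (s : C) (alpha : R) :
  1 - e2pi alpha <> 0 -> periodic_zeta s alpha = zeta_cont (e2pi alpha) s.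
Proof.
  intros Hq. apply (iota_unique (V := C_CompleteNormedModule)).
  - intros y (F & [HF1 HF2] & <-).
    destruct (zeta_cont_continues alpha Hq) as [HZ1 HZ2].
    assert (H := analytic_zero (fun s => F s - zeta_cont (e2pi alpha) s)).
    assert (E : F s - zeta_cont (e2pi alpha) s = 0).
    { apply H.
      - intros a. now apply analytic_at_minus.
      - intros s' Hs'. rewrite (Cseries_unique _ _ _ (HF2 s' Hs') (HZ2 s' Hs')). ring. }
    in_C.
    rewrite <- (Cplus_0_r (zeta_cont _ s)), <- E. ring.
  - exists (zeta_cont (e2pi alpha)). split; auto. now apply zeta_cont_continues.
Qed.

(** * The functions log (1 - q e^(-u)) and their derivatives *)

(** The form of the principal logarithm that can be differentiated. It is enough here: the arguments
    1 - q s with |q| = 1, q <> 1 and 0 <= s <= 1 all have positive real part. *)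
Lemma Clog_right_half (w : C) :
  (0 < fst w)%R -> Clog w = (ln (sqrt (fst w ^ 2 + snd w ^ 2)), atan (snd w / fst w)).
Proof.
  intros Hw. unfold Clog. f_equal. unfold Carg.
  assert (Hm : (0 < Cmod w)%R).
  { apply Cmod_gt_0. intros E. rewrite E in Hw. simpl in Hw. lra. }
  assert (K : acos (fst w / Cmod w) = atan (Rabs (snd w) / fst w)).
  { rewrite acos_atan by (apply Rdiv_lt_0_compat; auto). f_equal.
    assert (E : (1 - (fst w / Cmod w)² = (Rabs (snd w) / Cmod w)²)%R).
    { assert (H := Cmod2_alt w). unfold Re, Im in H. unfold Rsqr.
      assert (H2 := pow2_abs (snd w)).
      apply Rmult_eq_reg_r with (Cmod w ^ 2)%R; [|apply pow_nonzero; lra].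
      field_simplify; [|lra|lra]. rewrite H2. lra. }
    rewrite E, sqrt_Rsqr by (apply Rdiv_le_0_compat; [apply Rabs_pos|auto]).
    field. lra. }
  rewrite K. destruct (Rle_dec 0 (snd w)) as [L|L].
  - now rewrite Rabs_pos_eq.
  - rewrite Rabs_left1 by lra. unfold Rdiv. rewrite Ropp_mult_distr_l_reverse, atan_opp. ring.
Qed.

Lemma Cder_Clog (p : R -> C) (t : R) (dp : C) :
  (0 < fst (p t))%R -> Cder p t dp -> Cder (fun x => Clog (p x)) t (dp / p t).
Proof.
  intros Hp H. assert (p1 := Cder_fst _ _ _ H). assert (p2 := Cder_snd _ _ _ H).
  assert (Hloc : locally t (fun x => (0 < fst (p x))%R)).
  { assert (Hc := Ccont_fst _ _ (Cder_cont _ _ _ H)).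
    apply (Hc (fun y => (0 < y)%R)). apply (open_gt 0%R). exact Hp. }
  apply (is_derive_ext_loc (V := C_R_NormedModule)
    (fun x => (ln (sqrt (fst (p x) ^ 2 + snd (p x) ^ 2)), atan (snd (p x) / fst (p x))))).
  { revert Hloc. apply filter_imp. intros x Hx. now rewrite Clog_right_half. }
  set (n := fun x => (fst (p x) ^ 2 + snd (p x) ^ 2)%R).
  assert (Hn : (0 < n t)%R) by (unfold n; generalize (pow2_ge_0 (snd (p t))); nra).
  assert (Dn : is_derive n t (2 * fst (p t) * fst dp + 2 * snd (p t) * snd dp)%R).
  { eapply Rder_val.
    - apply (is_derive_plus (V := R_NormedModule)).
      + apply (is_derive_pow _ 2 _ _ p1).
      + apply (is_derive_pow _ 2 _ _ p2).
    - unfold plus; simpl. ring. }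
  apply Cder_pair.
  - cbn [fst].
    eapply Rder_val.
    + apply (is_derive_comp ln (fun x => sqrt (n x))).
      * apply is_derive_ln. now apply sqrt_lt_R0.
      * apply (is_derive_sqrt n); eauto.
    + unfold scal; simpl; unfold mult; simpl.
      assert (Hs : (sqrt (n t) * sqrt (n t) = n t)%R) by (apply sqrt_sqrt; lra).
      assert (Hs0 : (0 < sqrt (n t))%R) by now apply sqrt_lt_R0.
      transitivity ((2 * fst (p t) * fst dp + 2 * snd (p t) * snd dp) / (2 * (sqrt (n t) * sqrt
        (n t))))%R.
      { field. lra. }
      rewrite Hs. unfold n. field. unfold n in Hn. simpl in Hn. lra.
  - cbn [snd].
    eapply Rder_val.
    + apply (is_derive_comp atan (fun x => snd (p x) / fst (p x))%R).
      * apply is_derive_atan.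
      * apply (is_derive_div (fun x => snd (p x)) (fun x => fst (p x)) _ _ _ p2 p1). lra.
    + unfold scal; simpl; unfold mult; simpl.
      unfold n in Hn. simpl in Hn. unfold Rsqr. field. repeat split; try lra; nra.
Qed.

(** The derivative of log (1 - q e^(-w)). It is defined at complex w because its Taylor series comes
    from Cauchy's formula; the logarithm itself is used on real arguments only. *)
Definition hfun (q w : C) : C := q * Cexp (- w) / (1 - q * Cexp (- w)).

Definition Lfun (q : C) (u : R) : C := Clog (1 - q * RtoC (exp (- u))).

(** The minimum over 0 <= s <= 1 of the real part of 1 - q s, an affine function of s with these two
    end values. *)
Definition gap (q : C) : R := Rmin 1 (1 - fst q).

Lemma gap_pos (q : C) : (fst q < 1)%R -> (0 < gap q)%R.
Proof. intros H. apply Rmin_pos; lra. Qed.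

Lemma gap_le_fst (q : C) (s : R) :
  (0 <= s <= 1)%R -> (gap q <= fst (1 - q * RtoC s)%C)%R.
Proof.
  intros Hs. replace (fst (1 - q * RtoC s)%C) with (1 - fst q * s)%R
    by (destruct q; unfold RtoC; simpl; ring).
  unfold gap. destruct (Rle_dec 0 (fst q)) as [L|L].
  - eapply Rle_trans; [apply Rmin_r|]. nra.
  - eapply Rle_trans; [apply Rmin_l|]. nra.
Qed.

Lemma gap_le_Cmod (q : C) (s : R) :
  (0 <= s <= 1)%R -> (gap q <= Cmod (1 - q * RtoC s))%R.
Proof.
  intros Hs. eapply Rle_trans; [now apply gap_le_fst|].
  eapply Rle_trans; [apply Rle_abs|apply abs_fst_le].
Qed.

Lemma gap_neq_0 (q : C) (s : R) :
  (fst q < 1)%R -> (0 <= s <= 1)%R -> 1 - q * RtoC s <> 0.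
Proof.
  intros Hq Hs E. assert (H := gap_le_Cmod q s Hs). rewrite E, Cmod_0 in H.
  generalize (gap_pos q Hq). lra.
Qed.

Lemma exp_neg_bounds (u : R) : (0 <= u)%R -> (0 <= exp (- u) <= 1)%R.
Proof.
  intros Hu. split; [left; apply exp_pos|]. rewrite <- exp_0.
  destruct (Req_dec u 0) as [->|]; [rewrite Ropp_0; lra|]. left; apply exp_increasing; lra.
Qed.

Lemma Cmod_inv_gap (q : C) (s : R) :
  (fst q < 1)%R -> (0 <= s <= 1)%R -> (Cmod (/ (1 - q * RtoC s)) <= / gap q)%R.
Proof.
  intros Hq Hs. rewrite Cmod_inv by now apply gap_neq_0.
  apply Rinv_le_contravar; [now apply gap_pos|now apply gap_le_Cmod].
Qed.

Lemma hfun_R (q : C) (u : R) :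
  hfun q (RtoC u) = q * RtoC (exp (- u)) * / (1 - q * RtoC (exp (- u))).
Proof. unfold hfun. now rewrite <- RtoC_opp, Cexp_R. Qed.

Lemma Cmod_hfun_le (q : C) (u : R) :
  Cmod q = 1%R -> (fst q < 1)%R -> (0 <= u)%R -> (Cmod (hfun q (RtoC u)) <= / gap q * exp (-
    u))%R.
Proof.
  intros Hq1 Hq Hu. assert (He := exp_neg_bounds u Hu).
  rewrite hfun_R, !Cmod_mult, Hq1, Cmod_R, Rabs_pos_eq, Rmult_1_l, Rmult_comm by lra.
  apply Rmult_le_compat_r; [lra|]. now apply Cmod_inv_gap.
Qed.

Lemma Cder_Clog_line (q : C) (s : R) :
  (fst q < 1)%R -> (0 <= s <= 1)%R ->
  Cder (fun s => Clog (1 - q * RtoC s)) s (- q * / (1 - q * RtoC s)).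
Proof.
  intros Hq Hs. eapply Cder_val.
  - apply (Cder_Clog (fun s => 1 - q * RtoC s)).
    + generalize (gap_le_fst q s Hs) (gap_pos q Hq). lra.
    + apply Cder_minus; [apply Cder_const|]. apply Cder_scal.
      apply (Cder_RtoC (fun x => x)). apply (is_derive_id (K := R_AbsRing)).
  - change (@one R_AbsRing) with 1%R. cbv beta. field. now apply gap_neq_0.
Qed.

Lemma is_derive_exp_neg (u : R) : is_derive (fun x => exp (- x)) u (- exp (- u))%R.
Proof. auto_derive; auto. ring. Qed.

Lemma Cder_Lfun (q : C) (u : R) :
  (fst q < 1)%R -> (0 <= u)%R -> Cder (Lfun q) u (hfun q (RtoC u)).
Proof.
  intros Hq Hu. eapply Cder_val.
  - apply (Cder_comp (fun s => Clog (1 - q * RtoC s)) (fun x => exp (- x))).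
    + apply Cder_Clog_line; auto. now apply exp_neg_bounds.
    + apply is_derive_exp_neg.
  - rewrite hfun_R, RtoC_opp. ring.
Qed.

Lemma Clog_1 : Clog 1 = 0.
Proof.
  rewrite Clog_right_half by (simpl; lra). unfold RtoC. simpl.
  replace (1 * (1 * 1) + 0 * (0 * 1))%R with 1%R by ring.
  rewrite sqrt_1, ln_1. f_equal. unfold Rdiv. rewrite Rmult_0_l. apply atan_0.
Qed.

Definition log_term (q : C) (s : R) (n : nat) : C :=
  q ^ S n * RtoC (s ^ S n / INR (S n)).

Lemma is_derive_pow_div (n : nat) (t : R) :
  is_derive (fun x => x ^ S n / INR (S n))%R t (t ^ n)%R.
Proof.
  assert (Hn0 : INR (S n) <> 0%R) by (apply not_0_INR; lia).
  apply (is_derive_ext (fun x => / INR (S n) * x ^ S n)%R).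
  { intros x. apply Rmult_comm. }
  eapply Rder_val.
  - apply is_derive_scal. apply (is_derive_pow (fun x => x) (S n) t 1%R).
    apply (is_derive_id (K := R_AbsRing)).
  - cbn [Nat.pred]. field. exact Hn0.
Qed.

(** The remainder has derivative q (q s)^(N+1) / (1 - q s), at most s^N / [gap q]; integrating from
    0 gives O(1/N). The bound is uniform up to s = 1, so one estimate yields both the boundary value
    of the series and its termwise integration. *)
Lemma Clog_partial_sum (q : C) (s : R) (N : nat) :
  Cmod q = 1%R -> (fst q < 1)%R -> (0 <= s <= 1)%R ->
  (Cmod (- Clog (1 - q * RtoC s) - Csum (log_term q s) N) <= 2 * / gap q / INR (S N))%R.
Proof.
  intros Hq1 Hq Hs. assert (Hg := gap_pos q Hq).
  assert (HN : (0 < INR (S N))%R) by (apply lt_0_INR; lia).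
  set (E := fun s => - Clog (1 - q * RtoC s) - Csum (log_term q s) N).
  assert (H := Cmean_value E
    (fun s => q * (q * RtoC s) ^ S N * / (1 - q * RtoC s))
    (fun s => / gap q * (s ^ (S N) / INR (S N)))%R (fun s => / gap q * s ^ N)%R 0 s).
  assert (E0 : E 0%R = 0).
  { unfold E. replace (1 - q * RtoC 0) with (RtoC 1) by ring. rewrite Clog_1.
    assert (Z : Csum (log_term q 0) N = 0).
    { clear. assert (T : forall n, log_term q 0 n = 0).
      { intros n. unfold log_term. replace (0 ^ S n / INR (S n))%R with 0%R; [ring|].
        rewrite pow_i by lia. unfold Rdiv; ring. }
      induction N as [|N IH]; [now rewrite Csum_O|]. rewrite Csum_S, IH, T. ring. }
    rewrite Z. ring. }
  assert (Hd : forall N s, (0 <= s <= 1)%R ->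
     Cder (fun s => - Clog (1 - q * RtoC s) - Csum (log_term q s) N) s
       (q * (q * RtoC s) ^ S N * / (1 - q * RtoC s))).
  { clear N HN E H E0. intros N t Ht. assert (Hn := gap_neq_0 q t Hq Ht).
    assert (HT : forall n, Cder (fun s => log_term q s n) t (q ^ S n * RtoC (t ^ n))).
    { intros n. unfold log_term. apply Cder_scal. apply Cder_RtoC.
      apply is_derive_pow_div. }
    induction N as [|N IH].
    - apply (Cder_ext (fun s => - Clog (1 - q * RtoC s) - log_term q s 0)).
      { intros x. now rewrite Csum_O. }
      eapply Cder_val.
      + apply Cder_minus; [apply Cder_opp, Cder_Clog_line; auto|apply HT].
      + simpl. field. auto.
    - apply (Cder_ext
        (fun s => (- Clog (1 - q * RtoC s) - Csum (log_term q s) N) - log_term q s (S N))).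
      { intros x. rewrite Csum_S.
        in_C. ring. }
      eapply Cder_val.
      + apply Cder_minus; [apply IH|apply HT].
      + cbv beta. rewrite RtoC_pow, !Cpow_mult_l, !(Cpow_S q (S N)), (Cpow_S (RtoC t) (S N)).
        field. auto. }
  rewrite E0 in H. replace (E s - 0) with (E s) in H by ring.
  eapply Rle_trans; [apply H; clear H|].
  - lra.
  - intros t Ht. apply Hd. lra.
  - intros t Ht.
    apply is_derive_scal. apply is_derive_pow_div.
  - intros t Ht.
    rewrite !Cmod_mult, Cmod_pow, Cmod_mult, Hq1, Cmod_R, Rabs_pos_eq, !Rmult_1_l by lra.
    rewrite Rmult_comm. apply Rmult_le_compat.
    + apply Cmod_ge_0.
    + apply pow_le; lra.
    + apply Cmod_inv_gap; lra.
    + simpl. assert (0 <= t ^ N)%R by (apply pow_le; lra). nra.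
  - rewrite pow_i by lia.
    assert (Hsp : (0 <= s ^ S N <= 1)%R).
    { split; [apply pow_le; lra|]. rewrite <- (pow1 (S N)). apply pow_incr; lra. }
    assert (Hi : (0 < / INR (S N))%R) by now apply Rinv_0_lt_compat.
    assert (Hi' : (0 < / gap q)%R) by now apply Rinv_0_lt_compat.
    unfold Rdiv. rewrite Rmult_0_l.
    assert (s ^ S N * / INR (S N) <= / INR (S N))%R by nra. nra.
Qed.

Lemma is_lim_seq_inv_S (c : R) : is_lim_seq (fun n => c / INR (S n))%R 0.
Proof.
  replace (Finite 0) with (Rbar_mult c 0) by (simpl; f_equal; ring).
  apply (is_lim_seq_scal_l _ _ (Finite 0)).
  apply (is_lim_seq_incr_1 (fun n => / INR n)%R).
  replace (Finite 0) with (Rbar_inv p_infty) by reflexivity.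
  apply is_lim_seq_inv; [apply is_lim_seq_INR|discriminate].
Qed.

Lemma Clog_series (q : C) (s : R) :
  Cmod q = 1%R -> (fst q < 1)%R -> (0 <= s <= 1)%R ->
  Cseries (log_term q s) (- Clog (1 - q * RtoC s)).
Proof.
  intros Hq1 Hq Hs.
  apply (Cseries_of_bound _ _ (fun N => 2 * / gap q / INR (S N))%R).
  - intros n. rewrite Cmod_minus_sym. now apply Clog_partial_sum.
  - apply is_lim_seq_inv_S.
Qed.

(** The mean value inequality in the variable s = e^(-u), starting from s = 0 where the logarithm
    vanishes. *)
Lemma Cmod_Lfun_le (q : C) (u : R) :
  Cmod q = 1%R -> (fst q < 1)%R -> (0 <= u)%R -> (Cmod (Lfun q u) <= 2 * / gap q * exp (- u))%R.
Proof.
  intros Hq1 Hq Hu. assert (He := exp_neg_bounds u Hu).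
  assert (H := Cmean_value (fun s => Clog (1 - q * RtoC s)) (fun s => - q * / (1 - q * RtoC s))
     (fun s => / gap q * s)%R (fun s => / gap q)%R 0 (exp (- u))).
  cbv beta in H. replace (1 - q * RtoC 0) with (RtoC 1) in H by ring. rewrite Clog_1 in H.
  unfold Lfun. replace (Clog _) with (Clog (1 - q * RtoC (exp (- u))) - 0) by ring.
  eapply Rle_trans; [apply H; clear H|].
  - lra.
  - intros t Ht. apply Cder_Clog_line; auto; lra.
  - intros t Ht. apply is_derive_linear.
  - intros t Ht. rewrite Cmod_mult, Cmod_opp, Hq1, Rmult_1_l. apply Cmod_inv_gap; auto; lra.
  - lra.
Qed.

(** At s = 1 the defining series converges only conditionally and lies outside the range of
    [zeta_cont_part] with k = 0. One summation by parts applied to the logarithmic series on the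
    unit circle leads to k = 1, which is covered. *)
Lemma zeta_cont_1 (q : C) :
  Cmod q = 1%R -> (fst q < 1)%R -> zeta_cont q 1 = - Lfun q 0.
Proof.
  intros Hq1 Hq.
  assert (Hq' : 1 - q <> 0).
  { replace (1 - q) with (1 - q * RtoC 1) by ring. apply gap_neq_0; auto; lra. }
  assert (Hq0 : q <> 0) by (intros E; rewrite E, Cmod_0 in Hq1; lra).
  assert (S0 : Cseries (zeta_term q 0 1) (- Lfun q 0)).
  { unfold Lfun. rewrite Ropp_0, exp_0.
    eapply Cseries_ext; [|apply Clog_series; auto; lra].
    intros n. unfold log_term, zeta_term. f_equal.
    assert (Hn : (0 < INR (S n))%R) by (apply lt_0_INR; lia).
    change (fdiff 0 1 (INR (S n))) with (cpow (INR (S n)) (- (1))).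
    rewrite cpow_opp, cpow_1, pow1 by auto. unfold Rdiv. rewrite Rmult_1_l, RtoC_inv by lra.
    reflexivity. }
  rewrite (zeta_cont_part q 1) by (auto; simpl; lra).
  unfold zeta_part. rewrite (CSeries_unique _ _ (zeta_summation_by_parts q 0 1 _ Hq' Hq0 S0)).
  cbn [zeta_head Cpow]. field. auto.
Qed.

Lemma fst_e2pi_lt_1 (alpha : R) : (0 < alpha < 1)%R -> (fst (e2pi alpha) < 1)%R.
Proof.
  intros Ha. assert (HPI := PI_RGT_0).
  unfold e2pi, Cexp, Cmult, RtoC; simpl. rewrite exp_0.
  replace (2 * PI * alpha)%R with (2 * (PI * alpha))%R by ring.
  rewrite cos_2a_sin.
  assert (0 < sin (PI * alpha))%R by (apply sin_gt_0; nra). nra.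
Qed.

(** * The Taylor expansion of [hfun] in a disc free of singularities *)

Lemma Cexp_sub_e2pi (alpha : R) (w : C) :
  e2pi alpha * Cexp (- w) = Cexp (- fst w, 2 * PI * alpha - snd w)%R.
Proof.
  unfold e2pi. rewrite <- Cexp_add. f_equal. destruct w; unfold Copp, Cplus; simpl.
  f_equal; ring.
Qed.

(** The zeros of 1 - e^(2 pi i alpha - w) nearest to 0 are 2 pi i alpha and -2 pi i (1 - alpha).
    With w = a + ib and phi = (2 pi alpha - b)/2, the squared modulus is (1 - e^(-a))^2 + 4 e^(-a)
    sin(phi)^2, and phi keeps the distance eta from 0 and PI. *)
Lemma gap_disc (alpha rho : R) :
  (0 < rho)%R -> (rho < 2 * PI * alpha)%R -> (rho < 2 * PI * (1 - alpha))%R ->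
  exists mu, (0 < mu)%R /\
    forall w, (Cmod w <= rho)%R -> (mu <= Cmod (1 - e2pi alpha * Cexp (- w)))%R.
Proof.
  intros Hr H1 H2. assert (HPI := PI_RGT_0).
  set (eta := (Rmin (2 * PI * alpha - rho) (2 * PI * (1 - alpha) - rho) / 2)%R).
  assert (He0 : (0 < eta)%R).
  { unfold eta. apply Rdiv_lt_0_compat; [apply Rmin_pos|]; lra. }
  assert (He1 : (eta <= (2 * PI * alpha - rho) / 2)%R).
  { unfold eta. apply Rmult_le_compat_r; [lra|apply Rmin_l]. }
  assert (He2 : (eta <= (2 * PI * (1 - alpha) - rho) / 2)%R).
  { unfold eta. apply Rmult_le_compat_r; [lra|apply Rmin_r]. }
  assert (Hs : (0 < sin eta)%R) by (apply sin_gt_0; lra).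
  (* Its square is 4 e^(-rho) sin(eta)^2, the least value of the second summand of the squared
     modulus. *)
  exists (2 * exp (- rho / 2) * sin eta)%R.
  assert (Hmu : (0 < 2 * exp (- rho / 2) * sin eta)%R).
  { apply Rmult_lt_0_compat; auto. assert (0 < exp (- rho / 2))%R by apply exp_pos. lra. }
  split; auto. intros w Hw. rewrite Cexp_sub_e2pi.
  assert (Hw1 := abs_fst_le w). assert (Hw2 := abs_snd_le w).
  destruct w as [a b]. cbn [fst snd] in *.
  set (phi := ((2 * PI * alpha - b) / 2)%R).
  replace (2 * PI * alpha - b)%R with (2 * phi)%R by (unfold phi; field).
  assert (Hb : (- rho <= b <= rho)%R) by (apply Rabs_le_between; lra).
  assert (Ha : (- rho <= a <= rho)%R) by (apply Rabs_le_between; lra).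
  assert (Hphi : (eta <= phi <= PI - eta)%R) by (unfold phi; lra).
  assert (Hsin : (sin eta <= sin phi)%R).
  { destruct (Rle_dec phi (PI / 2)) as [L|L].
    - apply sin_incr_1; lra.
    - rewrite <- (sin_PI_x phi). apply sin_incr_1; lra. }
  apply Rsqr_incr_0; [|lra|apply Cmod_ge_0].
  rewrite !Rsqr_pow2, Cmod2_alt.
  unfold Cexp, Cminus, Cplus, Copp, Cmult, RtoC, Re, Im. cbn [fst snd].
  replace ((2 * exp (- rho / 2) * sin eta) ^ 2)%R with (4 * (exp (- rho / 2) * exp (- rho / 2)) *
    (sin eta) ^ 2)%R by ring.
  rewrite <- exp_plus. replace (- rho / 2 + - rho / 2)%R with (- rho)%R by field.
  replace ((1 + - (exp (- a) * cos (2 * phi) - 0 * sin (2 * phi))) ^ 2 +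
    (0 + - (exp (- a) * sin (2 * phi) + 0 * cos (2 * phi))) ^ 2)%R with
    ((1 - exp (- a)) ^ 2 + 2 * exp (- a) * (1 - cos (2 * phi)) +
      exp (- a) ^ 2 * ((sin (2 * phi))² + (cos (2 * phi))² - 1))%R by (unfold Rsqr; ring).
  rewrite sin2_cos2, cos_2a_sin.
  assert (Hexp : (exp (- rho) <= exp (- a))%R).
  { destruct (Req_dec a rho) as [->|]; [lra|]. left; apply exp_increasing; lra. }
  assert (0 < exp (- rho))%R by apply exp_pos.
  assert (sin eta ^ 2 <= sin phi ^ 2)%R by (apply pow_incr; lra).
  assert (0 <= (1 - exp (- a)) ^ 2)%R by apply pow2_ge_0.
  assert (0 <= sin eta ^ 2)%R by apply pow2_ge_0.
  assert (exp (- rho) * sin eta ^ 2 <= exp (- a) * sin phi ^ 2)%R by (apply Rmult_le_compat; lra).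
  nra.
Qed.

Lemma exp_le (x y : R) : (x <= y)%R -> (exp x <= exp y)%R.
Proof. intros [H|<-]; [left; now apply exp_increasing|lra]. Qed.

(** Since e^(-w2) = e^(-w1) e^(-d) with d = w2 - w1, the error is an exact combination of the
    second-order remainder X and of d times the first-order remainder Y of e^(-d), over products of
    two and three denominators. The constants are those of [Cexp_taylor2] and [Cexp_lipschitz], with
    |d| <= 2 rho. *)
Lemma hfun_quadratic (q : C) (rho mu : R) :
  Cmod q = 1%R -> (0 < mu)%R ->
  (forall w, (Cmod w <= rho)%R -> (mu <= Cmod (1 - q * Cexp (- w)))%R) ->
  forall w1 w2, (Cmod w1 <= rho)%R -> (Cmod w2 <= rho)%R ->
    (Cmod (hfun q w2 - hfun q w1
       - (- (q * Cexp (- w1)) / ((1 - q * Cexp (- w1)) * (1 - q * Cexp (- w1)))) * (w2 - w1))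
     <= (4 * (exp rho * exp (2 * rho)) / (mu * mu)
         + 2 * (exp rho * exp rho * exp (2 * rho)) / (mu * mu * mu)) * Cmod (w2 - w1) ^ 2)%R.
Proof.
  intros Hq Hmu Hgap w1 w2 H1 H2.
  set (E1 := Cexp (- w1)). set (d := w2 - w1).
  assert (Hd : (Cmod (- d) <= 2 * rho)%R).
  { rewrite Cmod_opp. unfold d. assert (H := Cmod_triangle w2 (- w1)). rewrite Cmod_opp in H.
    unfold Cminus. lra. }
  assert (HE1 : (Cmod E1 <= exp rho)%R) by (apply Cmod_Cexp_le; now rewrite Cmod_opp).
  assert (HE2 : Cexp (- w2) = E1 * Cexp (- d)).
  { unfold E1, d. rewrite <- Cexp_add. f_equal. ring. }
  assert (G1 := Hgap w1 H1). assert (G2 := Hgap w2 H2). fold E1 in G1.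
  unfold hfun. fold E1.
  set (D1 := 1 - q * E1) in *. set (D2 := 1 - q * Cexp (- w2)) in *.
  assert (N1 : D1 <> 0) by (apply Cmod_gt_0; lra).
  assert (N2 : D2 <> 0) by (apply Cmod_gt_0; lra).
  assert (ED : D2 = 1 - q * (E1 * Cexp (- d))) by (unfold D2; now rewrite HE2).
  set (X := Cexp (- d) - 1 - - d). set (Y := Cexp (- d) - 1).
  assert (HX : (Cmod X <= 4 * Cmod d ^ 2 * exp (2 * rho))%R).
  { eapply Rle_trans; [apply Cexp_taylor2|]. rewrite Cmod_opp in Hd |- *.
    apply Rmult_le_compat_l; [generalize (pow2_ge_0 (Cmod d)); lra|]. apply exp_le; auto. }
  assert (HY : (Cmod Y <= 2 * Cmod d * exp (2 * rho))%R).
  { eapply Rle_trans; [apply Cexp_lipschitz|]. rewrite Cmod_opp in Hd |- *.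
    apply Rmult_le_compat_l; [generalize (Cmod_ge_0 d); lra|]. apply exp_le; auto. }
  assert (E : q * Cexp (- w2) / D2 - q * E1 / D1 - - (q * E1) / (D1 * D1) * d
    = q * E1 * X * / (D1 * D2) - q * q * E1 * E1 * d * Y * / (D1 * D1 * D2)).
  { rewrite HE2. unfold X, Y, D1. unfold D1 in N1. rewrite ED. rewrite ED in N2. field. auto. }
  rewrite E. eapply Rle_trans; [unfold Cminus at 1; apply Cmod_triangle|].
  rewrite Cmod_opp, !Cmod_mult, !Hq, !Rmult_1_l.
  assert (I1 : (Cmod (/ (D1 * D2)) <= / (mu * mu))%R).
  { rewrite Cmod_inv, Cmod_mult by now apply Cmult_neq_0.
    apply Rinv_le_contravar; [nra|]. apply Rmult_le_compat; lra. }
  assert (I2 : (Cmod (/ (D1 * D1 * D2)) <= / (mu * mu * mu))%R).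
  { rewrite Cmod_inv, !Cmod_mult by (repeat apply Cmult_neq_0; auto).
    apply Rinv_le_contravar; [repeat apply Rmult_lt_0_compat; lra|].
    apply Rmult_le_compat; try lra; [nra|]. apply Rmult_le_compat; lra. }
  assert (P1 := Cmod_ge_0 E1). assert (P2 := Cmod_ge_0 X). assert (P3 := Cmod_ge_0 Y).
  assert (P4 := Cmod_ge_0 d).
  rewrite Rmult_plus_distr_r. apply Rplus_le_compat.
  - replace (4 * (exp rho * exp (2 * rho)) / (mu * mu) * Cmod d ^ 2)%R with
      (exp rho * (4 * Cmod d ^ 2 * exp (2 * rho)) * / (mu * mu))%R by (unfold Rdiv; ring).
    apply Rmult_le_compat; auto; try apply Cmod_ge_0; [now apply Rmult_le_pos|].
    apply Rmult_le_compat; auto.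
  - replace (2 * (exp rho * exp rho * exp (2 * rho)) / (mu * mu * mu) * Cmod d ^ 2)%R with
      (exp rho * exp rho * Cmod d * (2 * Cmod d * exp (2 * rho)) * / (mu * mu * mu))%R
      by (unfold Rdiv; ring).
    assert (Q1 : (0 <= Cmod E1 * Cmod E1)%R) by nra.
    assert (Q2 : (Cmod E1 * Cmod E1 <= exp rho * exp rho)%R) by nra.
    apply Rmult_le_compat; auto; try apply Cmod_ge_0.
    { apply Rmult_le_pos; auto. now apply Rmult_le_pos. }
    apply Rmult_le_compat; auto; [now apply Rmult_le_pos|].
    apply Rmult_le_compat_r; auto.
Qed.

Lemma hfun_taylor (alpha rho : R) :
  (0 < rho)%R -> (rho < 2 * PI * alpha)%R -> (rho < 2 * PI * (1 - alpha))%R ->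
  exists (c : nat -> C) (M : R), (forall n, (Cmod (c n) <= M / rho ^ n)%R) /\
    forall w, (Cmod w < rho)%R -> Cseries (fun n => c n * w ^ n) (hfun (e2pi alpha) w).
Proof.
  intros Hr H1 H2. destruct (gap_disc alpha rho Hr H1 H2) as (mu & Hmu & Hgap).
  exists (taylor_coef rho (hfun (e2pi alpha))), (exp rho / mu)%R.
  eapply Cauchy_Taylor; auto.
  - apply hfun_quadratic; eauto. apply Cmod_e2pi.
  - intros w Hw. specialize (Hgap w Hw). unfold hfun.
    rewrite Cmod_div by (apply Cmod_gt_0; lra).
    rewrite Cmod_mult, Cmod_e2pi, Rmult_1_l. unfold Rdiv.
    apply Rmult_le_compat; [apply Cmod_ge_0| | |].
    + left; apply Rinv_0_lt_compat; lra.
    + apply Cmod_Cexp_le. now rewrite Cmod_opp.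
    + apply Rinv_le_contravar; lra.
Qed.

(** * Values of the periodic zeta function at 1, 0, -1, ... *)

Lemma Csum_RtoC (a : nat -> R) (n : nat) : Csum (fun k => RtoC (a k)) n = RtoC (sum_n a n).
Proof.
  induction n as [|n IH]; [now rewrite Csum_O, sum_O|].
  rewrite Csum_S, sum_Sn, IH. now rewrite <- RtoC_plus.
Qed.

Lemma Cseries_RtoC (a : nat -> R) (l : R) : is_series a l -> Cseries (fun n => RtoC (a n)) (RtoC
  l).
Proof.
  intros H. apply (Cseries_of_bound _ _ (fun n => Rabs (sum_n a n - l))).
  - intros n. rewrite Csum_RtoC, <- RtoC_minus, Cmod_R. lra.
  - replace (Finite 0) with (Finite (Rabs (l - l))) by (f_equal; rewrite Rminus_diag; apply
      Rabs_R0).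
    apply (is_lim_seq_abs _ (Finite (l - l))).
    apply (is_lim_seq_minus' _ (fun _ => l)); [exact H|apply is_lim_seq_const].
Qed.

Definition exp_coef (u : R) (i : nat) : R := ((- u) ^ i / INR (fact i))%R.

(** Both sides are k-th differences in x of e^(-ux). On the left the exponential series is
    differenced termwise, x^i being x^(-s) at s = -i; on the right every difference multiplies by
    e^(-u) - 1. *)
Lemma fdiff_exp_series (k : nat) (x u : R) :
  (0 < x)%R ->
  Cseries (fun i => RtoC (exp_coef u i) * fdiff k (- RtoC (INR i)) x)
    (Cexp (RtoC (- (u * x))) * (Cexp (- RtoC u) - 1) ^ k).
Proof.
  revert x. induction k as [|k IH]; intros x Hx.
  - simpl. rewrite Cmult_1_r, Cexp_R.
    assert (H := is_exp_Reals (- (u * x))%R). apply is_pseries_R in H.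
    apply Cseries_RtoC in H. eapply Cseries_ext; [|exact H].
    intros n. replace (- - RtoC (INR n)) with (RtoC (INR n)) by ring.
    rewrite cpow_INR, <- RtoC_mult by auto. f_equal. unfold exp_coef.
    replace (- (u * x))%R with ((- u) * x)%R by ring. rewrite Rpow_mult_distr.
    field. apply INR_fact_neq_0.
  - assert (H := Cseries_minus _ _ _ _ (IH (x + 1)%R ltac:(lra)) (IH x Hx)).
    eapply Cseries_val; [eapply Cseries_ext; [|exact H]|].
    + intros n. simpl. ring.
    + replace (RtoC (- (u * (x + 1)))) with (RtoC (- (u * x)) + - RtoC u)
        by (rewrite <- RtoC_opp, <- RtoC_plus; f_equal; ring).
      rewrite Cexp_add. simpl. ring.
Qed.

(** Summing over i turns the boundary terms into a geometric progression of ratio y = q (e^(-u) - 1)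
    / (1 - q), and 1 - y = (1 - q e^(-u)) / (1 - q). The total is [hfun] times 1 - y^k, so the
    deviation from [hfun] is O(u^k). *)
Lemma zeta_head_exp_series (q : C) (k : nat) (u : R) :
  1 - q <> 0 -> 1 - q * Cexp (- RtoC u) <> 0 ->
  Cseries (fun i => RtoC (exp_coef u i) * zeta_head q k (- RtoC (INR i)))
    (hfun q (RtoC u) - (q / (1 - q)) ^ k * (Cexp (- RtoC u) - 1) ^ k * hfun q (RtoC u)).
Proof.
  intros Hq Hu.
  induction k as [|k IH].
  - eapply Cseries_val; [apply (Cseries_of_bound _ 0 (fun _ => 0%R)); [|apply is_lim_seq_const]|].
    + intros n. replace (Csum _ n) with (RtoC 0).
      * replace (RtoC 0 - 0) with (RtoC 0) by ring. rewrite Cmod_0. lra.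
      * induction n as [|n IH]; [rewrite Csum_O|rewrite Csum_S, <- IH]; simpl; ring.
    + simpl. ring.
  - assert (H := Cseries_plus _ _ _ _ IH
      (Cseries_mult_l ((q / (1 - q)) ^ S k) _ _ (fdiff_exp_series k 1 u Rlt_0_1))).
    eapply Cseries_val; [eapply Cseries_ext; [|exact H]|].
    + intros n. cbn [zeta_head]. ring.
    + replace (RtoC (- (u * 1))) with (- RtoC u) by (rewrite <- RtoC_opp; f_equal; ring).
      cbn [Cpow]. unfold hfun. field. auto.
Qed.

(** For a fixed k the boundary terms at all s = -i together form a power series that agrees with
    [hfun] up to O(t^k) on t > 0. Then [power_series_order] identifies the coefficients below k,
    with no closed form for either side. *)
Lemma hfun_taylor_coef (alpha rho : R) (c : nat -> C) (m : nat) :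
  (0 < alpha < 1)%R -> (0 < rho)%R ->
  (forall w, (Cmod w < rho)%R -> Cseries (fun n => c n * w ^ n) (hfun (e2pi alpha) w)) ->
  c m = RtoC ((-1) ^ m / INR (fact m)) * zeta_cont (e2pi alpha) (- RtoC (INR m)).
Proof.
  intros Ha Hr Hc. set (q := e2pi alpha) in *.
  assert (Hq1 : Cmod q = 1%R) by apply Cmod_e2pi.
  assert (Hq : (fst q < 1)%R) by now apply fst_e2pi_lt_1.
  assert (Hg := gap_pos q Hq).
  assert (Hgap : forall u, (0 <= u)%R -> 1 - q * Cexp (- RtoC u) <> 0).
  { intros u Hu. rewrite <- RtoC_opp, Cexp_R. apply gap_neq_0; auto. now apply exp_neg_bounds. }
  assert (Hq' : 1 - q <> 0).
  { replace (1 - q) with (1 - q * RtoC 1) by ring. apply gap_neq_0; auto; lra. }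
  (* The k-th differences at -m vanish from k = m + 1 on; the extra unit gives Re s + k > 1, under
     which [zeta_part] equals [zeta_cont]. *)
  set (k := S (S m)).
  set (e := fun i => RtoC ((-1) ^ i / INR (fact i)) * zeta_head q k (- RtoC (INR i))).
  assert (He : forall t, (0 <= t)%R -> Cseries (fun i => e i * RtoC t ^ i)
     (hfun q (RtoC t) - (q / (1 - q)) ^ k * (Cexp (- RtoC t) - 1) ^ k * hfun q (RtoC t))).
  { intros t Ht. assert (H := zeta_head_exp_series q k t Hq' (Hgap t Ht)).
    eapply Cseries_ext; [|exact H]. intros n. unfold e, exp_coef.
    rewrite <- RtoC_pow. replace (- t)%R with ((-1) * t)%R by ring.
    rewrite Rpow_mult_distr. unfold Rdiv. rewrite !RtoC_mult. ring. }
  set (B := (Cmod (q / (1 - q)) ^ k * / gap q)%R).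
  assert (Hz : c m - e m = 0).
  { apply (power_series_order (fun i => c i - e i)
      (fun t => (q / (1 - q)) ^ k * (Cexp (- RtoC t) - 1) ^ k * hfun q (RtoC t)) rho B k); auto.
    - intros t Ht.
      assert (H := Cseries_minus _ _ _ _ (Hc (RtoC t) ltac:(rewrite Cmod_R, Rabs_pos_eq; lra))
         (He t ltac:(lra))).
      eapply Cseries_val; [eapply Cseries_ext; [|exact H]|]; intros; cbv beta; ring.
    - intros t Ht. rewrite !Cmod_mult, !Cmod_pow.
      assert (H1 : (Cmod (Cexp (- RtoC t) - 1) <= t)%R).
      { rewrite <- RtoC_opp, Cexp_R, <- RtoC_minus, Cmod_R, Rabs_left1.
        - generalize (exp_ineq1_le (- t)). lra.
        - generalize (exp_neg_bounds t ltac:(lra)). lra. }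
      assert (H2 := Cmod_hfun_le q t Hq1 Hq ltac:(lra)).
      assert (H3 := exp_neg_bounds t ltac:(lra)).
      assert (Hi : (0 < / gap q)%R) by now apply Rinv_0_lt_compat.
      unfold B. rewrite !Rmult_assoc.
      apply Rmult_le_compat_l; [apply pow_le, Cmod_ge_0|].
      rewrite (Rmult_comm (/ gap q)).
      apply Rmult_le_compat; [apply pow_le, Cmod_ge_0|apply Cmod_ge_0| |nra].
      apply pow_incr. split; [apply Cmod_ge_0|auto].
    - unfold k. lia. }
  replace (c m) with (e m) by (rewrite <- (Cplus_0_r (e m)), <- Hz; ring).
  unfold e. f_equal.
  rewrite (zeta_cont_part q k) by (auto; unfold k; rewrite !S_INR; simpl; lra).
  unfold zeta_part.
  replace (CSeries _) with (RtoC 0); [ring|]. symmetry. apply CSeries_unique.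
  assert (Hz0 : forall n, zeta_term q k (- RtoC (INR m)) n = 0).
  { intros n. unfold zeta_term.
    assert (Hf : fdiff k (- RtoC (INR m)) (INR (S n)) = 0).
    { apply Cmod_eq_0. apply Rle_antisym; [|apply Cmod_ge_0].
      eapply Rle_trans; [apply fdiff_bound|].
      - rewrite S_INR. generalize (pos_INR n). lra.
      - unfold k. rewrite !S_INR. simpl. lra.
      - rewrite rising_mod_zero by (unfold k; lia). lra. }
    rewrite Hf. ring. }
  assert (Hs := zeta_series q k (- RtoC (INR m)) Hq1 ltac:(unfold k; rewrite !S_INR; simpl; lra)).
  eapply Cseries_val; [exact Hs|]. now apply (Cseries_zero _ _ Hz0).
Qed.

(** The Taylor coefficient of -[Lfun], with the sign and the factorial of the second series for W
    absorbed. *)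
Definition log_coef (q : C) (v : nat) : C :=
  RtoC ((-1) ^ v / INR (fact v)) * zeta_cont q (1 - RtoC (INR v)).

Lemma log_coef_S (q : C) (v : nat) :
  RtoC (INR (S v)) * log_coef q (S v) =
  - (RtoC ((-1) ^ v / INR (fact v)) * zeta_cont q (- RtoC (INR v))).
Proof.
  unfold log_coef. rewrite S_INR.
  replace (1 - RtoC (INR v + 1)) with (- RtoC (INR v)) by (rewrite RtoC_plus; ring).
  rewrite Cmult_assoc, <- RtoC_mult, <- S_INR.
  replace (INR (S v) * ((-1) ^ S v / INR (fact (S v))))%R with (- ((-1) ^ v / INR (fact v)))%R.
  - rewrite RtoC_opp. ring.
  - rewrite fact_simpl, mult_INR. simpl pow. field.
    split; [apply INR_fact_neq_0|apply not_0_INR; lia].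
Qed.

(** The series of [hfun] is its Cauchy expansion with the coefficients identified. That of [Lfun] is
    its termwise integral, with constant term supplied by [zeta_cont_1]. *)
Lemma Lfun_taylor (alpha rho : R) :
  (0 < rho)%R -> (rho < 2 * PI * alpha)%R -> (rho < 2 * PI * (1 - alpha))%R ->
  exists M : R,
    (forall v, (Cmod (log_coef (e2pi alpha) v) <= M / rho ^ v)%R) /\
    (forall v, (Cmod (RtoC (INR (S v)) * log_coef (e2pi alpha) (S v)) <= M / rho ^ v)%R) /\
    (forall u, (0 <= u < rho)%R ->
       Cseries (fun v => log_coef (e2pi alpha) v * RtoC u ^ v) (- Lfun (e2pi alpha) u)) /\
    (forall u, (0 <= u < rho)%R ->
       Cseries (fun v => RtoC (INR (S v)) * log_coef (e2pi alpha) (S v) * RtoC u ^ v)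
         (- hfun (e2pi alpha) (RtoC u))).
Proof.
  intros Hr H1 H2. assert (HPI := PI_RGT_0).
  assert (Ha : (0 < alpha < 1)%R) by (split; nra).
  destruct (hfun_taylor alpha rho Hr H1 H2) as (c & M & HcM & Hc).
  set (q := e2pi alpha) in *.
  assert (Hq1 : Cmod q = 1%R) by apply Cmod_e2pi.
  assert (Hq : (fst q < 1)%R) by now apply fst_e2pi_lt_1.
  assert (Ec : forall v, RtoC (INR (S v)) * log_coef q (S v) = - c v).
  { intros v. rewrite log_coef_S. now rewrite (hfun_taylor_coef alpha rho c v Ha Hr Hc). }
  assert (HM0 : (0 <= M)%R).
  { specialize (HcM 0%nat). simpl in HcM. generalize (Cmod_ge_0 (c 0%nat)). lra. }
  assert (Hser : forall u, (0 <= u < rho)%R -> Cseries (fun v => c v * RtoC u ^ v) (hfun q (RtoC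
    u))).
  { intros u Hu. apply Hc. rewrite Cmod_R, Rabs_pos_eq; lra. }
  assert (Hle : forall v, (Cmod (log_coef q (S v)) <= Cmod (c v))%R).
  { intros v. rewrite <- (Cmod_opp (c v)), <- Ec, Cmod_mult, Cmod_R, Rabs_pos_eq by apply pos_INR.
    assert (1 <= INR (S v))%R by (rewrite S_INR; generalize (pos_INR v); lra).
    generalize (Cmod_ge_0 (log_coef q (S v))). nra. }
  (* One constant for both families: M for the derivative, M rho for the coefficients of index v +
     1, and the last summand for index 0. *)
  exists (M + M * rho + Cmod (log_coef q 0))%R.
  assert (HA := Cmod_ge_0 (log_coef q 0)).
  assert (HMr : (0 <= M * rho)%R) by (apply Rmult_le_pos; lra).
  assert (Hbig : forall v X, (0 <= X <= M + M * rho + Cmod (log_coef q 0))%R ->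
    (X / rho ^ v <= (M + M * rho + Cmod (log_coef q 0)) / rho ^ v)%R).
  { intros v X HX. unfold Rdiv. apply Rmult_le_compat_r; [|lra].
    left. now apply Rinv_0_lt_compat, pow_lt. }
  split; [|split; [|split]].
  - intros [|v].
    + eapply Rle_trans; [|apply (Hbig 0%nat (Cmod (log_coef q 0))); lra]. simpl. lra.
    + eapply Rle_trans; [apply Hle|]. eapply Rle_trans; [apply HcM|].
      replace (M / rho ^ v)%R with (M * rho / rho ^ S v)%R.
      * apply Hbig. lra.
      * simpl. assert (0 < rho ^ v)%R by now apply pow_lt. field. lra.
  - intros v. rewrite Ec, Cmod_opp. eapply Rle_trans; [apply HcM|]. apply Hbig. lra.
  - intros u Hu.
    assert (E0 : log_coef q 0 = - Lfun q 0).
    { unfold log_coef. simpl. rewrite <- zeta_cont_1 by auto.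
      replace (1 - 0) with (RtoC 1) by ring. replace (1 / 1)%R with 1%R by field. ring. }
    set (x := (u / rho)%R).
    assert (Hx : (0 <= x < 1)%R).
    { unfold x. split; [apply Rdiv_le_0_compat; lra|apply Rlt_div_l; lra]. }
    assert (Hgeo : is_series (fun n => M * x ^ n)%R (M * / (1 - x))%R).
    { apply (is_series_Rmult_l M).
      apply is_series_geom. rewrite Rabs_pos_eq; lra. }
    set (eps := fun N => (M * / (1 - x) - sum_n (fun n => M * x ^ n) N)%R).
    assert (Heps : is_lim_seq eps 0).
    { replace (Finite 0) with (Finite (M * / (1 - x) - M * / (1 - x))) by (f_equal; ring).
      apply (is_lim_seq_minus' (fun _ => M * / (1 - x))%R); [apply is_lim_seq_const|exact Hgeo]. }
    (* The partial sum plus [Lfun] has as derivative the remainder of the series of [hfun], at most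
       [eps N] on [0, u]. The mean value inequality from 0 to u thus integrates the series. *)
    assert (Hmain : Cseries (fun v => log_coef q (S v) * RtoC u ^ S v) (- Lfun q u + Lfun q 0)).
    { apply (Cseries_of_bound _ _ (fun N => 2 * (eps N * u))%R).
      2: { replace (Finite 0) with (Rbar_mult 2 (Finite 0)) by (simpl; f_equal; ring).
           apply is_lim_seq_scal_l.
           replace (Finite 0) with (Rbar_mult (Finite 0) u) by (simpl; f_equal; ring).
           now apply is_lim_seq_scal_r. }
      intros N.
      set (E := fun t => Csum (fun v => log_coef q (S v) * RtoC t ^ S v) N + Lfun q t).
      assert (HE0 : E 0%R = Lfun q 0).
      { unfold E. replace (Csum _ N) with (RtoC 0); [ring|].
        clear. induction N as [|N IH]; [rewrite Csum_O|rewrite Csum_S, <- IH]; simpl; ring. }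
      assert (Hd := Cmean_value E (fun t => - Csum (fun v => c v * RtoC t ^ v) N + hfun q (RtoC
        t))
        (fun t => eps N * t)%R (fun _ => eps N) 0 u).
      replace (Csum _ N - _) with (E u - E 0%R) by (rewrite HE0; unfold E; ring).
      replace (2 * (eps N * u))%R with (2 * (eps N * u - eps N * 0))%R by ring.
      apply Hd; clear Hd.
      - lra.
      - intros t Ht. apply Cder_plus; [|apply Cder_Lfun; auto; lra].
        clear - Ec.
        assert (HT : forall v, Cder (fun t => log_coef q (S v) * RtoC t ^ S v) t (- (c v * RtoC t
          ^ v))).
        { intros v.
          apply (Cder_ext (fun t => RtoC (INR (S v)) * log_coef q (S v) * RtoC (t ^ S v / INR (S
            v)))).
          - intros s. assert (Hn : INR (S v) <> 0%R) by (apply not_0_INR; lia).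
            unfold Rdiv. rewrite RtoC_mult, RtoC_pow, RtoC_inv by auto.
            in_C.
            field. now apply RtoC_neq.
          - eapply Cder_val; [apply Cder_scal, Cder_RtoC, is_derive_pow_div|].
            rewrite Ec, RtoC_pow. ring. }
        induction N as [|N IH].
        + apply (Cder_ext (fun t => log_coef q 1 * RtoC t ^ 1)).
          { intros s. now rewrite Csum_O. }
          rewrite Csum_O. apply HT.
        + apply (Cder_ext (fun t => Csum (fun v => log_coef q (S v) * RtoC t ^ S v) N + log_coef
            q (S (S N)) * RtoC t ^ S (S N))).
          { intros s. now rewrite Csum_S. }
          eapply Cder_val; [apply Cder_plus; [exact IH|apply HT]|].
          rewrite Csum_S. ring.
      - intros t _. apply is_derive_linear.
      - intros t Ht. rewrite <- Cmod_opp.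
        replace (- _) with (Csum (fun v => c v * RtoC t ^ v) N - hfun q (RtoC t)) by ring.
        unfold eps. apply (Cseries_tail_bound _ (fun n => M * x ^ n)%R); auto.
        + intros n. rewrite Cmod_mult, Cmod_pow, Cmod_R, Rabs_pos_eq by lra.
          unfold x, Rdiv. rewrite Rpow_mult_distr, pow_inv, <- Rmult_assoc.
          eapply Rle_trans; [apply Rmult_le_compat; [apply Cmod_ge_0|apply pow_le; lra|apply
            HcM|apply pow_incr; split; [lra|apply Ht]]|].
          unfold Rdiv. lra.
        + apply Hser. lra. }
    apply (Cseries_unshift (fun v => log_coef q v * RtoC u ^ v)) in Hmain.
    eapply Cseries_val; [exact Hmain|].
    cbv beta. rewrite E0. simpl. ring.
  - intros u Hu. eapply Cseries_val.
    + eapply Cseries_ext; [|apply (Cseries_mult_l (- (1)) _ _ (Hser u Hu))].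
      intros n. cbv beta. rewrite Ec. ring.
    + ring.
Qed.

(** * Improper integrals *)

Lemma filterlim_Rmult_l (c y : R) :
  filterlim (fun x => c * x)%R (locally y) (locally (c * y)%R).
Proof. apply (filterlim_scal_r (K := R_AbsRing) (V := R_NormedModule) c y). Qed.

Lemma filterlim_sub_prod (V : NormedModule R_AbsRing) (E : R -> V)
  (Fa Fb : (R -> Prop) -> Prop) {FFa : Filter Fa} {FFb : Filter Fb} (la lb : V) :
  filterlim E Fa (locally la) -> filterlim E Fb (locally lb) ->
  filterlim (fun ab => minus (E (snd ab)) (E (fst ab))) (filter_prod Fa Fb) (locally (minus lb
    la)).
Proof.
  intros Ha Hb. apply (filterlim_comp_2 (F := filter_prod Fa Fb) (G := locally lb)
    (H := locally (opp la)) (fun ab => E (snd ab)) (fun ab => opp (E (fst ab))) plus).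
  - apply (filterlim_comp _ _ _ snd E _ Fb); auto. apply filterlim_snd.
  - apply (filterlim_comp _ _ _ (fun ab => E (fst ab)) opp _ (locally la)).
    + apply (filterlim_comp _ _ _ fst E _ Fa); auto. apply filterlim_fst.
    + apply (filterlim_opp la).
  - apply (filterlim_plus lb (opp la)).
Qed.

Lemma is_RInt_gen_antiderivative (V : CompleteNormedModule R_AbsRing) (E dE : R -> V)
  (Fa Fb : (R -> Prop) -> Prop) {FFa : Filter Fa} {FFb : Filter Fb} (la lb : V) :
  filter_prod Fa Fb (fun ab => forall t, (Rmin (fst ab) (snd ab) <= t <= Rmax (fst ab) (snd
    ab))%R ->
     is_derive E t (dE t) /\ continuous dE t) ->
  filterlim E Fa (locally la) -> filterlim E Fb (locally lb) ->
  is_RInt_gen dE Fa Fb (minus lb la).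
Proof.
  intros HD Ha Hb P HP.
  assert (H := filterlim_sub_prod V E Fa Fb la lb Ha Hb P HP).
  unfold filtermapi. unfold filtermap in H.
  generalize (filter_and _ _ HD H). apply filter_imp.
  intros [a b] [H1 H2]. cbn [fst snd] in *.
  exists (minus (E b) (E a)). split; auto.
  apply (is_RInt_derive E dE); intros t Ht; now apply H1.
Qed.

(** The Cauchy criterion at both ends at once: the integral of f from x to y is at most |H y - H x|,
    and the primitive H of the majorant has limits at the two ends. *)
Lemma CRInt_gen_dominated (f : R -> C) (H g : R -> R) (D : R -> Prop)
  (Fa Fb : (R -> Prop) -> Prop) {FFa : ProperFilter Fa} {FFb : ProperFilter Fb} (la lb : R) :
  (forall x y t, D x -> D y -> (x <= t <= y)%R -> D t) ->
  Fa D -> Fb D ->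
  (forall t, D t -> Ccont f t) -> (forall t, D t -> is_derive H t (g t)) ->
  (forall t, D t -> continuous g t) -> (forall t, D t -> (Cmod (f t) <= g t)%R) ->
  filterlim H Fa (locally la) -> filterlim H Fb (locally lb) ->
  exists l, is_CRInt_gen f Fa Fb l.
Proof.
  intros Hconv Da Db Hf HH Hg Hle Hla Hlb.
  assert (Hsub : forall x y t, D x -> D y -> (Rmin x y <= t <= Rmax x y)%R -> D t).
  { intros x y t Hx Hy Ht. destruct (Rle_dec x y) as [L|L].
    - rewrite Rmin_left, Rmax_right in Ht by lra. now apply (Hconv x y).
    - rewrite Rmin_right, Rmax_left in Ht by lra. now apply (Hconv y x). }
  assert (Hint : forall x y, D x -> D y -> is_CRInt f x y (CRInt f x y)).
  { intros x y Hx Hy. apply CRInt_continuous. intros t Ht. apply Hf. now apply (Hsub x y). }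
  assert (Hbd : forall x y l, D x -> D y -> is_CRInt f x y l -> (Cmod l <= Rabs (H y - H x))%R).
  { assert (K : forall x y l, D x -> D y -> (x <= y)%R -> is_CRInt f x y l -> (Cmod l <= H y - H
      x)%R).
    { intros x y l Hx Hy Hxy Hl. rewrite <- norm_C_R.
      apply (norm_RInt_le (V := C_R_NormedModule) f g x y); auto.
      - intros t Ht. rewrite norm_C_R. apply Hle. now apply (Hconv x y).
      - apply (is_RInt_derive (V := R_CompleteNormedModule) H g).
        + intros t Ht. apply HH. now apply (Hsub x y).
        + intros t Ht. apply Hg. now apply (Hsub x y). }
    intros x y l Hx Hy Hl. destruct (Rle_dec x y) as [L|L].
    - eapply Rle_trans; [now apply (K x y)|apply Rle_abs].
    - apply (is_RInt_swap (V := C_R_NormedModule)) in Hl.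
      assert (H1 := K y x (opp (G := C_R_NormedModule) l) Hy Hx ltac:(lra) Hl).
      change (Cmod (- l) <= H x - H y)%R in H1. rewrite Cmod_opp in H1.
      rewrite Rabs_minus_sym. eapply Rle_trans; [exact H1|apply Rle_abs]. }
  set (I := fun ab : R * R => CRInt f (fst ab) (snd ab)).
  assert (HC : exists y : C_R_CompleteNormedModule, filterlim I (filter_prod Fa Fb) (locally y)).
  { apply (filterlim_locally_cauchy (U := C_R_CompleteNormedModule) I).
    intros eps.
    assert (He4 : (0 < eps / 4)%R) by (generalize (cond_pos eps); lra).
    assert (Ca := proj1 (filterlim_locally _ _) Hla (mkposreal _ He4)).
    assert (Cb := proj1 (filterlim_locally _ _) Hlb (mkposreal _ He4)).
    exists (fun ab => (D (fst ab) /\ (Rabs (H (fst ab) - la) < eps / 4)%R) /\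
                      (D (snd ab) /\ (Rabs (H (snd ab) - lb) < eps / 4)%R)).
    split.
    { apply (Filter_prod Fa Fb _ (fun a => D a /\ (Rabs (H a - la) < eps / 4)%R)
        (fun b => D b /\ (Rabs (H b - lb) < eps / 4)%R)).
      - apply filter_and; auto.
      - apply filter_and; auto.
      - intros x y Hx Hy. now split. }
    intros [a b] [a' b'] [[H1 H2] [H3 H4]] [[H1' H2'] [H3' H4']]. cbn [fst snd] in *.
    assert (T : (Cmod (I (a', b') - I (a, b))%C < eps)%R).
    (* The two integrals differ by those from a' to a and from b to b'. Each is bounded by two
       deviations of H from its limit, hence the eps / 4. *)
    { assert (A := Hint a' a H1' H1). assert (B := Hint b b' H3 H3').
      assert (M := Hint a b H1 H3).
      assert (S := is_RInt_Chasles (V := C_R_NormedModule) _ _ _ _ _ _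
         (is_RInt_Chasles (V := C_R_NormedModule) _ _ _ _ _ _ A M) B).
      assert (E := CRInt_unique _ _ _ _ _ (Hint a' b' H1' H3') S).
      assert (HA := Hbd _ _ _ H1' H1 A). assert (HB := Hbd _ _ _ H3 H3' B).
      unfold I. cbn [fst snd]. rewrite E.
      match goal with |- (Cmod ?t < _)%R => replace t with
        (CRInt f a' a + CRInt f b b' : C) end.
      2: { match goal with |- (?x + ?y)%C = (plus (plus ?u ?v) ?w - ?s)%C => change (x + y = ((x
             + v) + y) - v :> C) end. ring. }
      eapply Rle_lt_trans; [apply Cmod_triangle|].
      assert (R1 : (Rabs (H a - H a') <= Rabs (H a - la) + Rabs (H a' - la))%R).
      { replace (H a - H a')%R with ((H a - la) - (H a' - la))%R by ring.
        eapply Rle_trans; [apply Rabs_triang|]. rewrite Rabs_Ropp. lra. }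
      assert (R2 : (Rabs (H b' - H b) <= Rabs (H b' - lb) + Rabs (H b - lb))%R).
      { replace (H b' - H b)%R with ((H b' - lb) - (H b - lb))%R by ring.
        eapply Rle_trans; [apply Rabs_triang|]. rewrite Rabs_Ropp. lra. }
      lra. }
    split.
    - change (Rabs (fst (I (a', b')) - fst (I (a, b))) < eps)%R.
      eapply Rle_lt_trans; [|exact T]. apply (abs_fst_le (I (a', b') - I (a, b))).
    - change (Rabs (snd (I (a', b')) - snd (I (a, b))) < eps)%R.
      eapply Rle_lt_trans; [|exact T]. apply (abs_snd_le (I (a', b') - I (a, b))). }
  destruct HC as [l Hl]. exists l. intros P HP. specialize (Hl P HP).
  unfold filtermapi. unfold filtermap in Hl.
  assert (HDD : filter_prod Fa Fb (fun ab => D (fst ab) /\ D (snd ab))).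
  { apply (Filter_prod Fa Fb _ D D); auto. }
  generalize (filter_and _ _ HDD Hl). apply filter_imp.
  intros [a b] [[H1 H2] H3]. cbn [fst snd] in *.
  exists (I (a, b)). auto.
Qed.

Lemma CRInt_gen_scal (c : C) (f : R -> C) (Fa Fb : (R -> Prop) -> Prop)
  {FFa : Filter Fa} {FFb : Filter Fb} (l : C) :
  is_CRInt_gen f Fa Fb l -> is_CRInt_gen (fun t => c * f t) Fa Fb (c * l).
Proof.
  intros H P HP.
  assert (Hc : filterlim (fun y : C => c * y) (locally (T := C_UniformSpace) l) (locally (T :=
    C_UniformSpace) (c * l))).
  { apply (filterlim_scal_r (K := C_AbsRing) (V := C_NormedModule) c l). }
  specialize (H _ (Hc P HP)). unfold filtermapi in *. revert H. apply filter_imp.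
  intros [a b] (y & Hy & Hp). exists (c * y). split; auto. now apply CRInt_scal.
Qed.

Lemma CRInt_gen_plus (f g : R -> C) (Fa Fb : (R -> Prop) -> Prop)
  {FFa : Filter Fa} {FFb : Filter Fb} (lf lg : C) :
  is_CRInt_gen f Fa Fb lf -> is_CRInt_gen g Fa Fb lg ->
  is_CRInt_gen (fun t => f t + g t) Fa Fb (lf + lg).
Proof. apply (is_RInt_gen_plus (V := C_R_NormedModule)). Qed.

Lemma CRInt_gen_minus (f g : R -> C) (Fa Fb : (R -> Prop) -> Prop)
  {FFa : Filter Fa} {FFb : Filter Fb} (lf lg : C) :
  is_CRInt_gen f Fa Fb lf -> is_CRInt_gen g Fa Fb lg ->
  is_CRInt_gen (fun t => f t - g t) Fa Fb (lf - lg).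
Proof. apply (is_RInt_gen_minus (V := C_R_NormedModule)). Qed.

Lemma CRInt_gen_unique (f : R -> C) (Fa Fb : (R -> Prop) -> Prop)
  {FFa : ProperFilter Fa} {FFb : ProperFilter Fb} (l l' : C) :
  is_CRInt_gen f Fa Fb l -> is_CRInt_gen f Fa Fb l' -> l = l'.
Proof.
  intros H H'. rewrite <- (is_RInt_gen_unique (V := C_R_CompleteNormedModule) _ _ H).
  apply (is_RInt_gen_unique (V := C_R_CompleteNormedModule) _ _ H').
Qed.

Lemma CRInt_gen_val (f : R -> C) (Fa Fb : (R -> Prop) -> Prop) (l l' : C) :
  is_CRInt_gen f Fa Fb l -> l = l' -> is_CRInt_gen f Fa Fb l'.
Proof. now intros H <-. Qed.

Lemma CRInt_gen_eq (f : R -> C) (Fa Fb : (R -> Prop) -> Prop)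
  {FFa : ProperFilter Fa} {FFb : ProperFilter Fb} (l : C) :
  is_CRInt_gen f Fa Fb l -> CRInt_gen f Fa Fb = l.
Proof. exact (is_RInt_gen_unique (V := C_R_CompleteNormedModule) f l). Qed.

Lemma CRInt_gen_ext (f g : R -> C) (Fa Fb : (R -> Prop) -> Prop)
  {FFa : Filter Fa} {FFb : Filter Fb} (l : C) :
  (forall t, f t = g t) -> is_CRInt_gen f Fa Fb l -> is_CRInt_gen g Fa Fb l.
Proof.
  intros H. apply (is_RInt_gen_ext (V := C_R_NormedModule)).
  apply filter_forall. auto.
Qed.

Lemma CRInt_gen_norm_le (f : R -> C) (g : R -> R) (Fa Fb : (R -> Prop) -> Prop)
  {FFa : ProperFilter Fa} {FFb : ProperFilter Fb} (l : C) (lg : R) :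
  filter_prod Fa Fb (fun ab => (fst ab <= snd ab)%R /\
     forall t, (fst ab <= t <= snd ab)%R -> (Cmod (f t) <= g t)%R) ->
  is_CRInt_gen f Fa Fb l -> is_RInt_gen g Fa Fb lg -> (Cmod l <= lg)%R.
Proof.
  intros H Hf Hg. rewrite <- norm_C_R.
  apply (RInt_gen_norm (V := C_R_CompleteNormedModule) (Fa := Fa) (Fb := Fb) f g l lg); auto.
  - revert H. apply filter_imp. now intros ab [H1 _].
  - revert H. apply filter_imp. intros ab [_ H2] t Ht. rewrite norm_C_R. auto.
Qed.

(** The remainder after N terms is at most [eps N] times a single integrable g, so the integrals
    miss their limit by at most [eps N * lg]. *)
Lemma CRInt_gen_series (f : R -> C) (fn : nat -> R -> C) (In : nat -> C) (g : R -> R) (eps : nat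
  -> R)
  (Fa Fb : (R -> Prop) -> Prop) {FFa : ProperFilter Fa} {FFb : ProperFilter Fb} (l : C) (lg : R) :
  (forall n, is_CRInt_gen (fn n) Fa Fb (In n)) -> is_CRInt_gen f Fa Fb l -> is_RInt_gen g Fa Fb
    lg ->
  filter_prod Fa Fb (fun ab => (fst ab <= snd ab)%R /\
     forall t, (fst ab <= t <= snd ab)%R -> forall N,
       (Cmod (f t - Csum (fun n => fn n t) N) <= eps N * g t)%R) ->
  is_lim_seq eps 0 -> Cseries In l.
Proof.
  intros Hn Hf Hg Hle Heps.
  apply (Cseries_of_bound _ _ (fun N => eps N * lg)%R).
  - intros N. rewrite Cmod_minus_sym.
    assert (HS : is_CRInt_gen (fun t => Csum (fun n => fn n t) N) Fa Fb (Csum In N)).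
    { clear - Hn FFa FFb. induction N as [|N IH].
      - rewrite Csum_O. refine (CRInt_gen_ext (fn 0%nat) _ Fa Fb _ _ (Hn 0%nat)).
        intros t. now rewrite Csum_O.
      - rewrite Csum_S.
        refine (CRInt_gen_ext (fun t => Csum (fun n => fn n t) N + fn (S N) t) _ Fa Fb _ _ _).
        + intros t. now rewrite Csum_S.
        + apply CRInt_gen_plus; auto; typeclasses eauto. }
    assert (HD := CRInt_gen_minus _ _ _ _ _ _ Hf HS).
    assert (HG := is_RInt_gen_scal (V := R_NormedModule) _ (eps N) _ Hg).
    refine (CRInt_gen_norm_le _ _ Fa Fb _ _ _ HD HG).
    revert Hle. apply filter_imp. intros ab [H1 H2]. split; auto.
  - replace (Finite 0) with (Rbar_mult (Finite 0) lg) by (simpl; f_equal; ring).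
    now apply is_lim_seq_scal_r.
Qed.

(** * Integration ranges, and the model integrals of powers and exponentials *)

Lemma at_right_0_interval (d : R) : (0 < d)%R -> at_right 0 (fun t => (0 < t <= d)%R).
Proof.
  intros Hd. exists (mkposreal d Hd). intros t Ht Ht0.
  change (Rabs (t - 0) < d)%R in Ht. rewrite Rminus_0_r in Ht.
  apply Rabs_lt_between in Ht. lra.
Qed.

Lemma filter_left (d : R) (Q : R -> Prop) :
  (0 < d)%R -> (forall t, (0 < t <= d)%R -> Q t) ->
  filter_prod (at_right 0) (at_point d)
    (fun ab => (fst ab <= snd ab)%R /\ forall t, (fst ab <= t <= snd ab)%R -> Q t).
Proof.
  intros Hd HQ.
  apply (Filter_prod _ _ _ (fun t => (0 < t <= d)%R) (fun t => t = d)).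
  - now apply at_right_0_interval.
  - reflexivity.
  - intros a b Ha ->. cbn [fst snd]. split; [lra|]. intros t Ht. apply HQ. lra.
Qed.

Lemma filter_right (d : R) (Q : R -> Prop) :
  (forall t, (d <= t)%R -> Q t) ->
  filter_prod (at_point d) (Rbar_locally p_infty)
    (fun ab => (fst ab <= snd ab)%R /\ forall t, (fst ab <= t <= snd ab)%R -> Q t).
Proof.
  intros HQ.
  apply (Filter_prod _ _ _ (fun t => t = d) (fun t => (d < t)%R)).
  - reflexivity.
  - now exists d.
  - intros a b -> Hb. cbn [fst snd]. split; [lra|]. intros t Ht. apply HQ. lra.
Qed.

Lemma filter_swap_bounds (Fa Fb : (R -> Prop) -> Prop) {FFa : Filter Fa} {FFb : Filter Fb} (Q : R
  -> Prop) :
  filter_prod Fa Fb (fun ab => (fst ab <= snd ab)%R /\ forall t, (fst ab <= t <= snd ab)%R -> Q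
    t) ->
  filter_prod Fa Fb (fun ab => forall t, (Rmin (fst ab) (snd ab) <= t <= Rmax (fst ab) (snd
    ab))%R -> Q t).
Proof.
  apply filter_imp. intros [a b] [H1 H2] t Ht. cbn [fst snd] in *.
  rewrite Rmin_left, Rmax_right in Ht by auto. now apply H2.
Qed.

Lemma filter_full (Q : R -> Prop) :
  (forall t, (0 < t)%R -> Q t) ->
  filter_prod (at_right 0) (Rbar_locally p_infty)
    (fun ab => (fst ab <= snd ab)%R /\ forall t, (fst ab <= t <= snd ab)%R -> Q t).
Proof.
  intros HQ.
  apply (Filter_prod _ _ _ (fun t => (0 < t <= 1)%R) (fun t => (1 < t)%R)).
  - apply at_right_0_interval. lra.
  - now exists 1%R.
  - intros a b Ha Hb. cbn [fst snd]. split; [lra|]. intros t Ht. apply HQ. lra.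
Qed.

Lemma filterlim_at_point (V : UniformSpace) (E : R -> V) (d : R) :
  filterlim E (at_point d) (locally (E d)).
Proof. intros P [e He]. apply He, ball_center. Qed.

Lemma filterlim_Rpower_0 (s : R) : (0 < s)%R -> filterlim (fun t => Rpower t s) (at_right 0)
  (locally 0%R).
Proof.
  intros Hs. apply filterlim_locally. intros eps.
  assert (Hd : (0 < Rpower eps (/ s))%R) by apply exp_pos.
  exists (mkposreal _ Hd). intros t Ht Ht0.
  change (Rabs (t - 0) < Rpower eps (/ s))%R in Ht. rewrite Rminus_0_r, Rabs_pos_eq in Ht by lra.
  change (Rabs (Rpower t s - 0) < eps)%R.
  rewrite Rminus_0_r, Rabs_pos_eq by (left; apply exp_pos).
  replace (pos eps) with (Rpower (Rpower eps (/ s)) s).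
  - apply Rlt_Rpower_l; auto.
  - rewrite Rpower_mult, Rinv_l, Rpower_1 by (try lra; apply cond_pos). reflexivity.
Qed.

Lemma filterlim_exp_infty (e : R) :
  (0 < e)%R -> filterlim (fun t => exp (- (e * t))) (Rbar_locally p_infty) (locally 0%R).
Proof.
  intros He. apply filterlim_locally. intros eps. assert (Heps := cond_pos eps).
  exists (/ (e * eps))%R. intros t Ht.
  change (Rabs (exp (- (e * t)) - 0) < eps)%R.
  rewrite Rminus_0_r, Rabs_pos_eq by (left; apply exp_pos).
  rewrite exp_Ropp. rewrite <- (Rinv_inv eps).
  apply Rinv_lt_contravar.
  - apply Rmult_lt_0_compat; [now apply Rinv_0_lt_compat|apply exp_pos].
  - eapply Rlt_le_trans; [|apply exp_ineq1_le].
    assert (H : (e * (/ (e * eps)) < e * t)%R) by now apply Rmult_lt_compat_l.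
    replace (e * / (e * eps))%R with (/ eps)%R in H by (field; lra). lra.
Qed.

Lemma is_derive_Rpower (s t : R) : (0 < t)%R -> is_derive (fun x => Rpower x s) t (s * Rpower t
  (s - 1))%R.
Proof.
  intros Ht. unfold Rpower. auto_derive; auto.
  replace ((s - 1) * ln t)%R with (s * ln t + - ln t)%R by ring.
  rewrite exp_plus, exp_Ropp, exp_ln by auto. field. lra.
Qed.

Lemma is_derive_Rpower_div (s t : R) :
  (0 < t)%R -> (0 < s)%R -> is_derive (fun x => / s * Rpower x s)%R t (Rpower t (s - 1)).
Proof.
  intros Ht Hs. eapply Rder_val; [apply is_derive_scal, is_derive_Rpower; auto|].
  field. lra.
Qed.

Lemma continuous_Rpower (s t : R) : (0 < t)%R -> continuous (fun x => Rpower x s) t.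
Proof.
  intros Ht. apply (ex_derive_continuous (fun x => Rpower x s)).
  eexists. now apply is_derive_Rpower.
Qed.

Lemma is_derive_exp_div (e t : R) :
  (0 < e)%R -> is_derive (fun x => - / e * exp (- (e * x)))%R t (exp (- (e * t))).
Proof. intros He. auto_derive; auto. field. lra. Qed.

Lemma continuous_exp_lin (e t : R) : continuous (fun x => exp (- (e * x))) t.
Proof.
  apply (ex_derive_continuous (fun x => exp (- (e * x)))). auto_derive. auto.
Qed.

Lemma Rpower_RInt_gen (d s : R) :
  (0 < d)%R -> (0 < s)%R ->
  is_RInt_gen (fun t => Rpower t (s - 1)) (at_right 0) (at_point d) (/ s * Rpower d s)%R.
Proof.
  intros Hd Hs.
  replace (/ s * Rpower d s)%R with (minus (/ s * Rpower d s) (/ s * 0))%R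
    by (unfold minus, plus, opp; simpl; ring).
  apply (is_RInt_gen_antiderivative R_CompleteNormedModule (fun t => / s * Rpower t s)%R); try
    typeclasses eauto.
  - apply filter_swap_bounds; try typeclasses eauto. apply filter_left; auto. intros t Ht. split.
    + apply is_derive_Rpower_div; lra.
    + apply continuous_Rpower; lra.
  - apply (filterlim_comp _ _ _ _ (fun y => / s * y)%R _ (locally 0%R)).
    + now apply filterlim_Rpower_0.
    + apply (filterlim_Rmult_l (/ s)%R 0%R).
  - apply (filterlim_at_point R_UniformSpace (fun t => / s * Rpower t s)%R).
Qed.

Lemma exp_RInt_gen (d e : R) :
  (0 < e)%R -> is_RInt_gen (fun t => exp (- (e * t))) (at_point d) (Rbar_locally p_infty)
     (/ e * exp (- (e * d)))%R.
Proof.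
  intros He.
  replace (/ e * exp (- (e * d)))%R with (minus (- / e * 0) (- / e * exp (- (e * d))))%R
    by (unfold minus, plus, opp; simpl; ring).
  apply (is_RInt_gen_antiderivative R_CompleteNormedModule (fun t => - / e * exp (- (e * t)))%R);
    try typeclasses eauto.
  - apply filter_swap_bounds; try typeclasses eauto. apply filter_right. intros t Ht. split.
    + now apply is_derive_exp_div.
    + apply continuous_exp_lin.
  - apply (filterlim_at_point R_UniformSpace (fun t => - / e * exp (- (e * t)))%R).
  - apply (filterlim_comp _ _ _ _ (fun y => - / e * y)%R _ (locally 0%R)).
    + now apply filterlim_exp_infty.
    + apply (filterlim_Rmult_l (- / e)%R 0%R).
Qed.

Lemma CRInt_gen_ex_left (f : R -> C) (d s M : R) :
  (0 < d)%R -> (0 < s)%R ->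
  (forall t, (0 < t <= d)%R -> Ccont f t) ->
  (forall t, (0 < t <= d)%R -> (Cmod (f t) <= M * Rpower t (s - 1))%R) ->
  exists l, is_CRInt_gen f (at_right 0) (at_point d) l.
Proof.
  intros Hd Hs Hc Hb.
  apply (CRInt_gen_dominated f (fun t => M * (/ s * Rpower t s))%R (fun t => M * Rpower t (s -
    1))%R
     (fun t => (0 < t <= d)%R) _ _ (M * (/ s * 0))%R (M * (/ s * Rpower d s))%R).
  - intros x y t Hx Hy Ht. lra.
  - now apply at_right_0_interval.
  - unfold at_point. lra.
  - auto.
  - intros t Ht. apply is_derive_scal, is_derive_Rpower_div; lra.
  - intros t Ht. apply (continuous_scal_r (K := R_AbsRing) (V := R_NormedModule) M).
    apply continuous_Rpower; lra.
  - auto.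
  - apply (filterlim_comp _ _ _ (fun t => Rpower t s) (fun y => M * (/ s * y))%R _ (locally 0%R)).
    + now apply filterlim_Rpower_0.
    + apply (filterlim_comp _ _ _ (fun y => / s * y)%R (fun y => M * y)%R _ (locally (/ s *
        0)%R)).
      * apply (filterlim_Rmult_l (/ s)%R 0%R).
      * apply (filterlim_Rmult_l M (/ s * 0)%R).
  - apply (filterlim_at_point R_UniformSpace (fun t => M * (/ s * Rpower t s))%R).
Qed.

Lemma CRInt_gen_ex_right (f : R -> C) (d e M : R) :
  (0 < e)%R ->
  (forall t, (d <= t)%R -> Ccont f t) ->
  (forall t, (d <= t)%R -> (Cmod (f t) <= M * exp (- (e * t)))%R) ->
  exists l, is_CRInt_gen f (at_point d) (Rbar_locally p_infty) l.
Proof.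
  intros He Hc Hb.
  apply (CRInt_gen_dominated f (fun t => M * (- / e * exp (- (e * t))))%R (fun t => M * exp (- (e
    * t)))%R
     (fun t => (d <= t)%R) _ _ (M * (- / e * exp (- (e * d))))%R (M * (- / e * 0))%R).
  - intros x y t Hx Hy Ht. lra.
  - unfold at_point. lra.
  - exists d. intros t Ht. lra.
  - auto.
  - intros t Ht. apply is_derive_scal. now apply is_derive_exp_div.
  - intros t Ht. apply (continuous_scal_r (K := R_AbsRing) (V := R_NormedModule) M).
    apply continuous_exp_lin.
  - auto.
  - apply (filterlim_at_point R_UniformSpace (fun t => M * (- / e * exp (- (e * t))))%R).
  - apply (filterlim_comp _ _ _ (fun t => exp (- (e * t))) (fun y => M * (- / e * y))%R _
      (locally 0%R)).
    + now apply filterlim_exp_infty.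
    + apply (filterlim_comp _ _ _ (fun y => - / e * y)%R (fun y => M * y)%R _ (locally (- / e *
        0)%R)).
      * apply (filterlim_Rmult_l (- / e)%R 0%R).
      * apply (filterlim_Rmult_l M (- / e * 0)%R).
Qed.

(** Half of the decay rate absorbs the power of t. For tau < 0 the power is bounded on t >= d by its
    value at d. *)
Lemma Rpower_exp_bound (d e tau : R) :
  (0 < d)%R -> (0 < e)%R ->
  exists M, (0 <= M)%R /\ forall t, (d <= t)%R -> (Rpower t tau * exp (- (e * t)) <= M * exp (-
    (e / 2 * t)))%R.
Proof.
  intros Hd He.
  assert (K : exists M, (0 <= M)%R /\ forall t, (d <= t)%R -> (Rpower t tau <= M * exp (e / 2 *
    t))%R).
  { destruct (Rle_dec 0 tau) as [L|L].
    (* From 1 + y <= e^y follows ln t <= t / k + ln k, and this k makes tau / k at most e / 2.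
       Taking tau + 1 keeps k positive when tau = 0. *)
    - set (k := (2 * (tau + 1) / e)%R).
      assert (Hk : (0 < k)%R) by (unfold k; apply Rdiv_lt_0_compat; lra).
      exists (exp (tau * ln k)). split; [left; apply exp_pos|]. intros t Ht.
      unfold Rpower. rewrite <- exp_plus. apply exp_le.
      assert (Hl : (ln t <= t / k + ln k)%R).
      { replace t with ((t / k) * k)%R at 1 by (field; lra).
        assert (0 < t / k)%R by (apply Rdiv_lt_0_compat; lra).
        rewrite ln_mult by auto.
        assert (H1 := exp_ineq1_le (ln (t / k))). rewrite exp_ln in H1 by auto. lra. }
      assert (H2 : (tau * (t / k) <= e / 2 * t)%R).
      { unfold k. replace (tau * (t / (2 * (tau + 1) / e)))%R with ((tau / (tau + 1)) * (e / 2 *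
          t))%R
          by (field; lra).
        assert (tau / (tau + 1) <= 1)%R by (apply Rle_div_l; lra).
        assert (0 <= e / 2 * t)%R by nra. nra. }
      nra.
    - exists (Rpower d tau). split; [left; apply exp_pos|]. intros t Ht.
      assert (H1 := Rpower_anti d t (- tau) Hd Ht ltac:(lra)). rewrite Ropp_involutive in H1.
      assert (H2 : (1 <= exp (e / 2 * t))%R).
      { rewrite <- exp_0. apply exp_le. nra. }
      assert (0 < Rpower d tau)%R by apply exp_pos. nra. }
  destruct K as (M & HM & HK). exists M. split; auto. intros t Ht.
  specialize (HK t Ht).
  replace (- (e / 2 * t))%R with (e / 2 * t + - (e * t))%R by field.
  rewrite exp_plus, <- Rmult_assoc. apply Rmult_le_compat_r; [left; apply exp_pos|auto].
Qed.

Lemma CRInt_gen_Chasles (f : R -> C) (d : R) (l1 l2 : C) :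
  is_CRInt_gen f (at_right 0) (at_point d) l1 ->
  is_CRInt_gen f (at_point d) (Rbar_locally p_infty) l2 ->
  is_CRInt_gen f (at_right 0) (Rbar_locally p_infty) (l1 + l2).
Proof. apply (is_RInt_gen_Chasles (V := C_R_NormedModule)). Qed.

Lemma Ccont_cpow (s : C) (t : R) : (0 < t)%R -> Ccont (fun x => cpow x s) t.
Proof. intros Ht. eapply Cder_cont, Cder_cpow; auto. Qed.

Lemma Mellin_ex_left (g : R -> C) (z : C) (d M : R) :
  (0 < d)%R -> (0 < fst z)%R ->
  (forall t, (0 < t <= d)%R -> Ccont g t) -> (forall t, (0 < t <= d)%R -> (Cmod (g t) <= M)%R) ->
  exists l, is_CRInt_gen (fun t => cpow t (z - 1) * g t) (at_right 0) (at_point d) l.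
Proof.
  intros Hd Hz Hc Hb. apply (CRInt_gen_ex_left _ d (fst z) M); auto.
  - intros t Ht. apply Ccont_mult; [apply Ccont_cpow; lra|auto].
  - intros t Ht. rewrite Cmod_mult, Cmod_cpow, Rmult_comm.
    replace (fst (z - 1)) with (fst z - 1)%R by (destruct z; simpl; ring).
    apply Rmult_le_compat_r; [left; apply exp_pos|auto].
Qed.

Lemma Mellin_ex_right (g : R -> C) (z : C) (d e M : R) :
  (0 < d)%R -> (0 < e)%R ->
  (forall t, (d <= t)%R -> Ccont g t) ->
  (forall t, (d <= t)%R -> (Cmod (g t) <= M * exp (- (e * t)))%R) ->
  exists l, is_CRInt_gen (fun t => cpow t z * g t) (at_point d) (Rbar_locally p_infty) l.
Proof.
  intros Hd He Hc Hb. destruct (Rpower_exp_bound d e (fst z) Hd He) as (B & HB0 & HB).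
  apply (CRInt_gen_ex_right _ d (e / 2) (Rabs M * B)); [lra| |].
  - intros t Ht. apply Ccont_mult; [apply Ccont_cpow; lra|auto].
  - intros t Ht. rewrite Cmod_mult, Cmod_cpow. specialize (Hb t Ht). specialize (HB t Ht).
    assert (H1 := exp_pos (- (e * t))). assert (H2 := exp_pos (fst z * ln t)).
    fold (Rpower t (fst z)) in H2.
    assert (H3 := Rle_abs M). assert (H4 := Rabs_pos M).
    apply Rle_trans with (Rpower t (fst z) * (Rabs M * exp (- (e * t))))%R.
    + apply Rmult_le_compat_l; [lra|]. nra.
    + replace (Rpower t (fst z) * (Rabs M * exp (- (e * t))))%R with
        (Rabs M * (Rpower t (fst z) * exp (- (e * t))))%R by ring.
      rewrite Rmult_assoc. apply Rmult_le_compat_l; auto.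
Qed.

(** * Changes of variables *)

Lemma filterlim_at_right_0_neg_ln (k : R) :
  (0 < k)%R -> filterlim (fun t => - ln t / k)%R (at_right 0) (Rbar_locally p_infty).
Proof.
  intros Hk P [M HM]. unfold filtermap.
  exists (mkposreal _ (exp_pos (- (k * M)))). intros t Ht Ht0.
  change (Rabs (t - 0) < exp (- (k * M)))%R in Ht. rewrite Rminus_0_r, Rabs_pos_eq in Ht by lra.
  apply HM. apply Rlt_div_r; auto. apply ln_increasing in Ht; auto. rewrite ln_exp in Ht. lra.
Qed.

Lemma filterlim_at_left_1_neg_ln (k : R) :
  (0 < k)%R -> filterlim (fun t => - ln t / k)%R (at_left 1) (at_right 0).
Proof.
  intros Hk P [e He]. unfold filtermap. assert (Hep := cond_pos e).
  assert (Hd : (0 < 1 - exp (- (k * e)))%R).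
  { assert (exp (- (k * e)) < 1)%R; [|lra]. rewrite <- exp_0. apply exp_increasing.
    assert (0 < k * e)%R by now apply Rmult_lt_0_compat. lra. }
  exists (mkposreal _ Hd). intros t Ht Ht1.
  change (Rabs (t - 1) < 1 - exp (- (k * e)))%R in Ht. rewrite Rabs_left in Ht by lra.
  assert (Hte : (exp (- (k * e)) < t)%R) by lra.
  assert (Ht0 : (0 < t)%R) by (eapply Rlt_trans; [apply exp_pos|exact Hte]).
  assert (L1 : (ln t < 0)%R) by (rewrite <- ln_1; now apply ln_increasing).
  assert (L2 : (- (k * e) < ln t)%R).
  { rewrite <- (ln_exp (- (k * e))). apply ln_increasing; auto. apply exp_pos. }
  apply He.
  - change (Rabs (- ln t / k - 0) < e)%R. rewrite Rminus_0_r, Rabs_pos_eq.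
    + apply Rlt_div_l; auto. lra.
    + apply Rdiv_le_0_compat; lra.
  - apply Rdiv_lt_0_compat; lra.
Qed.

(** The substitution t = e^(-kv) reverses orientation; this sign cancels the one in dt = -k e^(-kv)
    dv. *)
Lemma CRInt_gen_subst_exp (f : R -> C) (k : R) (l : C) :
  (0 < k)%R -> (forall t, (0 < t < 1)%R -> Ccont f t) ->
  is_CRInt_gen (fun v => RtoC (k * exp (- (k * v))) * f (exp (- (k * v))))
    (at_right 0) (Rbar_locally p_infty) l ->
  is_CRInt_gen f (at_right 0) (at_left 1) l.
Proof.
  intros Hk Hc H P HP. destruct (H P HP) as [Q1 Q2 HQ1 HQ2 HQ].
  (* The ends are exchanged: t near 0 corresponds to large v, controlled by [Q2], and t near 1 to
     small v, controlled by [Q1]. The threshold 1/2 guarantees a < b. *)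
  apply (Filter_prod _ _ _ (fun a => Q2 (- ln a / k)%R /\ (0 < a <= 1 / 2)%R)
           (fun b => Q1 (- ln b / k)%R /\ (1 / 2 < b < 1)%R)).
  - apply filter_and.
    + now apply filterlim_at_right_0_neg_ln.
    + apply at_right_0_interval. lra.
  - apply filter_and.
    + now apply filterlim_at_left_1_neg_ln.
    + assert (Hh : (0 < 1 / 2)%R) by lra. exists (mkposreal _ Hh). intros t Ht Ht1.
      change (Rabs (t - 1) < 1 / 2)%R in Ht. apply Rabs_lt_between in Ht. lra.
  - intros a b [Ha Ha'] [Hb Hb']. destruct (HQ _ _ Hb Ha) as (y & Hy & Hp). cbn [fst snd] in *.
    exists y. split; auto.
    set (u := (- ln b / k)%R) in *. set (v := (- ln a / k)%R) in *.
    assert (Eu : exp (- (k * u)) = b).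
    { unfold u. replace (- (k * (- ln b / k)))%R with (ln b) by (field; lra). apply exp_ln; lra. }
    assert (Ev : exp (- (k * v)) = a).
    { unfold v. replace (- (k * (- ln a / k)))%R with (ln a) by (field; lra). apply exp_ln; lra. }
    assert (Hu0 : (0 < u)%R).
    { unfold u. apply Rdiv_lt_0_compat; auto.
      assert (ln b < ln 1)%R by (apply ln_increasing; lra).
      rewrite ln_1 in *. lra. }
    assert (Huv : (u <= v)%R).
    { unfold u, v. apply Rmult_le_compat_r; [left; now apply Rinv_0_lt_compat|].
      assert (ln a <= ln b)%R by (left; apply ln_increasing; lra). lra. }
    assert (S := is_RInt_comp (V := C_R_CompleteNormedModule) f (fun v => exp (- (k * v)))
      (fun v => - (k * exp (- (k * v))))%R u v).
    cbv beta in S. rewrite Eu, Ev in S.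
    assert (S' : is_CRInt (fun v => - (RtoC (k * exp (- (k * v))) * f (exp (- (k * v))))) u v
      (CRInt f b a)).
    { eapply CRInt_ext; [|apply S].
      - intros t _.
        change (scal (K := R_AbsRing) (V := C_R_NormedModule) (- (k * exp (- (k * t))))%R (f (exp
          (- (k * t)))) =
           - (RtoC (k * exp (- (k * t))) * f (exp (- (k * t))))).
        destruct (f (exp (- (k * t)))) as [c d]. unfold RtoC, Copp, Cmult; simpl.
        match goal with |- ?x = ?y => change ((((- (k * exp (- (k * t)))) * c)%R, ((- (k * exp (-
          (k * t)))) * d)%R) = y) end.
        f_equal; ring.
      - intros t Ht. rewrite Rmin_left, Rmax_right in Ht by auto. apply Hc.
        split; [apply exp_pos|].
        rewrite <- exp_0. apply exp_increasing.
        assert (0 < k * t)%R by (apply Rmult_lt_0_compat; lra). lra.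
      - intros t Ht. split.
        + auto_derive; auto. ring.
        + apply (ex_derive_continuous (fun v => - (k * exp (- (k * v))))%R). auto_derive. auto. }
    apply (is_RInt_opp (V := C_R_NormedModule)) in Hy.
    assert (E := CRInt_unique _ _ _ _ _ S' Hy).
    assert (I : is_CRInt f b a (CRInt f b a)).
    { apply CRInt_continuous. intros t Ht. rewrite Rmin_right, Rmax_left in Ht by lra. apply Hc.
      lra. }
    rewrite E in I. apply (is_RInt_swap (V := C_R_NormedModule)) in I.
    eapply CRInt_val; [exact I|]. apply (opp_opp (G := C_R_NormedModule)).
Qed.

Lemma CRInt_gen_subst_scale (f : R -> C) (y d : R) (l : C) :
  (0 < y)%R -> (0 < d)%R -> (forall t, (0 < t)%R -> Ccont f t) ->
  is_CRInt_gen f (at_point (y * d)%R) (Rbar_locally p_infty) l ->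
  is_CRInt_gen (fun v => RtoC y * f (y * v)%R) (at_point d) (Rbar_locally p_infty) l.
Proof.
  intros Hy Hd Hc H P HP. destruct (H P HP) as [Q1 Q2 HQ1 HQ2 HQ].
  apply (Filter_prod _ _ _ (fun a => a = d) (fun b => Q2 (y * b)%R /\ (d < b)%R)).
  - reflexivity.
  - apply filter_and; [|now exists d].
    destruct HQ2 as [M HM]. exists (M / y)%R. intros t Ht. apply HM.
    apply Rlt_div_l in Ht; auto. lra.
  - intros a b -> [Hb Hdb]. destruct (HQ _ _ HQ1 Hb) as (w & Hw & Hp). cbn [fst snd] in *.
    exists w. split; auto.
    assert (S := is_RInt_comp (V := C_R_CompleteNormedModule) f (fun v => y * v)%R (fun _ => y) d
      b).
    cbv beta in S.
    rewrite (is_RInt_unique (V := C_R_CompleteNormedModule) _ _ _ _ Hw) in S.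
    eapply CRInt_ext; [|apply S].
    + intros t _.
      change (scal (K := R_AbsRing) (V := C_R_NormedModule) y (f (y * t)%R) = RtoC y * f (y *
        t)%R).
      destruct (f (y * t)%R) as [c e]. unfold RtoC, Cmult; simpl.
      match goal with |- ?x = ?z => change (((y * c)%R, (y * e)%R) = z) end.
      f_equal; ring.
    + intros t Ht. rewrite Rmin_left, Rmax_right in Ht by lra. apply Hc.
      apply Rmult_lt_0_compat; lra.
    + intros t _. split; [apply is_derive_linear|apply continuous_const].
Qed.

(** * Mellin transforms and the Gamma function *)

Definition is_Mellin (g : R -> C) (z l : C) : Prop :=
  is_CRInt_gen (fun t => cpow t (z - 1) * g t) (at_right 0) (Rbar_locally p_infty) l.

Definition Mellin (g : R -> C) (z : C) : C :=
  CRInt_gen (fun t => cpow t (z - 1) * g t)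
    (at_right 0) (Rbar_locally p_infty).

(** One bound on the whole half-line provides boundedness near 0 and decay at infinity, which is
    what the Mellin integral needs at every z with Re z > 0. *)
Definition exp_decay (g : R -> C) : Prop :=
  (forall t, (0 < t)%R -> Ccont g t) /\
  exists e M, (0 < e)%R /\ (0 <= M)%R /\ forall t, (0 < t)%R -> (Cmod (g t) <= M * exp (- (e *
    t)))%R.

Lemma Mellin_split (g : R -> C) (z : C) (d : R) :
  exp_decay g -> (0 < fst z)%R -> (0 < d)%R ->
  exists l1 l2,
    is_CRInt_gen (fun t => cpow t (z - 1) * g t) (at_right 0) (at_point d) l1 /\
    is_CRInt_gen (fun t => cpow t (z - 1) * g t) (at_point d) (Rbar_locally p_infty) l2 /\
    is_Mellin g z (l1 + l2).
Proof.
  intros (Hc & e & M & He & HM & Hb) Hz Hd.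
  destruct (Mellin_ex_left g z d M Hd Hz) as [l1 H1].
  { intros t Ht. apply Hc; lra. }
  { intros t Ht. eapply Rle_trans; [apply Hb; lra|].
    assert (exp (- (e * t)) <= 1)%R; [|nra].
    rewrite <- exp_0. apply exp_le. assert (0 < e * t)%R by (apply Rmult_lt_0_compat; lra). lra. }
  destruct (Mellin_ex_right g (z - 1) d e M Hd He) as [l2 H2].
  { intros t Ht. apply Hc; lra. }
  { intros t Ht. apply Hb; lra. }
  exists l1, l2. split; [exact H1|]. split; [exact H2|].
  exact (CRInt_gen_Chasles _ d l1 l2 H1 H2).
Qed.

Lemma is_Mellin_unique (g : R -> C) (z l l' : C) : is_Mellin g z l -> is_Mellin g z l' -> l = l'.
Proof. intros H H'. exact (CRInt_gen_unique _ _ _ _ _ H H'). Qed.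

Lemma Mellin_eq (g : R -> C) (z l : C) : is_Mellin g z l -> Mellin g z = l.
Proof. exact (CRInt_gen_eq _ _ _ l). Qed.

Lemma Mellin_correct (g : R -> C) (z : C) :
  exp_decay g -> (0 < fst z)%R -> is_Mellin g z (Mellin g z).
Proof.
  intros Hg Hz. destruct (Mellin_split g z 1 Hg Hz Rlt_0_1) as (l1 & l2 & _ & _ & H).
  now rewrite (Mellin_eq _ _ _ H).
Qed.

(** In the Lipschitz bound 2 |w ln t| e^|w ln t|, the factor |ln t| is at most 4 e^(|ln t|/4) and
    the exponential at most e^(|ln t|/4), because |w| <= 1/4. *)
Lemma cpow_sub_1_bound (w : C) (t : R) :
  (Cmod w <= 1 / 4)%R -> (Cmod (cpow t w - 1) <= 8 * Cmod w * exp (Rabs (ln t) / 2))%R.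
Proof.
  intros Hw. assert (Hw0 := Cmod_ge_0 w). assert (Hl := Rabs_pos (ln t)).
  unfold cpow. eapply Rle_trans; [apply Cexp_lipschitz|].
  rewrite Cmod_mult, Cmod_R.
  assert (H1 : (Rabs (ln t) <= 4 * exp (Rabs (ln t) / 4))%R).
  { generalize (exp_ineq1_le (Rabs (ln t) / 4)). lra. }
  assert (H2 : (exp (Cmod w * Rabs (ln t)) <= exp (Rabs (ln t) / 4))%R) by (apply exp_le; nra).
  assert (H3 : (exp (Rabs (ln t) / 2) = exp (Rabs (ln t) / 4) * exp (Rabs (ln t) / 4))%R).
  { rewrite <- exp_plus. f_equal. field. }
  rewrite H3. assert (H4 := exp_pos (Rabs (ln t) / 4)).
  assert (H5 := exp_pos (Cmod w * Rabs (ln t))).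
  assert (Rabs (ln t) * exp (Cmod w * Rabs (ln t)) <= 4 * exp (Rabs (ln t) / 4) * exp (Rabs (ln
    t) / 4))%R
    by (apply Rmult_le_compat; lra).
  nra.
Qed.

(** The weight e^(|ln t|/2) of [cpow_sub_1_bound] is t^(-1/2) below 1, which is integrable, and
    t^(1/2) above 1, which the decay of g absorbs. *)
Lemma Mellin_lipschitz_1 (g : R -> C) :
  exp_decay g -> exists K, (0 <= K)%R /\ forall z, (Cmod (z - 1) <= 1 / 4)%R ->
    (Cmod (Mellin g z - Mellin g 1) <= K * Cmod (z - 1))%R.
Proof.
  intros Hg. assert (Hg' := Hg). destruct Hg' as (Hc & e & M & He & HM & Hb).
  destruct (Rpower_exp_bound 1 e (1 / 2) Rlt_0_1 He) as (B & HB0 & HB).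
  (* [IL] is the integral of t^(-1/2) over (0, 1], and [IR] that of e^(-et/2) over [1, oo). *)
  set (IL := (/ (1 / 2) * Rpower 1 (1 / 2))%R).
  set (IR := (/ (e / 2) * exp (- (e / 2 * 1)))%R).
  exists (8 * M * IL + 8 * (M * B) * IR)%R.
  assert (HIL : (0 <= IL)%R).
  { unfold IL. apply Rmult_le_pos; [lra|left; apply exp_pos]. }
  assert (HIR : (0 <= IR)%R).
  { unfold IR. apply Rmult_le_pos; [left; apply Rinv_0_lt_compat; lra|left; apply exp_pos]. }
  split.
  { assert (0 <= M * B)%R by now apply Rmult_le_pos.
    apply Rplus_le_le_0_compat; apply Rmult_le_pos; lra. }
  intros z Hz.
  assert (Hz0 : (0 < fst z)%R).
  { assert (H := abs_fst_le (z - 1)). destruct z as [a b]; simpl in *.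
    assert (H1 := Rle_trans _ _ _ H Hz). apply Rabs_le_between in H1. lra. }
  destruct (Mellin_split g z 1 Hg Hz0 Rlt_0_1) as (l1 & l2 & A1 & A2 & A).
  destruct (Mellin_split g 1 1 Hg ltac:(simpl; lra) Rlt_0_1) as (m1 & m2 & B1 & B2 & B').
  rewrite (Mellin_eq _ _ _ A), (Mellin_eq _ _ _ B').
  replace (l1 + l2 - (m1 + m2)) with ((l1 - m1) + (l2 - m2)) by ring.
  apply Cmod_triangle_le. rewrite Rmult_plus_distr_r.
  assert (Hdiff : forall t, (0 < t)%R ->
    (Cmod (cpow t (z - 1) * g t - cpow t (1 - 1) * g t) <=
       8 * Cmod (z - 1) * exp (Rabs (ln t) / 2) * (M * exp (- (e * t))))%R).
  { intros t Ht. replace (1 - 1) with (RtoC 0) by ring. rewrite cpow_0.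
    replace (_ - _) with ((cpow t (z - 1) - 1) * g t) by ring. rewrite Cmod_mult.
    apply Rmult_le_compat; try apply Cmod_ge_0; [now apply cpow_sub_1_bound|auto]. }
  assert (Hw0 := Cmod_ge_0 (z - 1)).
  apply Rplus_le_compat.
  - assert (D := CRInt_gen_minus _ _ _ _ _ _ A1 B1).
    assert (Hh : (0 < 1 / 2)%R) by lra.
    assert (G := is_RInt_gen_scal (V := R_NormedModule) _ (8 * M * Cmod (z - 1))%R _
       (Rpower_RInt_gen 1 (1 / 2) Rlt_0_1 Hh)).
    replace (8 * M * IL * Cmod (z - 1))%R with (8 * M * Cmod (z - 1) * IL)%R by ring.
    refine (CRInt_gen_norm_le _ _ _ _ _ _ _ D G).
    apply filter_left; [lra|]. intros t Ht.
    eapply Rle_trans; [apply Hdiff; lra|].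
    change (8 * Cmod (z - 1) * exp (Rabs (ln t) / 2) * (M * exp (- (e * t))) <=
      8 * M * Cmod (z - 1) * Rpower t (1 / 2 - 1))%R.
    assert (E1 : (exp (Rabs (ln t) / 2) = Rpower t (1 / 2 - 1))%R).
    { unfold Rpower. f_equal. rewrite Rabs_left1; [field|].
      rewrite <- ln_1. destruct (Req_dec t 1) as [->|]; [lra|left; apply ln_increasing; lra]. }
    rewrite E1.
    assert (E2 : (exp (- (e * t)) <= 1)%R).
    { rewrite <- exp_0. apply exp_le. assert (0 < e * t)%R by (apply Rmult_lt_0_compat; lra).
      lra. }
    assert (E3 : (0 < Rpower t (1 / 2 - 1))%R) by apply exp_pos.
    replace (8 * M * Cmod (z - 1) * Rpower t (1 / 2 - 1))%R with
      (8 * Cmod (z - 1) * Rpower t (1 / 2 - 1) * (M * 1))%R by ring.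
    apply Rmult_le_compat_l; [|now apply Rmult_le_compat_l].
    apply Rmult_le_pos; lra.
  - assert (D := CRInt_gen_minus _ _ _ _ _ _ A2 B2).
    assert (Hh : (0 < e / 2)%R) by lra.
    assert (G := is_RInt_gen_scal (V := R_NormedModule) _ (8 * (M * B) * Cmod (z - 1))%R _
       (exp_RInt_gen 1 (e / 2) Hh)).
    replace (8 * (M * B) * IR * Cmod (z - 1))%R with (8 * (M * B) * Cmod (z - 1) * IR)%R by ring.
    refine (CRInt_gen_norm_le _ _ _ _ _ _ _ D G).
    apply filter_right. intros t Ht.
    eapply Rle_trans; [apply Hdiff; lra|].
    change (8 * Cmod (z - 1) * exp (Rabs (ln t) / 2) * (M * exp (- (e * t))) <=
      8 * (M * B) * Cmod (z - 1) * exp (- (e / 2 * t)))%R.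
    assert (E1 : (exp (Rabs (ln t) / 2) = Rpower t (1 / 2))%R).
    { unfold Rpower. f_equal. rewrite Rabs_pos_eq; [field|].
      rewrite <- ln_1. destruct (Req_dec t 1) as [->|]; [lra|left; apply ln_increasing; lra]. }
    rewrite E1. specialize (HB t Ht).
    replace (8 * Cmod (z - 1) * Rpower t (1 / 2) * (M * exp (- (e * t))))%R with
      (8 * Cmod (z - 1) * M * (Rpower t (1 / 2) * exp (- (e * t))))%R by ring.
    replace (8 * (M * B) * Cmod (z - 1) * exp (- (e / 2 * t)))%R with
      (8 * Cmod (z - 1) * M * (B * exp (- (e / 2 * t))))%R by ring.
    apply Rmult_le_compat_l; auto. repeat apply Rmult_le_pos; lra.
Qed.

Lemma Cfilterlim_zero (E : R -> C) (G : R -> R) (F : (R -> Prop) -> Prop) {FF : Filter F} :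
  F (fun t => (Cmod (E t) <= G t)%R) -> filterlim G F (locally 0%R) ->
  filterlim E F (locally (T := C_UniformSpace) (RtoC 0)).
Proof.
  intros HE HG. apply (filterlim_locally (U := C_UniformSpace)). intros eps.
  assert (H := proj1 (filterlim_locally _ _) HG eps).
  generalize (filter_and _ _ HE H). apply filter_imp. intros t [H1 H2].
  change (Rabs (G t - 0) < eps)%R in H2. rewrite Rminus_0_r in H2.
  assert (H3 := Rle_abs (G t)).
  split.
  - change (Rabs (fst (E t) - 0) < eps)%R. rewrite Rminus_0_r.
    generalize (abs_fst_le (E t)). lra.
  - change (Rabs (snd (E t) - 0) < eps)%R. rewrite Rminus_0_r.
    generalize (abs_snd_le (E t)). lra.
Qed.

Lemma CRInt_gen_antiderivative (E dE : R -> C)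
  (Fa Fb : (R -> Prop) -> Prop) {FFa : Filter Fa} {FFb : Filter Fb} (la lb : C) :
  filter_prod Fa Fb (fun ab => (fst ab <= snd ab)%R /\
     forall t, (fst ab <= t <= snd ab)%R -> Cder E t (dE t) /\ Ccont dE t) ->
  filterlim E Fa (locally (T := C_UniformSpace) la) ->
  filterlim E Fb (locally (T := C_UniformSpace) lb) ->
  is_CRInt_gen dE Fa Fb (lb - la).
Proof.
  intros H Ha Hb.
  apply (is_RInt_gen_antiderivative C_R_CompleteNormedModule E dE); auto.
  now apply filter_swap_bounds.
Qed.

Lemma filterlim_power_exp_infty (E : R -> C) (tau e M : R) :
  (0 < e)%R ->
  (forall t, (0 < t)%R -> (Cmod (E t) <= Rpower t tau * (M * exp (- (e * t))))%R) ->
  filterlim E (Rbar_locally p_infty) (locally (T := C_UniformSpace) (RtoC 0)).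
Proof.
  intros He HE. destruct (Rpower_exp_bound 1 e tau Rlt_0_1 He) as (B & HB0 & HB).
  refine (Cfilterlim_zero E (fun t => Rabs M * B * exp (- (e / 2 * t)))%R (Rbar_locally p_infty)
    _ _).
  - exists 1%R. intros t Ht. eapply Rle_trans; [apply HE; lra|].
    specialize (HB t ltac:(lra)).
    assert (H1 := exp_pos (- (e * t))). assert (H2 : (0 < Rpower t tau)%R) by apply exp_pos.
    assert (H3 := Rle_abs M). assert (H4 := Rabs_pos M).
    apply Rle_trans with (Rabs M * (Rpower t tau * exp (- (e * t))))%R.
    + replace (Rpower t tau * (M * exp (- (e * t))))%R with (M * (Rpower t tau * exp (- (e *
        t))))%R by ring.
      apply Rmult_le_compat_r; auto. apply Rmult_le_pos; lra.
    + rewrite Rmult_assoc. apply Rmult_le_compat_l; auto.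
  - replace (locally 0%R) with (locally (Rabs M * B * 0)%R) by (f_equal; ring).
    apply (filterlim_comp _ _ _ (fun t => exp (- (e / 2 * t))) (fun y => Rabs M * B * y)%R _
      (locally 0%R)).
    + apply filterlim_exp_infty. lra.
    + apply (filterlim_Rmult_l (Rabs M * B)%R 0%R).
Qed.

Lemma Cder_exp_neg (t : R) : Cder (fun x => RtoC (exp (- x))) t (- RtoC (exp (- t))).
Proof. rewrite <- RtoC_opp. apply Cder_RtoC, is_derive_exp_neg. Qed.

Lemma exp_decay_exp : exp_decay (fun t => RtoC (exp (- t))).
Proof.
  split.
  - intros t _. eapply Cder_cont, Cder_exp_neg.
  - exists 1%R, 1%R. split; [lra|split; [lra|]]. intros t _.
    rewrite Cmod_R, Rabs_pos_eq by (left; apply exp_pos). apply Req_le.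
    rewrite Rmult_1_l. do 2 f_equal. ring.
Qed.

Lemma Gamma_int_Mellin (s : C) : Gamma_int s = Mellin (fun t => RtoC (exp (- t))) s.
Proof. reflexivity. Qed.

(** The function t^s e^(-t) tends to 0 at both ends, so the integral of its derivative s t^(s-1)
    e^(-t) - t^s e^(-t) is 0. *)
Lemma Gamma_int_S (s : C) : (0 < fst s)%R -> Gamma_int (s + 1) = s * Gamma_int s.
Proof.
  intros Hs.
  assert (H1 := Mellin_correct _ s exp_decay_exp Hs). rewrite <- Gamma_int_Mellin in H1.
  assert (Hs1 : (0 < fst (s + 1)%C)%R) by (destruct s; simpl in *; lra).
  assert (H2 := Mellin_correct _ (s + 1) exp_decay_exp Hs1). rewrite <- Gamma_int_Mellin in H2.
  assert (H3 := CRInt_gen_minus _ _ _ _ _ _ (CRInt_gen_scal s _ _ _ _ H1) H2).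
  cbv beta in H3.
  assert (H4 : is_CRInt_gen (fun t => s * (cpow t (s - 1) * RtoC (exp (- t))) - cpow t (s + 1 -
    1) * RtoC (exp (- t)))
     (at_right 0) (Rbar_locally p_infty) (0 - 0)).
  { assert (E1 : s + 1 - 1 = s) by ring. rewrite E1.
    refine (CRInt_gen_antiderivative (fun t => cpow t s * RtoC (exp (- t))) _ (at_right 0)
      (Rbar_locally p_infty) _ _ _ _ _).
    - apply filter_full. intros t Ht. split.
      + eapply Cder_val; [apply Cder_mult; [now apply Cder_cpow|apply Cder_exp_neg]|]. cbv beta.
        ring.
      + apply Ccont_plus.
        * apply Ccont_mult; [apply Ccont_const|]. apply Ccont_mult; [now apply Ccont_cpow|].
          eapply Cder_cont, Cder_exp_neg.
        * apply Ccont_opp.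
          apply Ccont_mult; [now apply Ccont_cpow|]. eapply Cder_cont, Cder_exp_neg.
    - refine (Cfilterlim_zero _ (fun t => Rpower t (fst s)) (at_right 0) _ _).
      + generalize (at_right_0_interval 1 Rlt_0_1). apply filter_imp. intros t Ht.
        rewrite Cmod_mult, Cmod_cpow, Cmod_R, Rabs_pos_eq by (left; apply exp_pos).
        assert (H := exp_neg_bounds t ltac:(lra)).
        assert (0 < Rpower t (fst s))%R by apply exp_pos. nra.
      + now apply filterlim_Rpower_0.
    - apply (filterlim_power_exp_infty _ (fst s) 1 1); [lra|]. intros t Ht.
      rewrite Cmod_mult, Cmod_cpow, Cmod_R, Rabs_pos_eq by (left; apply exp_pos).
      rewrite !Rmult_1_l. lra. }
  assert (E := CRInt_gen_unique _ _ _ _ _ H3 H4).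
  rewrite <- (Cplus_0_r (Gamma_int (s + 1))). replace (RtoC 0) with (RtoC 0 - 0) by ring.
  rewrite <- E. ring.
Qed.

Lemma Gamma_int_1 : Gamma_int 1 = 1.
Proof.
  apply (is_Mellin_unique (fun t => RtoC (exp (- t))) 1).
  - apply Mellin_correct; [apply exp_decay_exp|simpl; lra].
  - unfold is_Mellin.
    refine (CRInt_gen_ext (fun t => RtoC (exp (- t))) _ (at_right 0) (Rbar_locally p_infty) _ _
      _).
    { intros t. replace (1 - 1) with (RtoC 0) by ring.
      rewrite cpow_0. symmetry. apply Cmult_1_l. }
    apply (CRInt_gen_val _ _ _ (- RtoC 0 - (- RtoC 1))); [|ring].
    refine (CRInt_gen_antiderivative (fun t => - RtoC (exp (- t))) _ (at_right 0) (Rbar_locally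
      p_infty) _ _ _ _ _).
    + apply filter_full. intros t Ht. split.
      * eapply Cder_val; [apply Cder_opp, Cder_exp_neg|ring].
      * eapply Cder_cont, Cder_exp_neg.
    + assert (C0 : Ccont (fun t => - RtoC (exp (- t))) 0).
      { eapply Cder_cont, Cder_opp, Cder_exp_neg. }
      intros P HP. unfold continuous in C0. rewrite Ropp_0, exp_0 in C0.
      specialize (C0 P HP). apply filter_le_within. exact C0.
    + replace (- RtoC 0) with (RtoC 0) by ring.
      apply (filterlim_power_exp_infty _ 0 1 1); [lra|]. intros t Ht.
      rewrite Cmod_opp, Cmod_R, Rabs_pos_eq, Rpower_O, !Rmult_1_l by (try lra; left; apply
        exp_pos). lra.
Qed.

Lemma up_neg_to_nat (t : R) : (t < 0)%R -> Z.to_nat (up t) = 0%nat.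
Proof.
  intros Ht. destruct (archimed t) as [H1 H2].
  assert (H : (IZR (up t) < 1)%R) by lra. apply lt_IZR in H. lia.
Qed.

Lemma CGamma_pos (z : C) : (0 < fst z)%R -> CGamma z = Gamma_int z.
Proof.
  intros Hz. unfold CGamma. rewrite up_neg_to_nat by lra. simpl.
  replace (z + 0) with z by ring. field.
Qed.

(** Here Re (z - 1) > -1, so the continuation at z - 1 uses a shift of at most one: for Re z > 1 the
    recurrence of the integral applies, otherwise the definition of [CGamma] does. *)
Lemma CGamma_shift (z : C) :
  (0 < fst z)%R -> z <> 1 -> CGamma z = (z - 1) * CGamma (z - 1).
Proof.
  intros Hz Hz1.
  assert (Hn : z - 1 <> 0).
  { intros E. apply Hz1. rewrite <- (Cplus_0_r 1), <- E. ring. }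
  assert (E1 : fst (z - 1)%C = (fst z - 1)%R) by (destruct z; simpl; ring).
  rewrite (CGamma_pos z Hz).
  destruct (Rlt_dec 1 (fst z)) as [L|L].
  - rewrite CGamma_pos by (rewrite E1; lra).
    rewrite <- Gamma_int_S by (rewrite E1; lra). f_equal. ring.
  (* For 0 < Re z <= 1 the shift is exactly one, because [up] sends [0, 1) to 1; this includes the
     line Re z = 1. *)
  - unfold CGamma. rewrite E1.
    replace (Z.to_nat (up (- (fst z - 1)))) with 1%nat.
    + simpl. replace (z - 1 + 1) with z by ring. field.
      replace (z - 1 + 0) with (z - 1) by ring. auto.
    + destruct (archimed (- (fst z - 1))) as [H1 H2].
      assert (A1 : (0 < IZR (up (- (fst z - 1))))%R) by lra.
      assert (A2 : (IZR (up (- (fst z - 1))) < 2)%R) by lra.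
      apply lt_IZR in A1. apply lt_IZR in A2. lia.
Qed.

(** * The formula for W *)

Definition Lprod (q1 q2 : C) (x u : R) : C := Lfun q2 u * Lfun q1 (x * u).

(** The first summand is what J at x contributes for one pair (c, d), after t = e^(-u); the second,
    apart from a power of x, is the contribution of J at 1/x after t = e^(-xu). *)
Definition dLprod (q1 q2 : C) (x u : R) : C :=
  hfun q2 (RtoC u) * Lfun q1 (x * u)
  + RtoC x * hfun q1 (RtoC (x * u)) * Lfun q2 u.

Lemma Cder_Lfun_scale (q : C) (x u : R) :
  (fst q < 1)%R -> (0 <= x * u)%R ->
  Cder (fun u => Lfun q (x * u)) u (RtoC x * hfun q (RtoC (x * u))).
Proof.
  intros Hq Hu. apply (Cder_comp (Lfun q) (fun u => x * u)%R); [now apply Cder_Lfun|].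
  apply is_derive_linear.
Qed.

Lemma Cder_Lprod (q1 q2 : C) (x u : R) :
  (fst q1 < 1)%R -> (fst q2 < 1)%R -> (0 < x)%R -> (0 <= u)%R ->
  Cder (Lprod q1 q2 x) u (dLprod q1 q2 x u).
Proof.
  intros Hq1 Hq2 Hx Hu. unfold Lprod. eapply Cder_val.
  - apply Cder_mult; [now apply Cder_Lfun|apply Cder_Lfun_scale; auto; nra].
  - unfold dLprod. ring.
Qed.

Lemma Ccont_hfun (q : C) (u : R) :
  (fst q < 1)%R -> (0 <= u)%R -> Ccont (fun u => hfun q (RtoC u)) u.
Proof.
  intros Hq Hu.
  apply (Ccont_ext
    (fun u => q * RtoC (exp (- u)) * / (1 - q * RtoC (exp (- u))))).
  { intros t. now rewrite hfun_R. }
  apply Ccont_mult.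
  - apply Ccont_mult; [apply Ccont_const|]. eapply Cder_cont, Cder_exp_neg.
  - eapply (Ccont_inv (fun u => 1 - q * RtoC (exp (- u)))).
    + apply gap_neq_0; auto. now apply exp_neg_bounds.
    + apply Cder_minus; [apply Cder_const|]. apply Cder_scal, Cder_exp_neg.
Qed.

Lemma Ccont_hfun_scale (q : C) (x u : R) :
  (fst q < 1)%R -> (0 <= x * u)%R -> Ccont (fun u => hfun q (RtoC (x * u))) u.
Proof.
  intros Hq Hu. apply (Ccont_comp (fun u => hfun q (RtoC u)) (fun u => x * u)%R).
  - now apply Ccont_hfun.
  - apply (ex_derive_continuous (fun u => x * u)%R). eexists. apply is_derive_linear.
Qed.

Lemma Ccont_Lfun (q : C) (u : R) : (fst q < 1)%R -> (0 <= u)%R -> Ccont (Lfun q) u.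
Proof. intros. eapply Cder_cont. now apply Cder_Lfun. Qed.

Lemma Ccont_Lfun_scale (q : C) (x u : R) :
  (fst q < 1)%R -> (0 <= x * u)%R -> Ccont (fun u => Lfun q (x * u)) u.
Proof. intros. eapply Cder_cont. now apply Cder_Lfun_scale. Qed.

Lemma exp_decay_mult_bounded (f g : R -> C) (e M N : R) :
  (0 < e)%R -> (0 <= M)%R ->
  (forall t, (0 < t)%R -> Ccont f t) -> (forall t, (0 < t)%R -> Ccont g t) ->
  (forall t, (0 < t)%R -> (Cmod (f t) <= M * exp (- (e * t)))%R) ->
  (forall t, (0 < t)%R -> (Cmod (g t) <= N)%R) ->
  exp_decay (fun t => f t * g t).
Proof.
  intros He HM Cf Cg Hf Hg. split.
  { intros t Ht. apply Ccont_mult; auto. }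
  assert (HN : (0 <= N)%R) by (eapply Rle_trans; [apply Cmod_ge_0|apply (Hg 1%R); lra]).
  exists e, (M * N)%R. split; auto. split; [now apply Rmult_le_pos|]. intros t Ht.
  rewrite Cmod_mult. replace (M * N * exp (- (e * t)))%R with (M * exp (- (e * t)) * N)%R by ring.
  apply Rmult_le_compat; try apply Cmod_ge_0; auto.
Qed.

Lemma exp_decay_plus (f g : R -> C) :
  exp_decay f -> exp_decay g -> exp_decay (fun t => f t + g t).
Proof.
  intros (Cf & e & M & He & HM & Hf) (Cg & e' & M' & He' & HM' & Hg). split.
  { intros t Ht. apply Ccont_plus; auto. }
  exists (Rmin e e'), (M + M')%R.
  assert (Hm1 := Rmin_l e e'). assert (Hm2 := Rmin_r e e').
  split; [now apply Rmin_pos|]. split; [lra|]. intros t Ht.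
  apply Cmod_triangle_le. specialize (Hf t Ht). specialize (Hg t Ht).
  assert (E1 : (exp (- (e * t)) <= exp (- (Rmin e e' * t)))%R) by (apply exp_le; nra).
  assert (E2 : (exp (- (e' * t)) <= exp (- (Rmin e e' * t)))%R) by (apply exp_le; nra).
  nra.
Qed.

Lemma Cmod_Lfun_bounded (q : C) (u : R) :
  Cmod q = 1%R -> (fst q < 1)%R -> (0 <= u)%R -> (Cmod (Lfun q u) <= 2 * / gap q)%R.
Proof.
  intros Hq1 Hq Hu. eapply Rle_trans; [now apply Cmod_Lfun_le|].
  assert (H := exp_neg_bounds u Hu).
  assert (0 < / gap q)%R by now apply Rinv_0_lt_compat, gap_pos.
  nra.
Qed.

Lemma Cmod_hfun_bounded (q : C) (u : R) :
  Cmod q = 1%R -> (fst q < 1)%R -> (0 <= u)%R -> (Cmod (hfun q (RtoC u)) <= / gap q)%R.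
Proof.
  intros Hq1 Hq Hu. eapply Rle_trans; [now apply Cmod_hfun_le|].
  assert (H := exp_neg_bounds u Hu).
  assert (0 < / gap q)%R by now apply Rinv_0_lt_compat, gap_pos.
  nra.
Qed.

Lemma exp_decay_hfun_Lfun (q1 q2 : C) (x : R) :
  Cmod q1 = 1%R -> (fst q1 < 1)%R -> Cmod q2 = 1%R -> (fst q2 < 1)%R -> (0 < x)%R ->
  exp_decay (fun u => hfun q2 (RtoC u) * Lfun q1 (x * u)).
Proof.
  intros H1 H1' H2 H2' Hx. assert (Hg := gap_pos q2 H2').
  apply (exp_decay_mult_bounded _ _ 1 (/ gap q2) (2 * / gap q1)).
  - lra.
  - left. now apply Rinv_0_lt_compat.
  - intros t Ht. apply Ccont_hfun; auto; lra.
  - intros t Ht. apply Ccont_Lfun_scale; auto; nra.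
  - intros t Ht. rewrite Rmult_1_l. apply Cmod_hfun_le; auto; lra.
  - intros t Ht. apply Cmod_Lfun_bounded; auto; nra.
Qed.

Lemma exp_decay_hfun_Lfun' (q1 q2 : C) (x : R) :
  Cmod q1 = 1%R -> (fst q1 < 1)%R -> Cmod q2 = 1%R -> (fst q2 < 1)%R -> (0 < x)%R ->
  exp_decay (fun u => RtoC x * hfun q1 (RtoC (x * u)) * Lfun q2 u).
Proof.
  intros H1 H1' H2 H2' Hx. assert (Hg := gap_pos q1 H1').
  apply (exp_decay_mult_bounded _ _ x (x * / gap q1) (2 * / gap q2)); auto.
  - apply Rmult_le_pos; [lra|]. left. now apply Rinv_0_lt_compat.
  - intros t Ht. apply Ccont_mult; [apply Ccont_const|]. apply Ccont_hfun_scale; auto; nra.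
  - intros t Ht. apply Ccont_Lfun; auto; lra.
  - intros t Ht. rewrite Cmod_mult, Cmod_R, Rabs_pos_eq, Rmult_assoc by lra.
    apply Rmult_le_compat_l; [lra|]. apply Cmod_hfun_le; auto; nra.
  - intros t Ht. apply Cmod_Lfun_bounded; auto; lra.
Qed.

Lemma exp_decay_dLprod (q1 q2 : C) (x : R) :
  Cmod q1 = 1%R -> (fst q1 < 1)%R -> Cmod q2 = 1%R -> (fst q2 < 1)%R -> (0 < x)%R ->
  exp_decay (dLprod q1 q2 x).
Proof.
  intros. apply exp_decay_plus; [now apply exp_decay_hfun_Lfun|now apply exp_decay_hfun_Lfun'].
Qed.

Lemma exp_decay_Lprod (q1 q2 : C) (x : R) :
  Cmod q1 = 1%R -> (fst q1 < 1)%R -> Cmod q2 = 1%R -> (fst q2 < 1)%R -> (0 < x)%R ->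
  exp_decay (Lprod q1 q2 x).
Proof.
  intros H1 H1' H2 H2' Hx. assert (Hg := gap_pos q2 H2').
  apply (exp_decay_mult_bounded _ _ 1 (2 * / gap q2) (2 * / gap q1)).
  - lra.
  - apply Rmult_le_pos; [lra|]. left. now apply Rinv_0_lt_compat.
  - intros t Ht. apply Ccont_Lfun; auto; lra.
  - intros t Ht. apply Ccont_Lfun_scale; auto; nra.
  - intros t Ht. rewrite Rmult_1_l. apply Cmod_Lfun_le; auto; lra.
  - intros t Ht. apply Cmod_Lfun_bounded; auto; nra.
Qed.

(** * Beyond delta: integration by parts and the incomplete Gamma series *)

Lemma Mellin_right_by_parts (g dg : R -> C) (z l : C) (d e M : R) :
  (0 < d)%R -> (0 < e)%R ->
  (forall t, (0 < t)%R -> Cder g t (dg t)) -> (forall t, (0 < t)%R -> Ccont dg t) ->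
  (forall t, (0 < t)%R -> (Cmod (g t) <= M * exp (- (e * t)))%R) ->
  is_CRInt_gen (fun t => cpow t (z - 1 - 1) * g t) (at_point d) (Rbar_locally p_infty) l ->
  is_CRInt_gen (fun t => cpow t (z - 1) * dg t) (at_point d) (Rbar_locally p_infty)
    (- (cpow d (z - 1) * g d) - (z - 1) * l).
Proof.
  intros Hd He Hg Hdg HM Hl.
  assert (Hcg : forall t, (0 < t)%R -> Ccont g t) by (intros t Ht; eapply Cder_cont, Hg; auto).
  (* The integrand is the derivative of t^(z-1) g t, which tends to 0 at infinity; only the boundary
     term at d survives. *)
  assert (H : is_CRInt_gen (fun t => (z - 1) * cpow t (z - 1 - 1) * g t + cpow t (z - 1) * dg t)
     (at_point d) (Rbar_locally p_infty) (0 - cpow d (z - 1) * g d)).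
  { refine (CRInt_gen_antiderivative (fun t => cpow t (z - 1) * g t) _ (at_point d) (Rbar_locally
      p_infty) _ _ _ _ _).
    - apply filter_right. intros t Ht. split.
      + apply Cder_mult; [apply Cder_cpow; lra|apply Hg; lra].
      + assert (Ht0 : (0 < t)%R) by lra. apply Ccont_plus.
        * apply Ccont_mult; [|exact (Hcg t Ht0)].
          apply Ccont_mult; [apply Ccont_const|exact (Ccont_cpow _ t Ht0)].
        * apply Ccont_mult; [exact (Ccont_cpow _ t Ht0)|exact (Hdg t Ht0)].
    - apply (filterlim_at_point C_UniformSpace (fun t => cpow t (z - 1) * g t)).
    - apply (filterlim_power_exp_infty _ (fst (z - 1)) e M); auto. intros t Ht.
      rewrite Cmod_mult, Cmod_cpow. apply Rmult_le_compat_l; auto. left; apply exp_pos. }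
  assert (H2 := CRInt_gen_minus _ _ _ _ _ _ H (CRInt_gen_scal (z - 1) _ _ _ _ Hl)).
  eapply CRInt_gen_val.
  - refine (CRInt_gen_ext _ _ _ _ _ _ H2). intros t. cbv beta. ring.
  - ring.
Qed.

(** Replacing t by y t in the integral that defines [inc_Gamma] brings out y^(z-2) from the power
    and y from dt. *)
Lemma inc_Gamma_scale (z : C) (y d : R) :
  (0 < y)%R -> (0 < d)%R ->
  is_CRInt_gen (fun t => cpow t (z - 1 - 1) * RtoC (exp (- (y * t)))) (at_point d) (Rbar_locally
    p_infty)
    (inc_Gamma (z - 1) (y * d) / cpow y (z - 1)).
Proof.
  intros Hy Hd.
  assert (Hyd : (0 < y * d)%R) by now apply Rmult_lt_0_compat.
  destruct exp_decay_exp as (Hc & e & M & He & HM & Hb).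
  destruct (Mellin_ex_right (fun t => RtoC (exp (- t))) (z - 1 - 1) (y * d) e M Hyd He) as [l Hl].
  { intros t Ht. apply Hc; lra. }
  { intros t Ht. apply Hb; lra. }
  assert (El : inc_Gamma (z - 1) (y * d) = l).
  { exact (CRInt_gen_eq _ _ _ _ Hl). }
  rewrite El.
  assert (H := CRInt_gen_subst_scale _ y d l Hy Hd ltac:(intros t Ht; apply Ccont_mult; [now
    apply Ccont_cpow|now apply Hc]) Hl).
  cbv beta in H.
  assert (H2 := CRInt_gen_scal (/ cpow y (z - 1)) _ _ _ _ H).
  eapply CRInt_gen_val; [|exact (Cmult_comm _ _)].
  eapply (is_RInt_gen_ext (V := C_R_NormedModule)); [|exact H2].
  apply (filter_imp (F := filter_prod (at_point d) (Rbar_locally p_infty))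
    (fun ab => (fst ab <= snd ab)%R /\ forall t, (fst ab <= t <= snd ab)%R -> (0 < t)%R)).
  - intros [a b] [Hab Hpos] t Ht. cbn [fst snd] in *. rewrite Rmin_left, Rmax_right in Ht by auto.
    assert (Ht' : (a <= t <= b)%R) by (split; left; apply Ht). specialize (Hpos t Ht'). cbv beta.
    rewrite cpow_mul by auto.
    replace (cpow y (z - 1)) with (cpow y (z - 1 - 1) * RtoC y).
    + in_C.
      field. split; [apply RtoC_neq; lra|apply cpow_neq_0].
    + rewrite <- (cpow_1 y Hy), <- cpow_add. f_equal. ring.
  - apply filter_right. intros t Ht. lra.
Qed.

Lemma log_term_exp (q : C) (u : R) (n : nat) :
  log_term q (exp (- u)) n = q ^ S n * RtoC (exp (- (INR (S n) * u)) / INR (S n)).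
Proof.
  unfold log_term. do 3 f_equal.
  induction (S n) as [|m IH].
  - simpl. rewrite Rmult_0_l, Ropp_0, exp_0. reflexivity.
  - rewrite S_INR. simpl pow. rewrite IH, <- exp_plus. f_equal. ring.
Qed.

Lemma Cmod_log_term_le (q : C) (u : R) (n : nat) :
  Cmod q = 1%R -> (0 <= u)%R -> (Cmod (log_term q (exp (- u)) n) <= exp (- u))%R.
Proof.
  intros Hq Hu. unfold log_term. rewrite Cmod_mult, Cmod_pow, Hq, pow1, Rmult_1_l, Cmod_R.
  assert (He := exp_neg_bounds u Hu).
  assert (Hn : (1 <= INR (S n))%R) by (rewrite S_INR; generalize (pos_INR n); lra).
  assert (Hp : (0 <= exp (- u) ^ n <= 1)%R).
  { split; [apply pow_le; lra|]. rewrite <- (pow1 n). apply pow_incr; lra. }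
  rewrite Rabs_pos_eq.
  - apply Rle_div_l; [lra|]. simpl pow. nra.
  - apply Rdiv_le_0_compat; [apply pow_le; lra|lra].
Qed.

Lemma Ccont_log_term (q : C) (x u : R) (n : nat) :
  Ccont (fun u => log_term q (exp (- (x * u))) n) u.
Proof.
  unfold log_term. apply Ccont_mult; [apply Ccont_const|].
  eapply Cder_cont. apply Cder_RtoC.
  apply (is_derive_comp (fun y => y ^ S n / INR (S n))%R (fun u => exp (- (x * u)))).
  - apply is_derive_pow_div.
  - auto_derive; auto.
Qed.

(** [log_term] of index n is the term of degree n + 1, hence [S n] and [S m]. The product of two
    such terms has the single exponential e^(-yu) with y = (n+1) + (m+1) x. *)
Lemma W_term1_integral (r c d : nat) (z : C) (x delta : R) (n m : nat) :
  (0 < x)%R -> (0 < delta)%R -> (0 < INR r)%R ->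
  is_CRInt_gen (fun u => cpow u (z - 1 - 1) *
      (log_term (e2pi (INR d / INR r)) (exp (- u)) n * log_term (e2pi (INR c / INR r)) (exp (- (x
        * u))) m))
    (at_point delta) (Rbar_locally p_infty) (W_term1 r c d z x delta (S n) (S m)).
Proof.
  intros Hx Hd Hr.
  assert (Hn : (0 < INR (S n))%R) by (apply lt_0_INR; lia).
  assert (Hm : (0 < INR (S m))%R) by (apply lt_0_INR; lia).
  set (y := (INR (S n) + INR (S m) * x)%R).
  assert (Hy : (0 < y)%R).
  { unfold y. assert (0 < INR (S m) * x)%R by now apply Rmult_lt_0_compat. lra. }
  assert (H := CRInt_gen_scal (e2pi (INR c / INR r) ^ S m * e2pi (INR d / INR r) ^ S n * / RtoC
    (INR (S m) * INR (S n)))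
     _ _ _ _ (inc_Gamma_scale z y delta Hy Hd)).
  eapply CRInt_gen_val.
  - refine (CRInt_gen_ext _ _ _ _ _ _ H). intros u. cbv beta. rewrite !log_term_exp.
    replace (- (y * u))%R with (- (INR (S n) * u) + - (INR (S m) * (x * u)))%R by (unfold y;
      ring).
    rewrite exp_plus. unfold Rdiv. rewrite !RtoC_mult, !RtoC_inv by lra.
    in_C.
    field. split; apply RtoC_neq; lra.
  - unfold W_term1. fold y.
    assert (E : forall k a : nat, e2pi (INR (k * a) / INR r) = e2pi (INR a / INR r) ^ k).
    { intros k a. rewrite <- e2pi_INR_mul. f_equal. rewrite mult_INR. field. lra. }
    rewrite !E. rewrite !RtoC_mult.
    field. repeat split; try (apply RtoC_neq; lra). apply cpow_neq_0.
Qed.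

(** The logarithm in xu is expanded with n fixed, then the one in u. Integrable majorants exist
    because the factor left unexpanded decays: [log_term q2] like e^(-t) in the inner sum, [Lfun q1]
    like e^(-xt) in the outer one. The series represent -[Lfun], and the two signs cancel in
    [Lprod]. *)
Lemma W_term1_sum (r c d : nat) (z : C) (x delta : R) :
  let q1 := e2pi (INR c / INR r) in let q2 := e2pi (INR d / INR r) in
  (fst q1 < 1)%R -> (fst q2 < 1)%R -> (0 < x)%R -> (0 < delta)%R -> (0 < INR r)%R ->
  exists w1,
    is_CRInt_gen (fun u => cpow u (z - 1 - 1) * Lprod q1 q2 x u) (at_point delta) (Rbar_locally
      p_infty) w1 /\
    is_double_series (fun n m => W_term1 r c d z x delta (S n) (S m)) w1.
Proof.
  intros q1 q2 Hq1' Hq2' Hx Hd Hr.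
  assert (Hq1 : Cmod q1 = 1%R) by apply Cmod_e2pi.
  assert (Hq2 : Cmod q2 = 1%R) by apply Cmod_e2pi.
  assert (G1 := gap_pos q1 Hq1'). assert (G2 := gap_pos q2 Hq2').
  destruct (Rpower_exp_bound delta 1 (fst (z - 1 - 1)) Hd Rlt_0_1) as (B1 & HB1 & K1).
  destruct (Rpower_exp_bound delta x (fst (z - 1 - 1)) Hd Hx) as (B2 & HB2 & K2).
  destruct (exp_decay_Lprod q1 q2 x Hq1 Hq1' Hq2 Hq2' Hx) as (CP & e & M & He & HM & HP).
  destruct (Mellin_ex_right (Lprod q1 q2 x) (z - 1 - 1) delta e M Hd He) as [w1 Hw1].
  { intros t Ht. apply CP; lra. }
  { intros t Ht. apply HP; lra. }
  exists w1. split; auto.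
  assert (Hin : forall n, exists l, is_CRInt_gen (fun u => cpow u (z - 1 - 1) *
     (log_term q2 (exp (- u)) n * - Lfun q1 (x * u))) (at_point delta) (Rbar_locally p_infty) l).
  { intros n. apply (Mellin_ex_right _ _ _ 1 (2 * / gap q1)); auto; try lra.
    - intros t Ht. apply Ccont_mult.
      + apply (Ccont_ext (fun u => log_term q2 (exp (- (1 * u))) n)).
        { intros s. now rewrite Rmult_1_l. }
        apply Ccont_log_term.
      + apply Ccont_opp. apply Ccont_Lfun_scale; auto. nra.
    - intros t Ht. rewrite Cmod_mult, Cmod_opp, Rmult_1_l, Rmult_comm.
      apply Rmult_le_compat; try apply Cmod_ge_0.
      + apply Cmod_Lfun_bounded; auto. nra.
      + apply Cmod_log_term_le; auto. lra. }
  exists (fun n => CRInt_gen (fun u => cpow u (z - 1 - 1) *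
     (log_term q2 (exp (- u)) n * - Lfun q1 (x * u))) (at_point delta) (Rbar_locally p_infty)).
  assert (Hin' : forall n, is_CRInt_gen (fun u => cpow u (z - 1 - 1) *
     (log_term q2 (exp (- u)) n * - Lfun q1 (x * u))) (at_point delta) (Rbar_locally p_infty)
     (CRInt_gen (fun u => cpow u (z - 1 - 1) *
     (log_term q2 (exp (- u)) n * - Lfun q1 (x * u))) (at_point delta) (Rbar_locally p_infty))).
  { intros n. destruct (Hin n) as [l Hl].
    now rewrite (CRInt_gen_eq _ _ _ _ Hl). }
  split.
  - intros n.
    apply (CRInt_gen_series _ _ _ (fun t => exp (- (1 / 2 * t))) (fun N => 2 * / gap q1 * B1 /
      INR (S N))%R
      _ _ _ _ (fun m => W_term1_integral r c d z x delta n m Hx Hd Hr) (Hin' n)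
      (exp_RInt_gen delta (1 / 2) ltac:(lra))); [|apply is_lim_seq_inv_S].
    apply filter_right. intros t Ht N.
    rewrite (Csum_ext _ (fun m => (cpow t (z - 1 - 1) * log_term q2 (exp (- t)) n) * log_term q1
      (exp (- (x * t))) m))
      by (intros; unfold q1, q2; ring).
    rewrite Csum_mult_l.
    match goal with |- (Cmod ?a <= _)%R => replace a with
      (cpow t (z - 1 - 1) * log_term q2 (exp (- t)) n *
        (- Lfun q1 (x * t) - Csum (log_term q1 (exp (- (x * t)))) N)) by ring end.
    rewrite !Cmod_mult, Cmod_cpow.
    assert (P1 := Clog_partial_sum q1 (exp (- (x * t))) N Hq1 Hq1' (exp_neg_bounds (x * t)
      ltac:(nra))).
    assert (P2 := Cmod_log_term_le q2 t n Hq2 ltac:(lra)).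
    specialize (K1 t Ht). rewrite Rmult_1_l in K1.
    assert (Q : (0 < Rpower t (fst (z - 1 - 1)%C))%R) by apply exp_pos.
    assert (HI : (0 < / INR (S N))%R) by (apply Rinv_0_lt_compat, lt_0_INR; lia).
    assert (HG : (0 < / gap q1)%R) by now apply Rinv_0_lt_compat.
    replace (2 * / gap q1 * B1 / INR (S N) * exp (- (1 / 2 * t)))%R with
      ((B1 * exp (- (1 / 2 * t))) * (2 * / gap q1 / INR (S N)))%R by (unfold Rdiv; ring).
    apply Rmult_le_compat; try apply Cmod_ge_0; auto.
    + apply Rmult_le_pos; [lra|apply Cmod_ge_0].
    + eapply Rle_trans; [|exact K1]. apply Rmult_le_compat_l; lra.
  - apply (CRInt_gen_series _ _ _ (fun t => exp (- (x / 2 * t))) (fun N => 2 * / gap q2 * (B2 *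
      (2 * / gap q1)) / INR (S N))%R
      _ _ _ _ Hin' Hw1 (exp_RInt_gen delta (x / 2) ltac:(lra))); [|apply is_lim_seq_inv_S].
    apply filter_right. intros t Ht N.
    rewrite (Csum_ext _ (fun n => (cpow t (z - 1 - 1) * - Lfun q1 (x * t)) * log_term q2 (exp (-
      t)) n))
      by (intros; ring).
    rewrite Csum_mult_l. unfold Lprod.
    match goal with |- (Cmod ?a <= _)%R => replace a with
      (cpow t (z - 1 - 1) * - Lfun q1 (x * t) *
        (- Lfun q2 t - Csum (log_term q2 (exp (- t))) N)) by ring end.
    rewrite !Cmod_mult, Cmod_opp, Cmod_cpow.
    assert (P1 := Clog_partial_sum q2 (exp (- t)) N Hq2 Hq2' (exp_neg_bounds t ltac:(lra))).
    assert (P2 := Cmod_Lfun_le q1 (x * t) Hq1 Hq1' ltac:(nra)).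
    specialize (K2 t Ht).
    assert (Q : (0 < Rpower t (fst (z - 1 - 1)%C))%R) by apply exp_pos.
    assert (HG : (0 < / gap q1)%R) by now apply Rinv_0_lt_compat.
    replace (2 * / gap q2 * (B2 * (2 * / gap q1)) / INR (S N) * exp (- (x / 2 * t)))%R with
      ((B2 * exp (- (x / 2 * t)) * (2 * / gap q1)) * (2 * / gap q2 / INR (S N)))%R by (unfold
        Rdiv; ring).
    apply Rmult_le_compat; try apply Cmod_ge_0; auto.
    + apply Rmult_le_pos; [lra|apply Cmod_ge_0].
    + apply Rle_trans with (Rpower t (fst (z - 1 - 1)%C) * (2 * / gap q1 * exp (- (x * t))))%R.
      * apply Rmult_le_compat_l; lra.
      * replace (Rpower t (fst (z - 1 - 1)%C) * (2 * / gap q1 * exp (- (x * t))))%R with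
          (Rpower t (fst (z - 1 - 1)%C) * exp (- (x * t)) * (2 * / gap q1))%R by ring.
        apply Rmult_le_compat_r; lra.
Qed.

(** * Below delta: uniform Taylor expansion and termwise integration *)

Lemma power_series_uniform_tail (b : nat -> C) (f : R -> C) (rho M delta : R) :
  (0 < delta < rho)%R -> (forall v, (Cmod (b v) <= M / rho ^ v)%R) ->
  (forall t, (0 <= t <= delta)%R -> Cseries (fun v => b v * RtoC t ^ v) (f t)) ->
  exists eps, is_lim_seq eps 0 /\ forall t, (0 <= t <= delta)%R -> forall N,
    (Cmod (f t - Csum (fun v => b v * RtoC t ^ v) N)%C <= eps N)%R.
Proof.
  intros Hd Hb Hf. set (x := (delta / rho)%R).
  assert (Hx : (0 <= x < 1)%R).
  { unfold x. split; [apply Rdiv_le_0_compat; lra|apply Rlt_div_l; lra]. }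
  assert (Hgeo : is_series (fun n => M * x ^ n)%R (M * / (1 - x))%R).
  { apply (is_series_Rmult_l M).
    apply is_series_geom. rewrite Rabs_pos_eq; lra. }
  exists (fun N => M * / (1 - x) - sum_n (fun n => M * x ^ n) N)%R. split.
  - replace (Finite 0) with (Finite (M * / (1 - x) - M * / (1 - x))) by (f_equal; ring).
    apply (is_lim_seq_minus' (fun _ => M * / (1 - x))%R); [apply is_lim_seq_const|exact Hgeo].
  - intros t Ht N. rewrite Cmod_minus_sym.
    apply (Cseries_tail_bound _ (fun n => M * x ^ n)%R); auto.
    intros n. rewrite Cmod_mult, Cmod_pow, Cmod_R, Rabs_pos_eq by lra.
    unfold x, Rdiv. rewrite Rpow_mult_distr, pow_inv.
    replace (M * (delta ^ n * / rho ^ n))%R with (M / rho ^ n * delta ^ n)%R by (unfold Rdiv;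
      ring).
    apply Rmult_le_compat; [apply Cmod_ge_0|apply pow_le; lra|apply Hb|apply pow_incr; lra].
Qed.

(** The derivative of t^k, including k = 0, where the factor [INR k] cancels the truncated exponent.
    The product and chain rules for monomials are [dmon_add] and [dmon_scale]. *)
Definition dmon (k : nat) (t : R) : R := (INR k * t ^ pred k)%R.

Lemma dmon_add (u v : nat) (t : R) : dmon (u + v) t = (dmon u t * t ^ v + t ^ u * dmon v t)%R.
Proof.
  unfold dmon. rewrite plus_INR.
  destruct u as [|u]; [simpl; ring|]. destruct v as [|v].
  - rewrite !Nat.add_0_r. change (INR 0) with 0%R. simpl (t ^ 0)%R. ring.
  - generalize (INR (S u)), (INR (S v)). intros i j. cbn [pred].
    replace (pred (S u + S v))%nat with (S u + v)%nat by lia.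
    rewrite !pow_add. simpl pow. ring.
Qed.

Lemma dmon_bound (k : nat) (t delta : R) :
  (0 <= t <= delta)%R -> (0 <= dmon k t <= dmon k delta)%R.
Proof.
  intros Ht. unfold dmon. assert (Hk := pos_INR k). split.
  - apply Rmult_le_pos; auto. apply pow_le; lra.
  - apply Rmult_le_compat_l; auto. apply pow_incr; lra.
Qed.

Lemma dmon_scale (k : nat) (x t : R) : (x ^ k * dmon k t = x * dmon k (x * t))%R.
Proof.
  unfold dmon. destruct k as [|k]; simpl pred.
  - change (INR 0) with 0%R. ring.
  - rewrite Rpow_mult_distr. simpl pow. ring.
Qed.

Lemma Ccont_dmon (k : nat) (t : R) : Ccont (fun t => RtoC (dmon k t)) t.
Proof.
  eapply Cder_cont. apply Cder_RtoC. unfold dmon. apply is_derive_scal.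
  apply (is_derive_pow (fun x => x) (pred k) t 1%R). apply (is_derive_id (K := R_AbsRing)).
Qed.

Lemma Ccont_pow (k : nat) (t : R) : Ccont (fun t => RtoC (t ^ k)) t.
Proof.
  eapply Cder_cont. apply Cder_RtoC.
  apply (is_derive_pow (fun x => x) k t 1%R). apply (is_derive_id (K := R_AbsRing)).
Qed.

Lemma Csum_dmon_S (b : nat -> C) (t : R) (N : nat) :
  Csum (fun v => b v * RtoC (dmon v t)) (S N) =
  Csum (fun v => RtoC (INR (S v)) * b (S v) * RtoC t ^ v) N.
Proof.
  induction N as [|N IH].
  - rewrite Csum_S, !Csum_O. unfold dmon. simpl. rewrite !RtoC_mult. ring.
  - rewrite Csum_S, IH, (Csum_S _ N). unfold dmon. rewrite RtoC_mult, RtoC_pow. simpl pred. ring.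
Qed.

Lemma Taylor_uniform (alpha delta : R) :
  (0 < delta)%R -> (delta < 2 * PI * alpha)%R -> (delta < 2 * PI * (1 - alpha))%R ->
  exists eps, is_lim_seq eps 0 /\ forall t, (0 <= t <= delta)%R -> forall N,
    (Cmod (- Lfun (e2pi alpha) t - Csum (fun v => log_coef (e2pi alpha) v * RtoC (t ^ v)%R) N)%C
      <= eps N)%R /\
    (Cmod (- hfun (e2pi alpha) (RtoC t) - Csum (fun v => log_coef (e2pi alpha) v * RtoC (dmon v
      t)) N)%C <= eps N)%R.
Proof.
  intros Hd H1 H2. assert (HPI := PI_RGT_0).
  assert (Ha : (0 < alpha < 1)%R) by (split; nra).
  set (q := e2pi alpha).
  assert (Hq1 : Cmod q = 1%R) by apply Cmod_e2pi.
  assert (Hq : (fst q < 1)%R) by now apply fst_e2pi_lt_1.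
  set (m := Rmin (2 * PI * alpha) (2 * PI * (1 - alpha))).
  assert (Hm : (delta < m)%R) by (apply Rmin_glb_lt; auto).
  assert (Hm1 : (m <= 2 * PI * alpha)%R) by apply Rmin_l.
  assert (Hm2 : (m <= 2 * PI * (1 - alpha))%R) by apply Rmin_r.
  (* A radius strictly between delta and a bound m on the distance to the singularities, so that the
     ratio delta / rho is below 1. *)
  set (rho := ((delta + m) / 2)%R).
  assert (Hrho : (delta < rho < m)%R) by (unfold rho; lra).
  destruct (Lfun_taylor alpha rho) as (M & B1 & B2 & S1 & S2); try lra.
  fold q in B1, B2, S1, S2.
  destruct (power_series_uniform_tail _ _ rho M delta ltac:(lra) B1
    (fun t Ht => S1 t ltac:(lra))) as (e1 & L1 & T1).
  destruct (power_series_uniform_tail _ _ rho M delta ltac:(lra) B2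
    (fun t Ht => S2 t ltac:(lra))) as (e2 & L2 & T2).
  (* Differentiating the series shifts its index by one: the partial sum at N = 0 is empty of
     content, and its remainder is [hfun] itself. *)
  set (e2' := (fun N => match N with O => / gap q | S N => e2 N end)%R).
  assert (P1 : forall N, (0 <= e1 N)%R).
  { intros N. eapply Rle_trans; [apply Cmod_ge_0|apply (T1 0%R ltac:(lra) N)]. }
  assert (P2 : forall N, (0 <= e2' N)%R).
  { intros [|N]; simpl.
    - left. now apply Rinv_0_lt_compat, gap_pos.
    - eapply Rle_trans; [apply Cmod_ge_0|apply (T2 0%R ltac:(lra) N)]. }
  exists (fun N => e1 N + e2' N)%R. split.
  { replace (Finite 0) with (Finite (0 + 0)) by (f_equal; ring).
    apply (is_lim_seq_plus' e1 e2' 0 0); auto.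
    now apply is_lim_seq_incr_1. }
  intros t Ht N. split.
  - eapply Rle_trans; [|apply (Rplus_le_compat_l (e1 N) 0 (e2' N)); auto]. rewrite Rplus_0_r.
    rewrite (Csum_ext _ (fun v => log_coef q v * RtoC t ^ v)) by (intros; now rewrite RtoC_pow).
    now apply T1.
  - eapply Rle_trans; [|apply (Rplus_le_compat_r (e2' N) 0 (e1 N)); auto]. rewrite Rplus_0_l.
    destruct N as [|N].
    + rewrite Csum_O. unfold dmon. simpl.
      replace (- hfun q t - log_coef q 0 * RtoC (0 * 1)) with (- hfun q (RtoC t))
        by (rewrite Rmult_0_l; ring).
      rewrite Cmod_opp. apply Cmod_hfun_bounded; auto; lra.
    + rewrite Csum_dmon_S. now apply T2.
Qed.

(** For k >= 1 the exponent k + z - 1 has positive real part and the antiderivative vanishes at 0.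
    For k = 0 this may fail, but integrand and value are both 0. *)
Lemma cpow_dmon_integral (z : C) (k : nat) (delta : R) :
  (0 < fst z)%R -> (0 < delta)%R ->
  is_CRInt_gen (fun t => cpow t (z - 1) * RtoC (dmon k t)) (at_right 0) (at_point delta)
    (RtoC (INR k) * cpow delta (RtoC (INR k) + z - 1) / (RtoC (INR k) + z - 1)).
Proof.
  intros Hz Hd. destruct k as [|k].
  - refine (CRInt_gen_ext (fun _ => RtoC 0) _ (at_right 0) (at_point delta) _ _ _).
    { intros t. unfold dmon. simpl. rewrite Rmult_0_l. ring. }
    apply (CRInt_gen_val _ _ _ (0 - 0)).
    2: { simpl INR. unfold Cdiv. ring. }
    refine (CRInt_gen_antiderivative (fun _ => RtoC 0) _ (at_right 0) (at_point delta) _ _ _ _ _).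
    + apply filter_left; auto. intros t Ht. split; [apply Cder_const|apply Ccont_const].
    + apply filterlim_const.
    + apply (filterlim_at_point C_UniformSpace (fun _ => RtoC 0)).
  - set (s := RtoC (INR (S k)) + z - 1).
    assert (Hs : (0 < fst s)%R).
    { unfold s. rewrite S_INR. generalize (pos_INR k). destruct z; simpl in *. lra. }
    assert (Hs0 : s <> 0) by (intros E; rewrite E in Hs; simpl in Hs; lra).
    apply (CRInt_gen_val _ _ _ (RtoC (INR (S k)) / s * cpow delta s - 0)).
    2: { unfold Cdiv. ring. }
    refine (CRInt_gen_antiderivative (fun t => RtoC (INR (S k)) / s * cpow t s) _ (at_right 0)
      (at_point delta) _ _ _ _ _).
    + apply filter_left; auto. intros t Ht. split.
      * eapply Cder_val; [apply Cder_scal, Cder_cpow; lra|].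
        unfold dmon. simpl pred. rewrite RtoC_mult, <- (cpow_INR t k) by lra.
        replace (s - 1) with ((z - 1) + RtoC (INR k)) by (unfold s; rewrite S_INR, RtoC_plus;
          ring).
        rewrite cpow_add. field. exact Hs0.
      * apply Ccont_mult; [apply Ccont_cpow; lra|apply Ccont_dmon].
    + refine (Cfilterlim_zero _ (fun t => Cmod (RtoC (INR (S k)) / s) * Rpower t (fst s))%R
        (at_right 0) _ _).
      * apply filter_forall. intros t. rewrite Cmod_mult, Cmod_cpow. lra.
      * replace (locally 0%R) with (locally (Cmod (RtoC (INR (S k)) / s) * 0)%R) by (f_equal;
          ring).
        apply (filterlim_comp _ _ _ (fun t => Rpower t (fst s)) (fun y => Cmod (RtoC (INR (S k))
          / s) * y)%R _ (locally 0%R)).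
        -- now apply filterlim_Rpower_0.
        -- apply (filterlim_Rmult_l (Cmod (RtoC (INR (S k)) / s)) 0%R).
    + apply (filterlim_at_point C_UniformSpace (fun t => RtoC (INR (S k)) / s * cpow t s)).
Qed.

(** The identity 1/(k+z-1) = (1 - k/(k+z-1)) / (z-1) with k = u + v. The part with 1 factors into
    one Taylor term for each logarithm at delta; the part with k/(k+z-1) is a
    [cpow_dmon_integral]. *)
Lemma W_term2_decomposition (r c d : nat) (z : C) (x delta : R) (u v : nat) :
  let q1 := e2pi (INR c / INR r) in let q2 := e2pi (INR d / INR r) in
  1 - q1 <> 0 -> 1 - q2 <> 0 -> (0 < fst z)%R -> z <> 1 -> (0 < delta)%R ->
  W_term2 r c d z x delta u v =
  / (z - 1) * (log_coef q1 u * RtoC (x ^ u) * RtoC (delta ^ u) * cpow delta (z - 1) * (log_coef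
    q2 v * RtoC (delta ^ v))
     - log_coef q1 u * RtoC (x ^ u) * log_coef q2 v *
       (RtoC (INR (u + v)) * cpow delta (RtoC (INR (u + v)) + z - 1) / (RtoC (INR (u + v)) + z -
         1))).
Proof.
  intros q1 q2 Hq1 Hq2 Hz Hz1 Hd.
  assert (Hz1' : z - 1 <> 0).
  { intros E. apply Hz1. rewrite <- (Cplus_0_r 1), <- E. ring. }
  set (s := RtoC (INR (u + v)) + z - 1).
  assert (Hs : s <> 0).
  { unfold s. destruct (u + v)%nat as [|k].
    - simpl. replace (0 + z - 1) with (z - 1) by ring. auto.
    - intros E. assert (E' := f_equal fst E). revert E'.
      rewrite S_INR. generalize (pos_INR k). destruct z; simpl in *. lra. }
  unfold W_term2. rewrite !periodic_zeta_eq by auto. fold q1 q2 s. unfold log_coef.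
  assert (Es : cpow delta s = RtoC (delta ^ u) * RtoC (delta ^ v) * cpow delta (z - 1)).
  { unfold s. replace (RtoC (INR (u + v)) + z - 1) with (RtoC (INR (u + v)) + (z - 1)) by ring.
    rewrite cpow_add, cpow_INR, pow_add, RtoC_mult by auto. reflexivity. }
  rewrite Es.
  assert (Fu := INR_fact_neq_0 u). assert (Fv := INR_fact_neq_0 v).
  rewrite pow_add. unfold Rdiv. rewrite !RtoC_mult, !RtoC_inv by auto.
  assert (EI : RtoC (INR (u + v)) = s - (z - 1)) by (unfold s; ring).
  rewrite EI. field. repeat split; auto; now apply RtoC_neq.
Qed.

(** Both remainders are uniform on [0, delta], so t^(Re z - 1) is an integrable weight for the inner
    sum over v and for the outer sum over u alike. *)
Lemma W_term2_sum (r c d : nat) (z : C) (x delta : R) :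
  let a1 := (INR c / INR r)%R in let a2 := (INR d / INR r)%R in
  (0 < fst z)%R -> z <> 1 -> (0 < x)%R -> (0 < delta)%R ->
  (x * delta < 2 * PI * a1)%R -> (x * delta < 2 * PI * (1 - a1))%R ->
  (delta < 2 * PI * a2)%R -> (delta < 2 * PI * (1 - a2))%R ->
  exists IL,
    is_CRInt_gen (fun t => cpow t (z - 1) * dLprod (e2pi a1) (e2pi a2) x t) (at_right 0)
      (at_point delta) IL /\
    is_double_series (W_term2 r c d z x delta)
      (/ (z - 1) * (cpow delta (z - 1) * Lprod (e2pi a1) (e2pi a2) x delta - IL)).
Proof.
  intros a1 a2 Hz Hz1 Hx Hd H1 H1' H2 H2'. assert (HPI := PI_RGT_0).
  assert (Hxd : (0 < x * delta)%R) by now apply Rmult_lt_0_compat.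
  assert (Ha1 : (0 < a1 < 1)%R) by (split; nra).
  assert (Ha2 : (0 < a2 < 1)%R) by (split; nra).
  destruct (Taylor_uniform a1 (x * delta) Hxd H1 H1') as (e1 & L1 & T1).
  destruct (Taylor_uniform a2 delta Hd H2 H2') as (e2 & L2 & T2).
  set (q1 := e2pi a1) in *. set (q2 := e2pi a2) in *.
  assert (Hq1 : Cmod q1 = 1%R) by apply Cmod_e2pi.
  assert (Hq2 : Cmod q2 = 1%R) by apply Cmod_e2pi.
  assert (Hq1' : (fst q1 < 1)%R) by now apply fst_e2pi_lt_1.
  assert (Hq2' : (fst q2 < 1)%R) by now apply fst_e2pi_lt_1.
  assert (Hn1 : 1 - q1 <> 0).
  { replace (1 - q1) with (1 - q1 * RtoC 1) by ring. apply gap_neq_0; auto; lra. }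
  assert (Hn2 : 1 - q2 <> 0).
  { replace (1 - q2) with (1 - q2 * RtoC 1) by ring. apply gap_neq_0; auto; lra. }
  assert (G1 := gap_pos q1 Hq1'). assert (G2 := gap_pos q2 Hq2').
  assert (I1 : (0 < / gap q1)%R) by now apply Rinv_0_lt_compat.
  assert (I2 : (0 < / gap q2)%R) by now apply Rinv_0_lt_compat.
  assert (Efz : fst (z - 1)%C = (fst z - 1)%R) by (destruct z; simpl; ring).
  set (A := fun u => log_coef q1 u * RtoC (x ^ u)).
  (* The derivative of A u t^u times -[Lfun q2 t]: one Taylor term of the logarithm in xt, the other
     logarithm left whole. Summed over u it gives [dLprod]. *)
  set (F := fun u t => A u * (RtoC (dmon u t) * - Lfun q2 t + RtoC (t ^ u) * - hfun q2 (RtoC t))).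
  assert (Hex : forall u, exists l, is_CRInt_gen (fun t => cpow t (z - 1) * F u t) (at_right 0)
    (at_point delta) l).
  { intros u. apply (Mellin_ex_left (F u) z delta
      (Cmod (A u) * (dmon u delta * (2 * / gap q2) + delta ^ u * / gap q2))%R); auto.
    - intros t Ht. apply Ccont_mult; [apply Ccont_const|]. apply Ccont_plus; apply Ccont_mult.
      + apply Ccont_dmon.
      + apply Ccont_opp. apply Ccont_Lfun; auto; lra.
      + apply Ccont_pow.
      + apply Ccont_opp. apply Ccont_hfun; auto; lra.
    - intros t Ht. unfold F. rewrite Cmod_mult. apply Rmult_le_compat_l; [apply Cmod_ge_0|].
      apply Cmod_triangle_le. rewrite !Cmod_mult, !Cmod_opp, !Cmod_R.
      assert (D := dmon_bound u t delta ltac:(lra)).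
      assert (D' : (0 <= t ^ u <= delta ^ u)%R) by (split; [apply pow_le; lra|apply pow_incr;
        lra]).
      rewrite !Rabs_pos_eq by lra.
      apply Rplus_le_compat; apply Rmult_le_compat; try apply Cmod_ge_0; try lra.
      + apply Cmod_Lfun_bounded; auto; lra.
      + apply Cmod_hfun_bounded; auto; lra. }
  set (I := fun u => CRInt_gen (fun t => cpow t (z - 1) * F u t) (at_right 0) (at_point delta) :
    C).
  assert (HI : forall u, is_CRInt_gen (fun t => cpow t (z - 1) * F u t) (at_right 0) (at_point
    delta) (I u)).
  { intros u. destruct (Hex u) as [l Hl]. unfold I.
    rewrite (CRInt_gen_eq _ _ _ _ Hl). exact Hl. }
  destruct (exp_decay_dLprod q1 q2 x Hq1 Hq1' Hq2 Hq2' Hx) as (CP & _).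
  destruct (Mellin_split (dLprod q1 q2 x) z delta (exp_decay_dLprod q1 q2 x Hq1 Hq1' Hq2 Hq2' Hx)
    Hz Hd)
    as (IL & l2 & HIL & _ & _).
  exists IL. split; [exact HIL|].
  assert (HG := Rpower_RInt_gen delta (fst z) Hd Hz).
  assert (Sin : forall u, Cseries (fun v => A u * log_coef q2 v *
     (RtoC (INR (u + v)) * cpow delta (RtoC (INR (u + v)) + z - 1) / (RtoC (INR (u + v)) + z -
       1))) (I u)).
  { intros u.
    refine (CRInt_gen_series _ (fun v t => A u * log_coef q2 v * (cpow t (z - 1) * RtoC (dmon (u
      + v) t)))
      _ _ (fun N => Cmod (A u) * (dmon u delta + delta ^ u) * e2 N)%R
      _ _ _ _ _ (HI u) HG _ _).
    - intros v. apply CRInt_gen_scal; [typeclasses eauto|typeclasses eauto|].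
      exact (cpow_dmon_integral z (u + v) delta Hz Hd).
    - apply filter_left; auto. intros t Ht N.
      rewrite (Csum_ext _ (fun v => (cpow t (z - 1) * A u * RtoC (dmon u t)) * (log_coef q2 v *
        RtoC (t ^ v))
         + (cpow t (z - 1) * A u * RtoC (t ^ u)) * (log_coef q2 v * RtoC (dmon v t)))).
      2: { intros v _. rewrite dmon_add, RtoC_plus, !RtoC_mult. ring. }
      rewrite Csum_plus, !Csum_mult_l. unfold F.
      destruct (T2 t ltac:(lra) N) as [Ta Tb].
      match goal with |- (Cmod ?a <= _)%R => replace a with
        (cpow t (z - 1) * A u *
          (RtoC (dmon u t) * (- Lfun q2 t - Csum (fun v => log_coef q2 v * RtoC (t ^ v)) N)
           + RtoC (t ^ u) * (- hfun q2 (RtoC t) - Csum (fun v => log_coef q2 v * RtoC (dmon v t))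
               N))) by ring end.
      rewrite !Cmod_mult, Cmod_cpow, Efz.
      assert (D := dmon_bound u t delta ltac:(lra)).
      assert (D' : (0 <= t ^ u <= delta ^ u)%R) by (split; [apply pow_le; lra|apply pow_incr;
        lra]).
      replace (Cmod (A u) * (dmon u delta + delta ^ u) * e2 N * Rpower t (fst z - 1))%R with
        (Rpower t (fst z - 1) * Cmod (A u) * ((dmon u delta + delta ^ u) * e2 N))%R by ring.
      apply Rmult_le_compat_l.
      { apply Rmult_le_pos; [left; apply exp_pos|apply Cmod_ge_0]. }
      apply Cmod_triangle_le.
      rewrite !Cmod_mult, !Cmod_R, !Rabs_pos_eq, Rmult_plus_distr_r by lra.
      apply Rplus_le_compat; apply Rmult_le_compat; try apply Cmod_ge_0; lra.
    - replace (Finite 0) with (Rbar_mult (Cmod (A u) * (dmon u delta + delta ^ u))%R (Finite 0))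
        by (simpl; f_equal; ring).
      now apply is_lim_seq_scal_l. }
  assert (Sout : Cseries I IL).
  { refine (CRInt_gen_series _ (fun u t => cpow t (z - 1) * F u t)
      _ _ (fun N => (x * (2 * / gap q2) + / gap q2) * e1 N)%R
      _ _ _ _ HI HIL HG _ _).
    - apply filter_left; auto. intros t Ht N.
      assert (Hxt : (0 <= x * t <= x * delta)%R) by nra.
      rewrite (Csum_ext _ (fun u => (cpow t (z - 1) * RtoC x * - Lfun q2 t) * (log_coef q1 u *
        RtoC (dmon u (x * t)))
         + (cpow t (z - 1) * - hfun q2 (RtoC t)) * (log_coef q1 u * RtoC ((x * t) ^ u)))).
      2: { intros u _. unfold F, A.
           assert (E := f_equal RtoC (dmon_scale u x t)). rewrite !RtoC_mult in E.
           rewrite Rpow_mult_distr, RtoC_mult.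
           replace (cpow t (z - 1) * RtoC x * - Lfun q2 t * (log_coef q1 u * RtoC (dmon u (x *
             t)))) with
             (cpow t (z - 1) * - Lfun q2 t * log_coef q1 u * (RtoC x * RtoC (dmon u (x * t)))) by
               ring.
           rewrite <- E. ring. }
      rewrite Csum_plus, !Csum_mult_l. unfold dLprod.
      destruct (T1 (x * t)%R Hxt N) as [Ta Tb].
      match goal with |- (Cmod ?a <= _)%R => replace a with
        (cpow t (z - 1) *
          (RtoC x * - Lfun q2 t * (- hfun q1 (RtoC (x * t)) - Csum (fun v => log_coef q1 v * RtoC
            (dmon v (x * t))) N)
           + - hfun q2 (RtoC t) * (- Lfun q1 (x * t) - Csum (fun v => log_coef q1 v * RtoC ((x *
               t) ^ v)) N))) by ring end.
      rewrite Cmod_mult, Cmod_cpow, Efz, Rmult_comm.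
      apply Rmult_le_compat_r; [left; apply exp_pos|].
      apply Cmod_triangle_le.
      rewrite !Cmod_mult, !Cmod_opp, Cmod_R, Rabs_pos_eq, Rmult_plus_distr_r by lra.
      apply Rplus_le_compat; apply Rmult_le_compat; try apply Cmod_ge_0; auto.
      + apply Rmult_le_pos; [lra|apply Cmod_ge_0].
      + apply Rmult_le_compat_l; [lra|]. apply Cmod_Lfun_bounded; auto; lra.
      + apply Cmod_hfun_bounded; auto; lra.
    - replace (Finite 0) with (Rbar_mult (x * (2 * / gap q2) + / gap q2)%R (Finite 0)) by (simpl;
        f_equal; ring).
      now apply is_lim_seq_scal_l. }
  assert (Hz1' : z - 1 <> 0).
  { intros E. apply Hz1. rewrite <- (Cplus_0_r 1), <- E. ring. }
  assert (Hb : Cseries (fun v => log_coef q2 v * RtoC (delta ^ v)) (- Lfun q2 delta)).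
  { apply (Cseries_of_bound _ _ e2); auto. intros n. rewrite Cmod_minus_sym. apply T2. lra. }
  assert (Ha : Cseries (fun u => log_coef q1 u * RtoC ((x * delta) ^ u)) (- Lfun q1 (x * delta))).
  { apply (Cseries_of_bound _ _ e1); auto. intros n. rewrite Cmod_minus_sym. apply T1. lra. }
  (* The sum over v restores the logarithm in t: as its value at delta in the boundary part, and
     inside the integral [I u] in the other. *)
  exists (fun u => / (z - 1) * (A u * RtoC (delta ^ u) * cpow delta (z - 1) * - Lfun q2 delta - I
    u)). split.
  - intros u.
    eapply Cseries_ext.
    2: { apply Cseries_mult_l. apply Cseries_minus; [apply Cseries_mult_l; exact Hb|apply Sin]. }
    intros v. cbv beta. rewrite W_term2_decomposition by auto. fold a1 a2 q1 q2. reflexivity.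
  - eapply Cseries_val.
    + eapply Cseries_ext.
      2: { apply (Cseries_mult_l (/ (z - 1))). apply Cseries_minus; [|exact Sout].
           apply (Cseries_mult_l (cpow delta (z - 1) * - Lfun q2 delta)). exact Ha. }
      intros u. cbv beta. unfold A. rewrite Rpow_mult_distr, RtoC_mult. ring.
    + unfold Lprod. ring.
Qed.

(** With b = delta^(z-1) [Lprod] at delta, the series add up to w1 + (b - IL)/(z-1), while the
    Mellin integral is IL - b - (z-1) w1. Their ratio is -1/(z-1), and (z-1) Gamma(z-1) =
    Gamma(z). *)
Lemma is_W_formula_Mellin (r c d : nat) (z : C) (x delta : R) :
  let a1 := (INR c / INR r)%R in let a2 := (INR d / INR r)%R in
  (0 < INR r)%R ->
  (0 < fst z)%R -> z <> 1 -> (0 < x)%R -> (0 < delta)%R ->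
  (x * delta < 2 * PI * a1)%R -> (x * delta < 2 * PI * (1 - a1))%R ->
  (delta < 2 * PI * a2)%R -> (delta < 2 * PI * (1 - a2))%R ->
  is_W_formula r c d z x delta (- (/ CGamma z * Mellin (dLprod (e2pi a1) (e2pi a2) x) z)).
Proof.
  intros a1 a2 Hr Hz Hz1 Hx Hd H1 H1' H2 H2'. assert (HPI := PI_RGT_0).
  assert (Hxd : (0 < x * delta)%R) by now apply Rmult_lt_0_compat.
  assert (Ha1 : (0 < a1 < 1)%R) by (split; nra).
  assert (Ha2 : (0 < a2 < 1)%R) by (split; nra).
  destruct (W_term2_sum r c d z x delta Hz Hz1 Hx Hd H1 H1' H2 H2') as (IL & HIL & HW2).
  fold a1 a2 in HIL, HW2.
  destruct (W_term1_sum r c d z x delta (fst_e2pi_lt_1 _ Ha1) (fst_e2pi_lt_1 _ Ha2) Hx Hd Hr) as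
    (w1 & Hw1 & HW1).
  fold a1 a2 in Hw1.
  assert (Hq1 : Cmod (e2pi a1) = 1%R) by apply Cmod_e2pi.
  assert (Hq2 : Cmod (e2pi a2) = 1%R) by apply Cmod_e2pi.
  assert (Hq1' := fst_e2pi_lt_1 _ Ha1). assert (Hq2' := fst_e2pi_lt_1 _ Ha2).
  set (q1 := e2pi a1) in *. set (q2 := e2pi a2) in *.
  destruct (exp_decay_Lprod q1 q2 x Hq1 Hq1' Hq2 Hq2' Hx) as (CP & e & M & He & HM & HP).
  destruct (exp_decay_dLprod q1 q2 x Hq1 Hq1' Hq2 Hq2' Hx) as (CdP & _).
  assert (HD : forall t, (0 < t)%R -> Cder (Lprod q1 q2 x) t (dLprod q1 q2 x t)).
  { intros t Ht. apply Cder_Lprod; auto; lra. }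
  assert (HR := Mellin_right_by_parts _ _ z w1 delta e M Hd He HD CdP HP Hw1).
  assert (Hfull := CRInt_gen_Chasles _ delta _ _ HIL HR).
  assert (E := Mellin_eq _ _ _ Hfull). rewrite E.
  exists w1, (/ (z - 1) * (cpow delta (z - 1) * Lprod q1 q2 x delta - IL)).
  split; [exact HW1|]. split; [exact HW2|].
  assert (Hz1' : z - 1 <> 0).
  { intros E'. apply Hz1. rewrite <- (Cplus_0_r 1), <- E'. ring. }
  rewrite (CGamma_shift z Hz Hz1), Cinv_mul.
  generalize (/ CGamma (z - 1)); intros g. field. exact Hz1'.
Qed.

(** * The integral J *)

Definition csum1 (f : nat -> C) (n : nat) : C := sum_n_m (G := C_AbelianMonoid) f 1 n.

Lemma csum1_0 (f : nat -> C) : csum1 f 0 = 0.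
Proof. apply (sum_n_m_zero (G := C_AbelianMonoid)). lia. Qed.

Lemma csum1_S (f : nat -> C) (n : nat) : csum1 f (S n) = csum1 f n + f (S n).
Proof. apply (sum_n_Sm (G := C_AbelianMonoid)). lia. Qed.

Lemma csum1_ext (f g : nat -> C) (n : nat) :
  (forall k, (1 <= k <= n)%nat -> f k = g k) -> csum1 f n = csum1 g n.
Proof. intros H. apply (sum_n_m_ext_loc (G := C_AbelianMonoid)). exact H. Qed.

Lemma csum1_mult_l (c : C) (f : nat -> C) (n : nat) : csum1 (fun k => c * f k) n = c * csum1 f n.
Proof. induction n as [|n IH]; [rewrite !csum1_0|rewrite !csum1_S, IH]; ring. Qed.

Lemma csum1_plus (f g : nat -> C) (n : nat) :
  csum1 (fun k => f k + g k) n = csum1 f n + csum1 g n.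
Proof. induction n as [|n IH]; [rewrite !csum1_0|rewrite !csum1_S, IH]; ring. Qed.

Lemma csum1_swap (f : nat -> nat -> C) (n m : nat) :
  csum1 (fun i => csum1 (f i) m) n = csum1 (fun j => csum1 (fun i => f i j) n) m.
Proof.
  induction n as [|n IH].
  - rewrite csum1_0. induction m as [|m IH]; [now rewrite csum1_0|].
    rewrite csum1_S, <- IH, csum1_0. ring.
  - rewrite csum1_S, IH, <- csum1_plus. apply csum1_ext. intros k _. now rewrite csum1_S.
Qed.

Lemma csum1_prod (f g : nat -> C) (n m : nat) :
  csum1 f n * csum1 g m = csum1 (fun i => csum1 (fun j => f i * g j) m) n.
Proof.
  rewrite Cmult_comm, <- csum1_mult_l. apply csum1_ext. intros k _.
  rewrite csum1_mult_l. ring.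
Qed.

Lemma csum1_geom (w : C) (n : nat) :
  1 - w <> 0 -> csum1 (fun l => w ^ l) n = w * (1 - w ^ n) / (1 - w).
Proof.
  intros Hw. induction n as [|n IH]; [rewrite csum1_0|rewrite csum1_S, IH]; simpl; field; auto.
Qed.

Lemma CRInt_gen_csum1 (f : nat -> R -> C) (I : nat -> C) (n : nat)
  (Fa Fb : (R -> Prop) -> Prop) {FFa : Filter Fa} {FFb : Filter Fb} :
  (forall k, (1 <= k <= S n)%nat -> is_CRInt_gen (f k) Fa Fb (I k)) ->
  is_CRInt_gen (fun t => csum1 (fun k => f k t) (S n)) Fa Fb (csum1 I (S n)).
Proof.
  induction n as [|n IH]; intros H.
  - apply (CRInt_gen_val _ _ _ (I 1%nat)).
    2: { rewrite csum1_S, csum1_0. ring. }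
    refine (CRInt_gen_ext (f 1%nat) _ Fa Fb _ _ (H 1%nat _)); [|lia].
    intros t. rewrite csum1_S, csum1_0. ring.
  - rewrite csum1_S.
    refine (CRInt_gen_ext (fun t => csum1 (fun k => f k t) (S n) + f (S (S n)) t) _ Fa Fb _ _ _).
    { intros t. now rewrite (csum1_S _ (S n)). }
    assert (H1 : is_CRInt_gen (fun t => csum1 (fun k => f k t) (S n)) Fa Fb (csum1 I (S n))).
    { apply IH. intros k Hk. apply H. lia. }
    exact (CRInt_gen_plus _ _ Fa Fb _ _ H1 (H (S (S n)) ltac:(lia))).
Qed.

Lemma Ccont_csum1 (f : nat -> R -> C) (n : nat) (t : R) :
  (forall k, (1 <= k <= n)%nat -> Ccont (f k) t) -> Ccont (fun t => csum1 (fun k => f k t) n) t.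
Proof.
  induction n as [|n IH]; intros H.
  - apply (Ccont_ext (fun _ => RtoC 0)).
    { intros s. now rewrite csum1_0. }
    apply Ccont_const.
  - apply (Ccont_ext (fun t => csum1 (fun k => f k t) n + f (S n) t)).
    { intros s. now rewrite csum1_S. }
    apply Ccont_plus; [apply IH; intros; apply H; lia|apply H; lia].
Qed.

Lemma dirichlet_character_modulus (r : nat) (chi : Z -> C) :
  (1 < r)%nat -> dirichlet_character r chi -> chi (Z.of_nat r) = 0.
Proof.
  intros Hr H. destruct (Ceq_dec (chi (Z.of_nat r)) 0) as [|Hn]; auto. exfalso.
  apply (dirichlet_support _ _ H) in Hn. rewrite Z.gcd_diag in Hn. lia.
Qed.

Lemma e2pi_INR (n : nat) : e2pi (INR n) = 1.
Proof.
  replace (INR n) with (INR n * 1)%R by ring. rewrite e2pi_INR_mul.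
  replace (e2pi 1) with (RtoC 1); [apply Cpow_1_l|].
  unfold e2pi, Cexp, RtoC, Cmult; simpl. rewrite Rmult_1_r, exp_0, cos_2PI, sin_2PI.
  f_equal; ring.
Qed.

Definition rootu (r j : nat) : C := e2pi (INR j / INR r).

(** After exchanging the two sums, each j contributes a geometric sum in zeta^j t of length r. As
    zeta^(jr) = 1, all of them share the factor 1 - t^r, which cancels the denominator in J. *)
Lemma gauss_sum_series (r : nat) (chi : Z -> C) (t : R) :
  (1 < r)%nat -> (0 < t < 1)%R ->
  csum1 (fun l => gauss_sum r l chi * RtoC (t ^ l)) r =
  RtoC (1 - t ^ r) * csum1 (fun j => chi (Z.of_nat j) * (rootu r j * RtoC t * / (1 - rootu r j *
    RtoC t))) r.
Proof.
  intros Hr Ht. assert (Hr0 : INR r <> 0%R) by (apply not_0_INR; lia).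
  rewrite (csum1_ext _ (fun l => csum1 (fun j => chi (Z.of_nat j) * (rootu r j * RtoC t) ^ l) r)).
  2: { intros l _. unfold gauss_sum.
       change (sum_n_m (G := C_AbelianMonoid) ?f 1 r) with (csum1 f r).
       rewrite Cmult_comm, <- csum1_mult_l. apply csum1_ext. intros j _.
       unfold rootu. rewrite Cpow_mult_l, <- e2pi_INR_mul, RtoC_pow.
       replace (INR (j * l) / INR r)%R with (INR l * (INR j / INR r))%R by (rewrite mult_INR;
         field; auto).
       ring. }
  rewrite csum1_swap, <- csum1_mult_l. apply csum1_ext. intros j _.
  rewrite csum1_mult_l.
  assert (Hn : 1 - rootu r j * RtoC t <> 0).
  { intros E. assert (H := Cmod_one_minus (rootu r j * RtoC t)).
    rewrite E, Cmod_0, Cmod_mult, Cmod_R, Rabs_pos_eq in H by lra.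
    unfold rootu in H. rewrite Cmod_e2pi in H. lra. }
  rewrite csum1_geom by auto.
  assert (Ep : (rootu r j * RtoC t) ^ r = RtoC (t ^ r)).
  { unfold rootu. rewrite Cpow_mult_l, <- e2pi_INR_mul, <- RtoC_pow.
    replace (INR r * (INR j / INR r))%R with (INR j) by (field; auto). rewrite e2pi_INR. ring. }
  rewrite Ep, RtoC_minus. field. auto.
Qed.

(** With t = e^(-u) the logarithm of 1/t is u, and the factor e^(-u) from dt cancels 1/t. The index
    r leaves both sums because the characters vanish there; it would contribute the root 1, whose
    logarithm is singular at u = 0. *)
Lemma J_integrand_exp (r : nat) (chi1 chi2 : Z -> C) (z : C) (x u : R) :
  (1 < r)%nat -> chi1 (Z.of_nat r) = 0 -> chi2 (Z.of_nat r) = 0 -> (0 < u)%R ->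
  RtoC (exp (- u)) * J_integrand r chi1 chi2 z x (exp (- u)) =
  cpow u (z - 1) *
  (csum1 (fun d => chi2 (Z.of_nat d) * hfun (rootu r d) (RtoC u)) (r - 1) *
   csum1 (fun c => chi1 (Z.of_nat c) * Lfun (rootu r c) (x * u)) (r - 1)).
Proof.
  intros Hr H1 H2 Hu.
  assert (Ht : (0 < exp (- u) < 1)%R).
  { split; [apply exp_pos|]. rewrite <- exp_0. apply exp_increasing. lra. }
  unfold J_integrand.
  change (sum_n_m (G := C_AbelianMonoid) ?f 1 r) with (csum1 f r).
  rewrite gauss_sum_series by auto.
  replace (1 / exp (- u))%R with (exp u) by (rewrite exp_Ropp; field; generalize (exp_pos u);
    lra).
  rewrite ln_exp.
  assert (Hpr : (exp (- u) ^ r < 1)%R).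
  { destruct r as [|r]; [lia|]. simpl.
    assert (0 <= exp (- u) ^ r <= 1)%R; [|nra].
    split; [apply pow_le; lra|]. rewrite <- (pow1 r). apply pow_incr; lra. }
  assert (Es : forall f : nat -> C, f r = 0 -> csum1 f r = csum1 f (r - 1)).
  { intros f Hf. replace r with (S (r - 1)) at 1 by lia. rewrite csum1_S.
    replace (S (r - 1)) with r by lia. rewrite Hf. ring. }
  rewrite !Es by (rewrite ?H1, ?H2; ring).
  rewrite (csum1_ext _ (fun d => chi2 (Z.of_nat d) * hfun (rootu r d) (RtoC u))).
  2: { intros d _. now rewrite hfun_R. }
  rewrite (csum1_ext (fun j => chi1 (Z.of_nat j) * Clog (1 - e2pi (INR j / INR r) * RtoC (Rpower
    (exp (- u)) x)))
     (fun c => chi1 (Z.of_nat c) * Lfun (rootu r c) (x * u))).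
  2: { intros c _. unfold Lfun, Rpower, rootu. rewrite ln_exp. do 6 f_equal. ring. }
  generalize (csum1 (fun d => chi2 (Z.of_nat d) * hfun (rootu r d) (RtoC u)) (r - 1)).
  generalize (csum1 (fun c => chi1 (Z.of_nat c) * Lfun (rootu r c) (x * u)) (r - 1)).
  intros X Y. rewrite RtoC_mult. field. split; apply RtoC_neq; lra.
Qed.

(** The scale k is free because the two integrals need different ones: k = 1 for J at x, and k = x
    for J at 1/x, so that both become integrals in the same variable. *)
Lemma J_integrand_subst (r : nat) (chi1 chi2 : Z -> C) (z : C) (x k : R) (H : R -> C) (l : C) :
  (1 < r)%nat -> chi1 (Z.of_nat r) = 0 -> chi2 (Z.of_nat r) = 0 -> (0 < k)%R ->
  (forall v, (0 < v)%R -> Ccont H v) ->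
  (forall v, (0 < v)%R -> H v = RtoC k * (cpow (k * v) (z - 1) *
    (csum1 (fun d => chi2 (Z.of_nat d) * hfun (rootu r d) (RtoC (k * v))) (r - 1) *
     csum1 (fun c => chi1 (Z.of_nat c) * Lfun (rootu r c) (x * (k * v))) (r - 1)))) ->
  is_CRInt_gen H (at_right 0) (Rbar_locally p_infty) l ->
  is_CRInt_gen (J_integrand r chi1 chi2 z x) (at_right 0) (at_left 1) l.
Proof.
  intros Hr H1 H2 Hk Hc HH Hl.
  assert (HJ : forall v, (0 < v)%R ->
    H v = RtoC (k * exp (- (k * v))) * J_integrand r chi1 chi2 z x (exp (- (k * v)))).
  { intros v Hv. rewrite HH, (RtoC_mult k (exp (- (k * v)))), <- Cmult_assoc by auto. f_equal.
    symmetry. apply J_integrand_exp; auto. now apply Rmult_lt_0_compat. }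
  apply (CRInt_gen_subst_exp _ k); auto.
  - intros t Ht.
    assert (Hpos : forall s, (0 < s < 1)%R -> (0 < - ln s / k)%R).
    { intros s Hs. apply Rdiv_lt_0_compat; auto.
      assert (ln s < ln 1)%R by (apply ln_increasing; lra). rewrite ln_1 in *. lra. }
    (* Continuity on (0, 1) is transported from H by inverting the substitution, v = - ln t / k. *)
    apply (continuous_ext_loc (T := R_UniformSpace) (U := C_UniformSpace) _
      (fun s => / RtoC (k * s) * H (- ln s / k)%R)).
    + assert (Ho : locally t (fun s => (0 < s < 1)%R)).
      { apply (locally_interval _ t 0 1); simpl; try lra. intros y Hy1 Hy2. lra. }
      revert Ho. apply filter_imp. intros s Hs. rewrite HJ by now apply Hpos.
      replace (exp (- (k * (- ln s / k)))) with s.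
      * in_C. field. apply RtoC_neq. assert (0 < k * s)%R by (apply Rmult_lt_0_compat; lra). lra.
      * replace (- (k * (- ln s / k)))%R with (ln s) by (field; lra). rewrite exp_ln; lra.
    + apply Ccont_mult.
      * eapply (Ccont_inv (fun s => RtoC (k * s))).
        -- apply RtoC_neq. assert (0 < k * t)%R by (apply Rmult_lt_0_compat; lra). lra.
        -- apply Cder_RtoC, is_derive_linear.
      * apply (Ccont_comp H (fun s => - ln s / k)%R); [apply Hc; now apply Hpos|].
        apply (ex_derive_continuous (fun s => - ln s / k)%R). auto_derive. lra.
  - eapply (is_RInt_gen_ext (V := C_R_NormedModule)); [|exact Hl].
    apply (filter_imp (F := filter_prod (at_right 0) (Rbar_locally p_infty))
      (fun ab => (fst ab <= snd ab)%R /\ forall t, (fst ab <= t <= snd ab)%R -> (0 < t)%R)).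
    + intros [a b] [Hab Hp] t Ht. cbn [fst snd] in *.
      rewrite Rmin_left, Rmax_right in Ht by auto. apply HJ. apply Hp. lra.
    + apply filter_full. auto.
Qed.

(** * The limit at z = 1 *)

Lemma Clipschitz_filterlim_punctured (f : C -> C) (a w : C) (eta Q : R) :
  (0 < eta)%R -> (0 <= Q)%R ->
  (forall z, (Cmod (z - a) <= eta)%R -> (Cmod (f z - w) <= Q * Cmod (z - a))%R) ->
  filterlim f (locally' (T := C_UniformSpace) a) (locally (T := C_UniformSpace) w).
Proof.
  intros He HQ H. apply (filterlim_locally (U := C_UniformSpace)). intros eps.
  assert (Heps := cond_pos eps).
  (* Balls in C are squares: a point of the square of half-side d is at distance at most 2 d from
     the centre, hence the division by 2. *)
  set (d := (Rmin eta (eps / (Q + 1)) / 2)%R).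
  assert (Hd : (0 < d)%R).
  { unfold d. apply Rdiv_lt_0_compat; [apply Rmin_pos; auto; apply Rdiv_lt_0_compat; lra|lra]. }
  exists (mkposreal d Hd). intros z [Hz1 Hz2] _.
  change (Rabs (fst z - fst a) < d)%R in Hz1. change (Rabs (snd z - snd a) < d)%R in Hz2.
  assert (Hz : (Cmod (z - a) <= 2 * d)%R).
  { eapply Rle_trans; [apply Cmod_le_abs|].
    change (Rabs (fst z - fst a) + Rabs (snd z - snd a) <= 2 * d)%R. lra. }
  assert (Hm1 := Rmin_l eta (eps / (Q + 1))). assert (Hm2 := Rmin_r eta (eps / (Q + 1))).
  assert (H1 := H z ltac:(unfold d in Hz; lra)).
  assert (H2 : (Cmod (f z - w) < eps)%R).
  { eapply Rle_lt_trans; [exact H1|].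
    assert (H3 : (Cmod (z - a) <= eps / (Q + 1))%R) by (unfold d in Hz; lra).
    apply Rle_lt_trans with (Q * (eps / (Q + 1)))%R; [now apply Rmult_le_compat_l|].
    replace (Q * (eps / (Q + 1)))%R with (eps * (Q / (Q + 1)))%R by (field; lra).
    rewrite <- (Rmult_1_r eps) at 2. apply Rmult_lt_compat_l; auto. apply Rlt_div_l; lra. }
  split.
  - change (Rabs (fst (f z - w)%C) < eps)%R. eapply Rle_lt_trans; [apply abs_fst_le|auto].
  - change (Rabs (snd (f z - w)%C) < eps)%R. eapply Rle_lt_trans; [apply abs_snd_le|auto].
Qed.

(** Gamma is itself the Mellin transform of e^(-t), so numerator and denominator are both Lipschitz
    at 1, and the quotient is too wherever the denominator stays away from 0. *)
Lemma Mellin_over_Gamma_limit (g : R -> C) :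
  exp_decay g ->
  filterlim (fun z => - (/ CGamma z * Mellin g z)) (locally' (T := C_UniformSpace) (RtoC 1))
    (locally (T := C_UniformSpace) (- (/ CGamma 1 * Mellin g 1))).
Proof.
  intros Hg.
  destruct (Mellin_lipschitz_1 g Hg) as (K & HK & HKb).
  destruct (Mellin_lipschitz_1 _ exp_decay_exp) as (L & HL & HLb).
  (* On this disc |Gamma(z) - 1| <= L |z - 1| <= 1/2, so |1/Gamma(z)| <= 2. *)
  set (eta := Rmin (1 / 4) (/ (2 * (L + 1)))).
  assert (Heta : (0 < eta)%R) by (apply Rmin_pos; [lra|apply Rinv_0_lt_compat; lra]).
  assert (HM := Cmod_ge_0 (Mellin g 1)).
  apply (Clipschitz_filterlim_punctured _ _ _ eta (2 * (K + Cmod (Mellin g 1) * L))); auto.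
  { assert (0 <= Cmod (Mellin g 1) * L)%R by now apply Rmult_le_pos. lra. }
  intros z Hz.
  assert (Hz4 : (Cmod (z - 1) <= 1 / 4)%R) by (eapply Rle_trans; [exact Hz|apply Rmin_l]).
  assert (Hz5 : (Cmod (z - 1) <= / (2 * (L + 1)))%R) by (eapply Rle_trans; [exact Hz|apply
    Rmin_r]).
  assert (Hzp : (0 < fst z)%R).
  { assert (A := Rle_trans _ _ _ (abs_fst_le (z - 1)) Hz4). apply Rabs_le_between in A.
    destruct z; simpl in *. lra. }
  assert (H1p : (0 < fst (RtoC 1))%R) by (simpl; lra).
  rewrite !CGamma_pos, Gamma_int_1 by auto.
  specialize (HKb z Hz4). specialize (HLb z Hz4).
  rewrite <- (Gamma_int_Mellin z), <- (Gamma_int_Mellin 1), Gamma_int_1 in HLb.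
  assert (Hw := Cmod_ge_0 (z - 1)).
  assert (HG : (1 / 2 <= Cmod (Gamma_int z))%R).
  { assert (A : (L * Cmod (z - 1) <= 1 / 2)%R).
    { apply Rle_trans with (L * / (2 * (L + 1)))%R; [now apply Rmult_le_compat_l|].
      replace (L * / (2 * (L + 1)))%R with ((L / (L + 1)) * (1 / 2))%R by (field; lra).
      assert (L / (L + 1) <= 1)%R by (apply Rle_div_l; lra). lra. }
    assert (B := Cmod_triangle (Gamma_int z) (1 - Gamma_int z)).
    replace (Gamma_int z + (1 - Gamma_int z)) with (RtoC 1) in B by ring.
    rewrite Cmod_1 in B. rewrite Cmod_minus_sym in HLb. lra. }
  assert (HG0 : Gamma_int z <> 0) by (apply Cmod_gt_0; lra).
  replace (- (/ Gamma_int z * Mellin g z) - - (/ 1 * Mellin g 1)) with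
    (/ Gamma_int z * (- (Mellin g z - Mellin g 1) + Mellin g 1 * (Gamma_int z - 1))) by (field;
      auto).
  rewrite Cmod_mult, Cmod_inv by auto.
  assert (Hi : (/ Cmod (Gamma_int z) <= 2)%R).
  { replace 2%R with (/ (1 / 2))%R by field. apply Rinv_le_contravar; lra. }
  rewrite Rmult_assoc.
  apply Rmult_le_compat; try apply Cmod_ge_0; auto.
  { left. apply Rinv_0_lt_compat. lra. }
  apply Cmod_triangle_le. rewrite Cmod_opp, Cmod_mult, Rmult_plus_distr_r.
  apply Rplus_le_compat; auto. rewrite Rmult_assoc. now apply Rmult_le_compat_l.
Qed.

Lemma is_W_Mellin (r c d : nat) (z : C) (x delta : R) :
  (1 < r)%nat -> (1 <= c <= r - 1)%nat -> (1 <= d <= r - 1)%nat ->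
  (0 < fst z)%R -> (0 < x)%R ->
  (0 < delta < Rmin (2 * PI / INR r) (2 * PI / (INR r * x)))%R ->
  is_W r c d z x delta (- (/ CGamma z * Mellin (dLprod (rootu r c) (rootu r d) x) z)).
Proof.
  intros Hr Hc Hd Hz Hx Hdelta. assert (HPI := PI_RGT_0).
  assert (Hr0 : (0 < INR r)%R) by (apply lt_0_INR; lia).
  (* The fractions c/r and d/r stay at distance at least 1/r from 0 and 1, so no singularity is
     closer to 0 than 2 pi / r. The two bounds on delta put delta and x delta inside that radius. *)
  assert (Hfrac : forall a, (1 <= a <= r - 1)%nat ->
    (2 * PI / INR r <= 2 * PI * (INR a / INR r))%R /\ (2 * PI / INR r <= 2 * PI * (1 - INR a /
      INR r))%R /\
    (0 < INR a / INR r < 1)%R).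
  { intros a [Ha1 Ha2].
    assert (A1 : (1 <= INR a)%R) by (apply (le_INR 1); auto).
    assert (A2 : (INR a + 1 <= INR r)%R) by (rewrite <- S_INR; apply le_INR; lia).
    assert (Hi : (0 < / INR r)%R) by now apply Rinv_0_lt_compat.
    assert (E : (INR r * / INR r = 1)%R) by (apply Rinv_r; lra).
    assert (B1 : (/ INR r <= INR a * / INR r)%R) by nra.
    assert (B2 : (INR a * / INR r + / INR r <= 1)%R) by nra.
    unfold Rdiv. repeat split; nra. }
  destruct (Hfrac c Hc) as (C1 & C2 & C3). destruct (Hfrac d Hd) as (D1 & D2 & D3).
  assert (Hd1 : (delta < 2 * PI / INR r)%R) by (eapply Rlt_le_trans; [apply Hdelta|apply Rmin_l]).
  assert (Hd2 : (x * delta < 2 * PI / INR r)%R).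
  { assert (A : (delta < 2 * PI / (INR r * x))%R) by (eapply Rlt_le_trans; [apply Hdelta|apply
      Rmin_r]).
    apply (Rmult_lt_compat_l x) in A; auto.
    replace (x * (2 * PI / (INR r * x)))%R with (2 * PI / INR r)%R in A by (field; lra).
    exact A. }
  assert (HW : forall z' : C, (0 < fst z')%R -> z' <> 1 ->
    is_W_formula r c d z' x delta (- (/ CGamma z' * Mellin (dLprod (rootu r c) (rootu r d) x)
      z'))).
  { intros z' Hz' Hz1. apply is_W_formula_Mellin; auto; lra. }
  split.
  - intros Hz1. now apply HW.
  - intros ->.
    exists (fun z' => - (/ CGamma z' * Mellin (dLprod (rootu r c) (rootu r d) x) z')). split.
    + assert (Hh : (0 < 1 / 2)%R) by lra. exists (mkposreal _ Hh). intros z' [Hz' _] Hne.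
      change (Rabs (fst z' - 1) < 1 / 2)%R in Hz'. apply Rabs_lt_between in Hz'.
      apply HW; auto. lra.
    + apply Mellin_over_Gamma_limit. apply exp_decay_dLprod; auto; try apply Cmod_e2pi;
        now apply fst_e2pi_lt_1.
Qed.

Theorem theorem5p3 :
  forall (r : nat) (chi1 chi2 : Z -> C) (z : C) (x delta : R),
    (1 < r)%nat ->
    dirichlet_character r chi1 ->
    dirichlet_character r chi2 ->
    (0 < fst z)%R ->
    (0 < x)%R ->
    (0 < delta < Rmin (2 * PI / INR r) (2 * PI / (INR r * x)))%R ->
    J_converges r chi1 chi2 z x /\
    J_converges r chi2 chi1 z (1 / x) /\
    exists W : nat -> nat -> C,
      (forall c d : nat,
         (1 <= c <= r - 1)%nat -> (1 <= d <= r - 1)%nat ->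
         is_W r c d z x delta (W c d)) /\
      (J r chi1 chi2 z x + cpow x (1 - z) * J r chi2 chi1 z (1 / x)
       = - sum_n_m (G := C_AbelianMonoid)
             (fun c : nat =>
                sum_n_m (G := C_AbelianMonoid)
                  (fun d : nat =>
                     chi1 (Z.of_nat c) * chi2 (Z.of_nat d) * W c d)
                  1 (r - 1))
             1 (r - 1))%C.
Proof.
  intros r chi1 chi2 z x delta Hr Hchi1 Hchi2 Hz Hx Hdelta.
  assert (H1 := dirichlet_character_modulus r chi1 Hr Hchi1).
  assert (H2 := dirichlet_character_modulus r chi2 Hr Hchi2).
  assert (Hr0 : (0 < INR r)%R) by (apply lt_0_INR; lia).
  assert (Hq1 : forall j, Cmod (rootu r j) = 1%R) by (intros; apply Cmod_e2pi).
  assert (Hq : forall j, (1 <= j <= r - 1)%nat -> (fst (rootu r j) < 1)%R).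
  { intros j Hj. apply fst_e2pi_lt_1.
    assert (A1 : (0 < INR j)%R) by (apply lt_0_INR; lia).
    assert (A2 : (INR j < INR r)%R) by (apply lt_INR; lia).
    split; [now apply Rdiv_lt_0_compat|]. apply Rlt_div_l; lra. }
  set (x1 := fun c => chi1 (Z.of_nat c)). set (x2 := fun d => chi2 (Z.of_nat d)).
  set (f := fun c d u => hfun (rootu r d) (RtoC u) * Lfun (rootu r c) (x * u)).
  set (g := fun c d u => RtoC x * hfun (rootu r c) (RtoC (x * u)) * Lfun (rootu r d) u).
  assert (Hf : forall c d, (1 <= c <= r - 1)%nat -> (1 <= d <= r - 1)%nat -> exp_decay (f c d)).
  { intros c d Hc Hd. apply exp_decay_hfun_Lfun; auto. }
  assert (Hg : forall c d, (1 <= c <= r - 1)%nat -> (1 <= d <= r - 1)%nat -> exp_decay (g c d)).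
  { intros c d Hc Hd. apply exp_decay_hfun_Lfun'; auto. }
  assert (Hcont : forall h, exp_decay h -> forall v, (0 < v)%R -> Ccont (fun v => cpow v (z - 1)
    * h v) v).
  { intros h [Hh _] v Hv. apply Ccont_mult; [now apply Ccont_cpow|auto]. }
  (* Stated for arbitrary kernels and weights, since the two integrals J differ in both. *)
  assert (Hsum : forall (h : nat -> nat -> R -> C) (a : nat -> nat -> C),
    (forall c d, (1 <= c <= r - 1)%nat -> (1 <= d <= r - 1)%nat -> exp_decay (h c d)) ->
    is_CRInt_gen (fun v => csum1 (fun c => csum1 (fun d => a c d * (cpow v (z - 1) * h c d v)) (r
      - 1)) (r - 1))
      (at_right 0) (Rbar_locally p_infty) (csum1 (fun c => csum1 (fun d => a c d * Mellin (h c d)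
        z) (r - 1)) (r - 1)) /\
    forall v, (0 < v)%R -> Ccont (fun v => csum1 (fun c => csum1 (fun d => a c d * (cpow v (z -
      1) * h c d v)) (r - 1)) (r - 1)) v).
  { intros h a Hh. split.
    - replace (r - 1)%nat with (S (r - 2)) in * by lia.
      refine (CRInt_gen_csum1 (fun c v => csum1 (fun d => a c d * (cpow v (z - 1) * h c d v)) (S
        (r - 2))) _ _
        (at_right 0) (Rbar_locally p_infty) _). intros c Hc.
      refine (CRInt_gen_csum1 (fun d v => a c d * (cpow v (z - 1) * h c d v)) _ _
        (at_right 0) (Rbar_locally p_infty) _). intros d Hd.
      exact (CRInt_gen_scal (a c d) _ _ _ _ (Mellin_correct (h c d) z (Hh c d Hc Hd) Hz)).
    - intros v Hv.
      apply (Ccont_csum1 (fun c v => csum1 (fun d => a c d * (cpow v (z - 1) * h c d v)) (r -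
        1))). intros c Hc.
      apply (Ccont_csum1 (fun d v => a c d * (cpow v (z - 1) * h c d v))). intros d Hd.
      apply Ccont_mult; [apply Ccont_const|]. apply Hcont; auto. }
  destruct (Hsum f (fun c d => x1 c * x2 d) Hf) as [I1 C1].
  (* The weight x^(z-1) comes from (xv)^(z-1) in the second substitution and is cancelled by the
     factor x^(1-z) in the theorem; the Jacobian x is already part of g. *)
  destruct (Hsum g (fun c d => cpow x (z - 1) * (x1 c * x2 d)) Hg) as [I2 C2].
  assert (J1 := fun E => J_integrand_subst r chi1 chi2 z x 1 _ _ Hr H1 H2 Rlt_0_1 C1 E I1).
  assert (J2 := fun E => J_integrand_subst r chi2 chi1 z (1 / x) x _ _ Hr H2 H1 Hx C2 E I2).
  match type of J1 with ?A -> _ => assert (E1 : A) end.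
  { intros v Hv.
    rewrite !Rmult_1_l, Cmult_1_l, (Cmult_comm (csum1 _ _)), csum1_prod, <- csum1_mult_l.
    apply csum1_ext. intros c _. rewrite <- csum1_mult_l. apply csum1_ext. intros d _.
    unfold f, x1, x2. ring. }
  match type of J2 with ?A -> _ => assert (E2 : A) end.
  { intros v Hv. rewrite csum1_prod, <- !csum1_mult_l.
    apply csum1_ext. intros c _. rewrite <- !csum1_mult_l. apply csum1_ext. intros d _.
    rewrite cpow_mul by auto. replace (1 / x * (x * v))%R with v by (field; lra).
    unfold g, x1, x2. ring. }
  specialize (J1 E1). specialize (J2 E2).
  split; [eexists; exact J1|]. split; [eexists; exact J2|].
  exists (fun c d => - (/ CGamma z * Mellin (dLprod (rootu r c) (rootu r d) x) z)). split.
  - intros c d Hc Hd. now apply is_W_Mellin.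
  - unfold J.
    rewrite (CRInt_gen_eq _ _ _ _ J1).
    rewrite (CRInt_gen_eq _ _ _ _ J2).
    change (sum_n_m (G := C_AbelianMonoid) ?f 1 (r - 1)) with (csum1 f (r - 1)).
    rewrite (csum1_ext (fun c => sum_n_m _ 1 (r - 1))
      (fun c => - / CGamma z * csum1 (fun d => x1 c * x2 d * Mellin (f c d) z + x1 c * x2 d *
        Mellin (g c d) z) (r - 1))).
    2: { intros c Hc. rewrite <- csum1_mult_l. apply csum1_ext. intros d Hd.
         assert (EM : Mellin (dLprod (rootu r c) (rootu r d) x) z = Mellin (f c d) z + Mellin (g
           c d) z).
         { apply Mellin_eq. unfold is_Mellin.
           assert (A := CRInt_gen_plus _ _ _ _ _ _ (Mellin_correct (f c d) z (Hf c d Hc Hd) Hz)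
             (Mellin_correct (g c d) z (Hg c d Hc Hd) Hz)).
           refine (CRInt_gen_ext _ _ _ _ _ _ A). intros t. unfold dLprod, f, g. ring. }
         rewrite EM. unfold x1, x2. ring. }
    rewrite csum1_mult_l.
    rewrite (csum1_ext (fun c => csum1 (fun d => cpow x (z - 1) * (x1 c * x2 d) * Mellin (g c d)
      z) (r - 1))
      (fun c => cpow x (z - 1) * csum1 (fun d => x1 c * x2 d * Mellin (g c d) z) (r - 1))).
    2: { intros c _. rewrite <- csum1_mult_l. apply csum1_ext. intros d _. ring. }
    rewrite csum1_mult_l.
    rewrite (csum1_ext (fun c => csum1 (fun d => x1 c * x2 d * Mellin (f c d) z + x1 c * x2 d *
      Mellin (g c d) z) (r - 1))
      (fun c => csum1 (fun d => x1 c * x2 d * Mellin (f c d) z) (r - 1) + csum1 (fun d => x1 c *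
        x2 d * Mellin (g c d) z) (r - 1)))
      by (intros; apply csum1_plus).
    rewrite csum1_plus.
    replace (1 - z) with (- (z - 1)) by ring. rewrite cpow_opp.
    assert (Hn := cpow_neq_0 x (z - 1)).
    generalize (/ CGamma z). intros G. field. exact Hn.
Qed.
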